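(* There exist a constant $K$ and, for every $p\in(0,1/2]$, a constant $I_p$ such that the following holds. Let $n$ be such that $pn$ is an integer, and let $f\in\mathbb{R}[x_1,\dots,x_n]$ be a harmonic multilinear polynomial of degree $d$ such that with respect to $\nu_{pn}$, $\mathbb{V}[f]\le 1$ and $\mathrm{Inf}^s_i[f]\le\tau$ for all $i\in[n]$. Let $\delta>0$ and suppose that $\tau\le I_p^{-d}\delta^K$ and $n\ge I_p^d/\delta^K$. Then for any $C$-Lipschitz functional $\psi\colon\mathbb{R}\to\mathbb{R}$ and for $\pi\in\{\mathcal{G}_p,\mu_p\}$, $$\left|\mathbb{E}_{\nu_{pn}}[\psi(f)]-\mathbb{E}_{\pi}[\psi(f)]\right|=O_p(C\delta).$$ The condition $\mathrm{Inf}^s_i[f]\le\tau$ for all $i\in[n]$ can be replaced by the condition $\mathrm{Inf}^c_i[f]_{\mu_p}\le\tau$ for all $i\in[n]$.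
   Context: $[n]=\{1,\dots,n\}$. The slice is $\binom{[n]}{k}=\{x\in\{0,1\}^n: x_1+\cdots+x_n=k\}$, and $\nu_k$ is the uniform distribution on it. $\mu_p$ is the product distribution on $\{0,1\}^n$ with marginals $\mathrm{Ber}(p)$. $\mathcal{G}_p$ is the Gaussian measure $\mathrm{N}((p,\dots,p),p(1-p)I_n)$ on $\mathbb{R}^n$. A polynomial $f\in\mathbb{R}[x_1,\dots,x_n]$ is multilinear if $\partial^2 f/\partial x_i^2=0$ for all $i$; it is harmonic if $\sum_{i=1}^n \partial f/\partial x_i=0$. $\mathbb{V}$ denotes variance. Slice-influences: $f^{(ij)}(x)=f(x^{(ij)})$, where $x^{(ij)}$ is $x$ with coordinates $i,j$ swapped; $\mathrm{Inf}^s_{ij}[f]=\mathbb{E}_{\nu_{pn}}[(f-f^{(ij)})^2]$ and $\mathrm{Inf}^s_i[f]=\frac1n\sum_{j=1}^n\mathrm{Inf}^s_{ij}[f]$. Cube-influences: $\mathrm{Inf}^c_i[f]_{\mu_p}=\mathbb{E}_{\mu_p}[(\partial f/\partial x_i)^2]$. A function $\psi$ is $C$-Lipschitz if $|\psi(x)-\psi(y)|\le C|x-y|$ for all $x,y$. Notation: $A=O_p(B)$ means that for all $n\ge N(p)$ one has $A\le c(p)B$, where $N(p),c(p)$ depend only on $p$ and are continuous in $p$; constants with subscript $p$ likewise depend only on $p$, continuously.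
   Formalization: It is additionally assumed that δ ≤ 1 or d ≤ pn; without this the claim is false, since for p < 1/2 and d > pn a large multiple of ∏(x_{2i−1} − x_{2i}) over d pairs vanishes on the slice but has unbounded expectation of |f| under μ_p. *)

(* Defs.v *)
From HB Require Import structures.
From mathcomp Require Import all_boot all_order all_algebra all_fingroup.
(* Not imported: the notations of mpoly clash with those of mathcomp-analysis. *)
From mathcomp Require Import -(notations) mpoly.
From mathcomp Require Import all_classical all_reals all_analysis.

Set Implicit Arguments.
Unset Strict Implicit.
Unset Printing Implicit Defensive.

Import Order.TTheory GRing.Theory Num.Theory.
Import numFieldNormedType.Exports.

Local Open Scope ring_scope.

Section Polynomials.
Context {R : nzRingType} {n : nat}.
Implicit Types f : mpoly n R.

Definition mpoly_multilinear f := forall i, mderiv i (mderiv i f) = 0.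

Definition mpoly_harmonic f := \sum_(i < n) mderiv i f = 0.

(* [mmeasure mdeg] (i.e. [msize]) is 1 + the total degree; the zero polynomial gets degree 0. *)
Definition mdegree f : nat := (mmeasure mdeg f).-1.

End Polynomials.

Section Cube.
Context {R : realType} {n : nat}.
Local Notation cube := {ffun 'I_n -> bool}.
Implicit Types (x : cube) (f : mpoly n R).

Definition slice (k : nat) : {set cube} :=
  [set x : cube | (\sum_(i < n) x i == k)%N]%SET.

Definition cube_eval f x : R := meval (fun i => (x i)%:R) f.

Definition coord_swap (i j : 'I_n) x : cube := [ffun l => x (tperm i j l)].

Definition slice_expect (k : nat) (g : cube -> R) : R :=
  (\sum_(x in slice k) g x) / #|slice k|%:R.

Definition slice_var (k : nat) (g : cube -> R) : R :=
  slice_expect k (fun x => (g x - slice_expect k g) ^+ 2).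

Definition cube_expect (p : R) (g : cube -> R) : R :=
  \sum_(x : cube) (\prod_(i < n) bernoulli_pmf p (x i)) * g x.

Definition slice_inf2 (k : nat) f (i j : 'I_n) : R :=
  slice_expect k (fun x => (cube_eval f x - cube_eval f (coord_swap i j x)) ^+ 2).

Definition slice_inf (k : nat) f (i : 'I_n) : R :=
  n%:R^-1 * \sum_(j < n) slice_inf2 k f i j.

Definition cube_inf (p : R) f (i : 'I_n) : R :=
  cube_expect p (fun x => cube_eval (mderiv i f) x ^+ 2).

End Cube.

Section ProductMeasure.
Context {R : realType} {d : measure_display} {T : measurableType d}.
Variable P : probability T R.

Section Cons.
Variable n : nat.

Definition tuple_cons (xt : T * n.-tuple T) : n.+1.-tuple T :=
  [tuple of xt.1 :: xt.2].

Lemma measurable_tuple_cons : measurable_fun setT tuple_cons.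
Proof.
exact: (measurable_cons (@measurable_fst _ _ T (n.-tuple T))
                        (@measurable_snd _ _ T (n.-tuple T))).
Qed.

HB.instance Definition _ :=
  isMeasurableFun.Build _ _ _ _ tuple_cons measurable_tuple_cons.

End Cons.

Fixpoint iid (n : nat) : probability (n.-tuple T) R :=
  match n with
  | 0 => \d_([tuple] : 0.-tuple T)
  | m.+1 => distribution (P \x iid m)%E (@tuple_cons m)
  end.

End ProductMeasure.

(* [normal_prob] takes the standard deviation, not the variance. *)
Definition gauss {R : realType} (p : R) (n : nat) : probability (n.-tuple (measurableTypeR R)) R :=
  iid (normal_prob p (Num.sqrt (p * (1 - p))) : probability (measurableTypeR R) R) n.

Definition tuple_eval {R : realType} {n : nat} (f : mpoly n R)
  (x : n.-tuple R) : R := meval (tnth x) f.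

(* Main.v *)
(* A harmonic polynomial is invariant under translation along (1,...,1), so f is a multilinear
   polynomial in the centered variables x_i - p, with coefficients c.

   Slice versus cube: a uniformly random ordering of the coordinates couples all slices monotonically
   (X_l switches on the first l coordinates). For the homogeneous part f_e of degree e the correlations
   E[f_e(X_k) f_e(X_l)] are explicit multiples of E[f_e(X_k)^2], and distinct degrees are orthogonal on
   a slice. Hence f_e(X_k) and f_e(X_l) are L2-close when l is distributed as the weight of a
   mu_p-random point, because then |k - l| is about sqrt n; this also compares the L2 norms on the
   slice and on the cube.

   Cube versus Gaussian space: the Lindeberg replacement argument, after smoothing psi at scale delta.
   The error is controlled by the cube influences, and these are bounded by slice influences because
   (n - |T|) c(T u i) = sum_{j not in T} (c(T u i) - c(T u j)) by harmonicity.

   When delta > 1, psi(f) is compared with psi(E f) on each of the three spaces. *)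
From HB Require Import structures.
Require Import Defs.
From mathcomp Require Import all_boot all_order all_algebra all_fingroup.
From mathcomp Require Import -(notations) mpoly.
From mathcomp Require Import all_classical all_reals all_analysis.
From mathcomp Require Import measurable_realfun.
From mathcomp Require Import ring lra zify.
Import Order.TTheory GRing.Theory Num.Theory.
Import numFieldNormedType.Exports.

Set Implicit Arguments.
Unset Strict Implicit.
Unset Printing Implicit Defensive.

Local Open Scope classical_set_scope.
Local Open Scope ring_scope.

(** [wnorm 4] is an L2 norm in which every coordinate has weight 4 instead of its variance p(1-p).
    With that weight, the bound of the fourth moment by [wnorm 4 c ^+ 2] survives the addition of
    one coordinate, so no separate hypercontractivity theorem enters; in degree d the change of
    weight costs (4/(p(1-p)))^d, a source of the power I_p^d. Third moments in the replacement are
    split as 2|r|^3 <= l r^2 + r^4/l, so that only second and fourth moments occur. Smoothing at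
    scale delta produces a third-order constant of order C/delta^2, and the optimal l makes the
    replacement sum of order sqrt(tau), up to factors exponential in d. Requiring C
    sqrt(tau)/delta^2 <= C delta gives tau <= delta^6, hence K = 6. The obstacle is a degree close
    to k: the second moment on a slice may then be much smaller than on the cube. Their ratio is at
    most 4 when 2d^2 <= k, which the lower bound on n forces for delta <= 1. For delta > 1 only d <=
    k is available; the ratio is then at most 256^d, and the size of I_p lets delta^2 absorb it. *)

(** * Integration against a density *)

Section Density.
Local Open Scope ereal_scope.
Context {d : measure_display} {T : measurableType d} {R : realType}.
Variables (mu nu : {measure set T -> \bar R}) (g : T -> R).
Hypothesis g_ge0 : forall x, (0 <= g x)%R.
Hypothesis mg : measurable_fun setT g.
Hypothesis nuE : forall A, measurable A -> nu A = \int[mu]_(x in A) (g x)%:E.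

Import HBNNSimple.

Let nnsfun_density (f : {nnsfun T >-> R}) :
  \int[nu]_x (f x)%:E = \int[mu]_x ((f x)%:E * (g x)%:E).
Proof.
under [LHS]eq_integral do rewrite fimfunE -fsumEFin//.
rewrite [LHS]ge0_integral_fsum//; last 2 first.
  - by move=> r; exact/measurable_EFinP/measurableT_comp.
  - by move=> n x _; rewrite EFinM nnfun_muleindic_ge0.
under [RHS]eq_integral.
  move=> x xD; rewrite fimfunE -fsumEFin// muleC ge0_mule_fsumr; last first.
    by move=> r; rewrite EFinM nnfun_muleindic_ge0.
  over.
rewrite [RHS]ge0_integral_fsum//; last 2 first.
  - move=> r; apply/measurable_EFinP; apply: measurable_funM => //.
    by apply: measurable_funM => //; exact: measurable_indic.
  - move=> n x _; rewrite EFinM mule_ge0//; last by rewrite nnfun_muleindic_ge0.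
    by rewrite lee_fin.
apply: eq_fsbigr => r _; rewrite integralZl_indic_nnsfun//= integral_indic//.
rewrite setIT nuE// integral_mkcond.
have [r0|r0] := leP 0%R r; last first.
  rewrite preimage_nnfun0// .
  under eq_integral do rewrite patchE in_set0.
  under [in RHS]eq_integral do rewrite indicE in_set0 mulr0 mule0.
  by rewrite !integral0 mule0.
rewrite -ge0_integralZl//.
- apply: eq_integral => x _; rewrite patchE indicE.
  by case: ifPn => _; rewrite ?mulr1 ?mulr0 ?mule0// muleC.
- rewrite -(setTI (f @^-1` [set r])); apply/(measurable_restrictT _ _).1 => //.
    by rewrite setTI.
  by apply/measurable_EFinP; apply: measurable_funTS.
- by move=> x _; rewrite patchE; case: ifPn => // _; rewrite lee_fin.
Qed.

(** True for simple functions by linearity, then by monotone convergence on both sides. It turns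
    integrals against [normal_prob] into Lebesgue integrals of the normal density. *)
Lemma ge0_integral_density (f : T -> \bar R) :
  measurable_fun setT f -> (forall x, 0 <= f x) ->
  \int[nu]_x f x = \int[mu]_x (f x * (g x)%:E).
Proof.
move=> mf f0.
pose f_ := nnsfun_approx measurableT mf.
transitivity (limn (fun n => \int[nu]_x (f_ n x)%:E)).
  rewrite -monotone_convergence//=.
  - apply: eq_integral => ? /[!inE] xD; apply/esym/cvg_lim => //=.
    exact: cvg_nnsfun_approx.
  - by move=> n; exact/measurable_EFinP/measurable_funTS.
  - by move=> n ? _; rewrite lee_fin.
  - by move=> ? _ ? ? mn; rewrite lee_fin; exact/lefP/nd_nnsfun_approx.
transitivity (limn (fun n => \int[mu]_x ((f_ n x)%:E * (g x)%:E))).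
  by apply: congr_lim; apply/funext => n; exact: nnsfun_density.
rewrite -monotone_convergence//=.
- apply: eq_integral => x /[!inE] xD; apply/cvg_lim => //=.
  under eq_fun do rewrite muleC.
  rewrite muleC; apply: cvgeZl => //.
  exact: cvg_nnsfun_approx.
- move=> n; apply/measurable_EFinP; apply: measurable_funM => //.
- by move=> n ? _; rewrite lee_fin mulr_ge0.
- move=> x _ ? ? mn; rewrite lee_fin ler_wpM2r//.
  exact/lefP/nd_nnsfun_approx.
Qed.

End Density.

(** * Real analysis and Gaussian moments *)

Section Taylor.
Context {R : realType}.
Implicit Types (f G : R -> R) (a h B L : R).

Lemma derive_bound_lipschitz f f' a h B : (forall x : R, is_derive x (1 : R) f (f' x)) ->
  (forall x, `|x - a| <= `|h| -> `|f' x| <= B) ->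
  `|f (a + h) - f a| <= `|h| * B.
Proof.
move=> df fB; have cf x : {for x, continuous f}.
  by apply/differentiable_continuous/derivable1_diffP; have [] := df x.
have [h0|h0] := leP 0 h.
  have [||c] := @MVT_segment _ f f' a (a + h).
  - by rewrite lerDl.
  - by apply: continuous_subspaceT => x; exact: cf.
  rewrite in_itv/= => /andP[ac ch] ->.
  rewrite addrAC subrr add0r normrM mulrC ler_wpM2l//; apply: fB.
  by rewrite !ger0_norm ?subr_ge0// lerBlDl.
have [||c] := @MVT_segment _ f f' (a + h) a.
- by rewrite gerDl ltW.
- by apply: continuous_subspaceT => x; exact: cf.
rewrite in_itv/= => /andP[ac ch].
rewrite distrC => ->; rewrite opprD addrA subrr add0r normrM normrN mulrC.
rewrite ler_wpM2l//; apply: fB.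
rewrite ler0_norm ?subr_le0// ler0_norm ?(ltW h0)//; lra.
Qed.

(** The mean value bound is applied to the remainder [r] and to its derivative [r1], both zero at 0;
    the sharper constant 1/6 is given up. [G2] is compared only with its value at [a], so a
    Lipschitz second derivative is enough. *)
Lemma taylor2_bound G G1 G2 a h L :
  (forall x : R, is_derive x (1 : R) G (G1 x)) -> (forall x : R, is_derive x (1 : R) G1 (G2 x)) ->
  (forall x, `|x - a| <= `|h| -> `|G2 x - G2 a| <= L * `|x - a|) ->
  `|G (a + h) - G a - h * G1 a - h ^+ 2 / 2 * G2 a| <= L * `|h| ^+ 3.
Proof.
move=> dG dG1 GL.
have [->|h0] := eqVneq h 0.
  by rewrite addr0 subrr normr0 expr0n expr0n /= !mul0r mulr0 !subr0 normr0.
have L0 : 0 <= L.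
  have /GL : `|a + h - a| <= `|h| by rewrite addrAC subrr add0r.
  rewrite addrAC subrr add0r => /(le_trans (normr_ge0 _)).
  by rewrite pmulr_lge0// normr_gt0.
pose r t := G (a + t) - G a - t * G1 a - t ^+ 2 / 2 * G2 a.
pose r1 t := G1 (a + t) - G1 a - t * G2 a.
have sh (f f' : R -> R) (x : R) : (forall x : R, is_derive x (1 : R) f (f' x)) ->
    is_derive x (1 : R) (fun t => f (a + t)) (f' (a + x)).
  move=> df; have := df (a + x) => dfa.
  have := @is_derive1_comp _ f (fun t => a + t) x (f' (a + x)) 1.
  rewrite mulr1; apply => //.
  rewrite -[X in is_derive _ _ _ X]add0r; exact: (@is_deriveD _ _ _ (cst a) id).
have dr (t : R) : is_derive t (1 : R) r (r1 t).
  rewrite /r; have dGt := sh _ _ t dG.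
  apply: is_derive_eq; rewrite /r1 /GRing.scale/=; lra.
have dr1 (t : R) : is_derive t (1 : R) r1 (G2 (a + t) - G2 a).
  rewrite /r1; have dGt := sh _ _ t dG1.
  apply: is_derive_eq; rewrite /GRing.scale/=; lra.
have r10 : r1 0 = 0 by rewrite /r1 addr0 subrr mul0r subr0.
have r0 : r 0 = 0 by rewrite /r addr0 subrr !mul0r expr0n/= !mul0r !subr0.
have r1B t : `|t| <= `|h| -> `|r1 t| <= L * `|h| ^+ 2.
  move=> th; rewrite -(subr0 (r1 t)) -r10 -[in r1 t](add0r t).
  apply: le_trans (derive_bound_lipschitz dr1 (B := L * `|h|) _) _.
    move=> x; rewrite subr0 => xt; apply: le_trans (GL _ _) _.
      by rewrite addrAC subrr add0r (le_trans xt).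
    by rewrite addrAC subrr add0r ler_wpM2l// (le_trans xt).
  by rewrite mulrCA ler_wpM2l// expr2 ler_wpM2r.
rewrite -[X in `|X|]/(r h) -(subr0 (r h)) -r0 -[in r h](add0r h).
apply: le_trans (derive_bound_lipschitz dr (B := L * `|h| ^+ 2) _) _.
  by move=> x; rewrite subr0 => /r1B.
by rewrite mulrCA -exprS.
Qed.

Lemma expR_sub1_le (x : R) : `|expR x - 1| <= `|x| * expR `|x|.
Proof.
rewrite -expR0 -[in expR x](add0r x).
apply: (derive_bound_lipschitz (f' := expR)) => y.
rewrite subr0 => yx; rewrite ger0_norm ?expR_ge0// ler_expR.
by rewrite (le_trans _ yx)// ler_norm.
Qed.

Lemma expR_taylor2 (x : R) :
  `|expR x - 1 - x - x ^+ 2 / 2| <= `|x| ^+ 3 * expR `|x|.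
Proof.
have := @taylor2_bound expR expR expR 0 x (expR `|x|).
rewrite add0r expR0 !mulr1 (mulrC (expR _)); apply => y; rewrite subr0 => yx.
rewrite -{1}expR0 expR0 mulrC (le_trans (expR_sub1_le _))// ler_wpM2l// ler_expR//.
Qed.

End Taylor.

Lemma le0_of_le_linear (R : realFieldType) (x C : R) :
  (forall t, 0 < t <= 1 -> x <= C * t) -> x <= 0.
Proof.
move=> xC; rewrite leNgt; apply/negP => x0.
have C1 : 0 < `|C| + 1 by rewrite ltr_pwDr.
pose t := Num.min 1 (x / (2 * (`|C| + 1))).
have t0 : 0 < t by rewrite lt_min ltr01/= divr_gt0 ?mulr_gt0.
have := xC t; rewrite t0 ge_min lexx => /(_ isT).
apply/negP; rewrite -ltNge.
have tx : t * (2 * (`|C| + 1)) <= x by rewrite -ler_pdivlMr ?mulr_gt0// ge_min lexx orbT.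
have := ler_norm C; nra.
Qed.

Section EFinIntegrable.
Context {d : measure_display} {T : measurableType d} {R : realType}.
Variable mu : {measure set T -> \bar R}.
Local Notation intble f := (mu.-integrable setT (EFin \o f)).
Implicit Types f g : T -> R.

Lemma EFin_integrableZl (r : R) f : intble f -> intble (fun x => r * f x).
Proof. exact: integrableZl. Qed.

Lemma EFin_integrableD f g : intble f -> intble g -> intble (fun x => f x + g x).
Proof. exact: integrableD. Qed.

Lemma EFin_integrableB f g : intble f -> intble g -> intble (fun x => f x - g x).
Proof. exact: integrableB. Qed.

Lemma EFin_le_integrable f g : measurable_fun setT f ->
  (forall x, `|f x| <= g x) -> intble g -> intble f.
Proof.
move=> mf fg ig; apply: (@le_integrable _ _ _ _ _ measurableT _ (EFin \o g)) => //.
  exact/measurable_EFinP.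
by move=> x _ /=; rewrite lee_fin (le_trans (fg x))// ler_norm.
Qed.

Lemma EFin_measurable f : intble f -> measurable_fun setT f.
Proof. by move=> /integrableP[/measurable_EFinP]. Qed.

Lemma EFin_Rintegral f : intble f -> (\int[mu]_x (f x)%:E)%E = (\int[mu]_x f x)%:E.
Proof. by move=> fi; rewrite /Rintegral fineK// integrable_fin_num. Qed.

End EFinIntegrable.

Lemma Rintegral_probability_cst {d : measure_display} {T : measurableType d}
    {R : realType} (P : probability T R) (r : R) : \int[P]_x r = r.
Proof.
rewrite Rintegral_cst//.
by have /(congr1 fine) /= -> := @probability_setT _ _ _ P; rewrite mulr1.
Qed.

Section NormalMoments.
Context {R : realType}.
Variables (m s : R).
Hypothesis s_neq0 : s != 0.
Local Notation P := (normal_prob m s).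

(** Completing the square turns the tilted density into a constant times the normal density of mean
    m + t s^2, whose total mass is 1. All moments below are extracted from this formula. *)
Lemma normal_mgf (t : R) :
  (\int[P]_x (expR (t * (x - m)))%:E = (expR (t ^+ 2 * s ^+ 2 / 2))%:E)%E.
Proof.
rewrite (@ge0_integral_density _ _ _ lebesgue_measure _ (normal_pdf m s)) //.
- transitivity (\int[lebesgue_measure]_x
      ((expR (t ^+ 2 * s ^+ 2 / 2))%:E * (normal_pdf (m + t * s ^+ 2) s x)%:E))%E.
    apply: eq_integral => x _; rewrite -!EFinM; congr EFin.
    rewrite !normal_pdfE// mulrCA [RHS]mulrCA; congr (_ * _).
    rewrite /normal_fun -!expRD; congr expR.
    by field.
  rewrite ge0_integralZl//.
  + by rewrite integral_normal_pdf mule1.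
  + by apply/measurable_EFinP; exact: measurable_normal_pdf.
  + by move=> x _; rewrite lee_fin normal_pdf_ge0.
- by move=> x; exact: normal_pdf_ge0.
- exact: measurable_normal_pdf.
- apply/measurable_EFinP; apply: measurableT_comp => //.
  by apply: measurable_funM => //; exact: measurable_funB.
Qed.

Lemma measurable_expRM (t : R) :
  measurable_fun setT (fun x : measurableTypeR R => expR (t * (x - m))).
Proof.
apply: measurableT_comp => //.
by apply: measurable_funM => //; exact: measurable_funB.
Qed.

Lemma normal_integrable_expR (t : R) :
  P.-integrable setT (EFin \o (fun x => expR (t * (x - m)))).
Proof.
apply/integrableP; split; first by apply/measurable_EFinP; exact: measurable_expRM.
under eq_integral do rewrite /= ger0_norm ?expR_ge0//.
by rewrite normal_mgf ltry.
Qed.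

Lemma normal_Rmgf (t : R) :
  \int[P]_x expR (t * (x - m)) = expR (t ^+ 2 * s ^+ 2 / 2).
Proof. by rewrite /Rintegral normal_mgf. Qed.

(* [|u| ^ k / k!] is below [cosh u] up to a factor 2, so that the moments are controlled by the exponential ones. *)
Lemma exprn_le_expR (k : nat) (u : R) :
  `|u| ^+ k <= k`!%:R * (expR u + expR (- u)).
Proof.
have pos : `|u| ^+ k <= k`!%:R * expR `|u|.
  case: k => [|k]; first by rewrite expr0 fact0 mul1r (le_trans _ (expR_ge1Dx _))// lerDl.
  have := expR_ge1Dxn k (normr_ge0 u).
  rewrite -ler_pdivrMl ?ltr0n ?fact_gt0// mulrC; apply: le_trans.
  by rewrite lerDr.
apply: (le_trans pos); rewrite ler_wpM2l ?ler0n//.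
by case: (ger0P u) => _; rewrite ?lerDl ?lerDr expR_ge0.
Qed.

Lemma measurable_centerX (k : nat) :
  measurable_fun setT (fun x : measurableTypeR R => (x - m) ^+ k).
Proof. by apply: measurable_funX; exact: measurable_funB. Qed.

Lemma normal_integrable_exprn (k : nat) :
  P.-integrable setT (EFin \o (fun x => (x - m) ^+ k)).
Proof.
have := EFin_integrableZl k`!%:R (EFin_integrableD (normal_integrable_expR 1)
  (normal_integrable_expR (-1))).
apply: EFin_le_integrable; first exact: measurable_centerX.
move=> x; rewrite normrX (le_trans (exprn_le_expR k _))//.
by rewrite mul1r mulN1r.
Qed.

(** The exponential bound on powers with k = 4, where 48 = 2 * 4!; [t] stays free so that it can be
    tuned to the variance. *)
Lemma normal_moment4 (t : R) : 0 < t ->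
  \int[P]_x (x - m) ^+ 4 <= 48 / t ^+ 4 * expR (t ^+ 2 * s ^+ 2 / 2).
Proof.
move=> t0; have i1 := normal_integrable_expR t.
have i2 := normal_integrable_expR (- t).
apply: (@le_trans _ _ (\int[P]_x ((24 / t ^+ 4) * (expR (t * (x - m)) + expR (- t * (x - m)))))).
  apply: le_Rintegral => //; first exact: normal_integrable_exprn.
    exact/EFin_integrableZl/EFin_integrableD.
  move=> x _; have := exprn_le_expR 4 (t * (x - m)).
  rewrite -normrX ger0_norm ?exprn_even_ge0// exprMn mulrC -ler_pdivlMr ?exprn_gt0//.
  by rewrite mulrAC mulNr.
rewrite RintegralZl//; last exact: EFin_integrableD.
rewrite RintegralD// !normal_Rmgf sqrrN; lra.
Qed.

Let mean : R := \int[P]_x (x - m).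
Let var : R := \int[P]_x (x - m) ^+ 2.

(** The second-order expansion of the exponential is integrated term by term, the first two moments
    being still unknown. *)
Let third_order_bound : exists C : R, forall t : R, `|t| <= 1 ->
  `|expR (t ^+ 2 * s ^+ 2 / 2) - 1 - t * mean - t ^+ 2 / 2 * var| <= C * `|t| ^+ 3.
Proof.
(* With u = x - m this is 3! (e^u + e^-u)^2, which dominates |u|^3 e^|u| and so the Taylor remainder
   for all |t| <= 1 at once. Writing 1 as [expR (0 * _)] makes every term an exponential moment. *)
pose g x := 6 * (expR (2 * (x - m)) + 2 * expR (0 * (x - m)) + expR (- 2 * (x - m))).
have ig : P.-integrable setT (EFin \o g).
  apply: EFin_integrableZl; apply: EFin_integrableD; last exact: normal_integrable_expR.
  apply: EFin_integrableD; first exact: normal_integrable_expR.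
  exact/EFin_integrableZl/normal_integrable_expR.
have i1 : P.-integrable setT (EFin \o (fun x => x - m)) := normal_integrable_exprn 1.
have i2 := normal_integrable_exprn 2.
exists (\int[P]_x g x) => t t1.
have ie : P.-integrable setT (EFin \o (fun x => expR (t * (x - m)) - expR (0 * (x - m)))).
  by apply: EFin_integrableB; exact: normal_integrable_expR.
have it1 := EFin_integrableZl t i1; have it2 := EFin_integrableZl (t ^+ 2 / 2) i2.
have ie1 := EFin_integrableB ie it1; have ie2 := EFin_integrableB ie1 it2.
have -> : expR (t ^+ 2 * s ^+ 2 / 2) - 1 - t * mean - t ^+ 2 / 2 * var =
    \int[P]_x (expR (t * (x - m)) - expR (0 * (x - m)) - t * (x - m) -
      t ^+ 2 / 2 * (x - m) ^+ 2).
  rewrite !RintegralB//; try exact: normal_integrable_expR.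
  by rewrite !RintegralZl// !normal_Rmgf expr0n/= !mul0r expR0.
apply: (le_trans (le_normr_Rintegral _ ie2)) => //.
rewrite -RintegralZr//; apply: le_Rintegral => //.
- exact: integrable_norm.
- rewrite (_ : (fun x => _) = (fun x => `|t| ^+ 3 * g x)); last first.
    by apply/funext => x; rewrite mulrC.
  exact: EFin_integrableZl.
move=> x _; rewrite mul0r expR0 /g; set u := x - m.
have -> : t ^+ 2 / 2 * u ^+ 2 = (t * u) ^+ 2 / 2 by rewrite exprMn mulrAC.
apply: (le_trans (expR_taylor2 _)); rewrite normrM exprMn mulrC -mulrA mul0r expR0.
rewrite mulrCA [leRHS]mulrA [leRHS]mulrC ler_wpM2l ?exprn_ge0//.
have u3 := exprn_le_expR 3 u.
have eu : expR (`|t| * `|u|) <= expR u + expR (- u).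
  apply: (@le_trans _ _ (expR `|u|)); first by rewrite ler_expR ler_piMl.
  by case: (ger0P u) => _; rewrite ?lerDl ?lerDr expR_ge0.
have -> : expR (2 * u) = expR u ^+ 2 by rewrite -expRM_natl.
have -> : expR (- 2 * u) = expR (- u) ^+ 2 by rewrite mulNr -mulrN -expRM_natl.
have e1 : expR u * expR (- u) = 1 by rewrite -expRD subrr expR0.
apply: (@le_trans _ _ ((expR u + expR (- u)) * (3`!%:R * (expR u + expR (- u))))).
  by rewrite ler_pM ?expR_ge0 ?exprn_ge0.
rewrite (_ : 3`! = 6)%N//; nra.
Qed.

(** The generating function has expansion 1 + t^2 s^2/2 + O(t^3) and also 1 + t mean + t^2 var/2 +
    O(t^3). Comparing the two at t and -t separates the odd from the even coefficient. *)
Lemma normal_mean_var :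
  \int[P]_x (x - m) = 0 /\ \int[P]_x (x - m) ^+ 2 = s ^+ 2.
Proof.
have [C CP] := third_order_bound.
have s2 := sqr_ge0 s.
pose w := s ^+ 2 / 2.
have w0 : 0 <= w by rewrite divr_ge0.
have sw : s ^+ 2 = 2 * w by rewrite /w mulrCA divff ?mulr1.
pose D : R := C + w ^+ 2 / 2 + w ^+ 3 * expR w.
have lin (t : R) : `|t| <= 1 -> `|t * mean + t ^+ 2 / 2 * (var - s ^+ 2)| <= D * `|t| ^+ 3.
  move=> t1; have := CP t t1; rewrite -mulrA -/w.
  have := expR_taylor2 (t ^+ 2 * w).
  have -> : `|t ^+ 2 * w| = t ^+ 2 * w.
    by apply: ger0_norm; exact: mulr_ge0 (sqr_ge0 t) w0.
  have -> : t ^+ 2 = `|t| ^+ 2 by rewrite real_normK ?num_real.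
  rewrite sw; move: `|t| (normr_ge0 t) t1 => /= r r0 r1.
  have r2 : r ^+ 2 <= 1 by rewrite exprn_ile1.
  set e := expR (r ^+ 2 * w).
  have ew : e <= expR w by rewrite ler_expR ler_piMl.
  have e0 : 0 <= e by exact: expR_ge0.
  rewrite !ler_norml => /andP[l1 u1] /andP[l2 u2].
  have r43 : r ^+ 2 ^+ 2 <= r ^+ 3 by rewrite -exprM (_ : 2 * 2 = 1 + 3)%N// exprD expr1 ler_piMl ?exprn_ge0.
  have r63 : r ^+ 2 ^+ 3 <= r ^+ 3.
    by rewrite -exprM (_ : 2 * 3 = 3 + 3)%N// exprD ler_piMl ?exprn_ge0// exprn_ile1.
  have b1 : (r ^+ 2 * w) ^+ 2 / 2 <= w ^+ 2 / 2 * r ^+ 3.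
    by rewrite exprMn mulrAC mulrC -mulrA ler_wpM2l// ?exprn_ge0// mulrC ler_wpM2l ?invr_ge0.
  have b2 : (r ^+ 2 * w) ^+ 3 * e <= w ^+ 3 * expR w * r ^+ 3.
    rewrite exprMn mulrAC mulrC -[leRHS]mulrA ler_wpM2l// ?exprn_ge0// mulrC.
    by rewrite ler_pM ?exprn_ge0.
  have b0 : 0 <= (r ^+ 2 * w) ^+ 2 by rewrite sqr_ge0.
  rewrite /D; apply/andP; split; lra.
have D0 : 0 <= D.
  by have := lin 1; rewrite normr1 !expr1n => /(_ (lexx _)) /(le_trans (normr_ge0 _)); rewrite mulr1.
have both (t : R) : 0 < t <= 1 ->
    `|mean| <= D * t /\ `|var - s ^+ 2| <= 2 * D * t.
  move=> /andP[t0 t1].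
  have := lin (- t); have := lin t.
  rewrite normrN gtr0_norm// ?sqrrN => /(_ t1) + /(_ t1).
  rewrite !ler_norml => /andP[l1 u1] /andP[l2 u2].
  have tm : t ^+ 3 <= t ^+ 2 by rewrite exprS ler_piMl// exprn_ge0// ltW.
  have Dt : D * t ^+ 3 <= D * t ^+ 2 by rewrite ler_wpM2l.
  have t3 : t ^+ 3 = t ^+ 2 * t by rewrite exprSr.
  split; apply/andP; split.
  - rewrite -(ler_pM2l t0); nra.
  - rewrite -(ler_pM2l t0); nra.
  - rewrite -(@ler_pM2l _ (t ^+ 2)) ?exprn_gt0//; nra.
  - rewrite -(@ler_pM2l _ (t ^+ 2)) ?exprn_gt0//; nra.
rewrite -/mean -/var; split; apply/eqP; rewrite -?[var == _]subr_eq0 -normr_le0.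
  by apply: (le0_of_le_linear (C := D)) => t /both[].
by apply: (le0_of_le_linear (C := 2 * D)) => t /both[].
Qed.

End NormalMoments.

(** * Iterated integration over independent coordinates *)

Section IID.
Context {R : realType}.
Variables (P : probability (measurableTypeR R) R) (p : R).
Hypothesis i4 : P.-integrable setT (EFin \o (fun x => (x - p) ^+ 4)).
Local Notation tup n := (n.-tuple (measurableTypeR R)).

(** A product weight, integrable by independence, that dominates up to a constant the fourth power
    of any multilinear polynomial ([teval_growth]). *)
Definition quartic_weight n (t : tup n) : R := \prod_(i < n) (1 + (tnth t i - p) ^+ 4).

Lemma quartic_weight_ge1 n (t : tup n) : 1 <= quartic_weight t.
Proof.
rewrite /quartic_weight; elim/big_ind: _ => [//|x y x1 y1|i _].
  by rewrite -[1]mulr1 ler_pM.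
by rewrite lerDl exprn_even_ge0.
Qed.

Lemma quartic_weight_cons n (x : measurableTypeR R) (t : tup n) :
  quartic_weight [tuple of x :: t] = (1 + (x - p) ^+ 4) * quartic_weight t.
Proof.
rewrite /quartic_weight big_ord_recl; congr (_ * _).
by apply: eq_bigr => i _; rewrite tnthS.
Qed.

Lemma measurable_tnth_sub n (i : 'I_n) :
  measurable_fun setT (fun t : tup n => tnth t i - p).
Proof. by apply: measurable_funB => //; exact: measurable_tnth. Qed.

Lemma measurable_quartic_weight n : measurable_fun setT (@quartic_weight n).
Proof.
apply: measurable_prod => i _; apply: measurable_funD => //.
by apply: measurable_funX; exact: measurable_tnth_sub.
Qed.

(** The class of integrands for which every use of Fubini below is legitimate: it is stable under
    fixing the head coordinate and under integrating it out. *)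
Definition quartic_growth n (F : tup n -> R) :=
  measurable_fun setT F /\ exists K : R, forall t, `|F t| <= K * quartic_weight t.

Lemma ge0_integral_iidS n (F : tup n.+1 -> \bar R) :
  measurable_fun setT F -> (forall t, 0 <= F t)%E ->
  (\int[iid P n.+1]_t F t = \int[P \x iid P n]_z F (tuple_cons z))%E.
Proof.
by move=> mF F0; rewrite ge0_integral_distribution.
Qed.

Lemma integral_iidS n (F : tup n.+1 -> \bar R) : measurable_fun setT F ->
  (P \x iid P n)%E.-integrable setT (F \o (@tuple_cons _ (measurableTypeR R) n)) ->
  (\int[iid P n.+1]_t F t = \int[P \x iid P n]_z F (tuple_cons z))%E.
Proof.
by move=> mF iF; rewrite integral_distribution.
Qed.

Let M4 : R := 1 + \int[P]_x (x - p) ^+ 4.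

Let M4E : (\int[P]_x (1 + (x - p) ^+ 4)%:E = M4%:E)%E.
Proof.
have i1 := EFin_integrableD (finite_measure_integrable_cst P 1 measurableT) i4.
rewrite EFin_Rintegral// RintegralD//; last exact: finite_measure_integrable_cst.
by rewrite Rintegral_probability_cst.
Qed.

Lemma integral_quartic_weight n :
  (\int[iid P n]_t (quartic_weight t)%:E = (M4 ^+ n)%:E)%E.
Proof.
have w0 m (t : tup m) : 0 <= quartic_weight t by rewrite (le_trans _ (quartic_weight_ge1 t)).
elim: n => [|n IH].
  rewrite integral_dirac//; last by apply/measurable_EFinP; exact: measurable_quartic_weight.
  by rewrite diracE in_setT mul1e /quartic_weight big_ord0 expr0.
rewrite ge0_integral_iidS; last 2 first.
  by apply/measurable_EFinP; exact: measurable_quartic_weight.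
  by move=> t; rewrite lee_fin.
rewrite fubini_tonelli1/=; last 2 first.
  apply/measurable_EFinP; apply: measurableT_comp; first exact: measurable_quartic_weight.
  exact: measurable_tuple_cons.
  by move=> z; rewrite lee_fin.
transitivity (\int[P]_x ((M4 ^+ n)%:E * (1 + (x - p) ^+ 4)%:E))%E.
  apply: eq_integral => x _; rewrite /fubini_F.
  rewrite (eq_integral (fun t => (1 + (x - p) ^+ 4)%:E * (quartic_weight t)%:E)%E); last first.
    by move=> t _; rewrite -EFinM -quartic_weight_cons.
  rewrite ge0_integralZl//=; first by rewrite IH muleC.
  - by apply/measurable_EFinP; exact: measurable_quartic_weight.
  - by move=> t _; rewrite lee_fin.
  - by rewrite lee_fin addr_ge0// exprn_even_ge0.
rewrite /= ge0_integralZl//=.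
- by rewrite M4E -EFinM mulrC exprS.
- apply/measurable_EFinP; apply: measurable_funD => //.
  by apply: measurable_funX; exact: measurable_funB.
- by move=> x _; rewrite lee_fin addr_ge0// exprn_even_ge0.
- by rewrite lee_fin exprn_ge0// addr_ge0// Rintegral_ge0// => x _; rewrite exprn_even_ge0.
Qed.

Lemma quartic_growth_integrable n (F : tup n -> R) : quartic_growth F ->
  (iid P n).-integrable setT (EFin \o F).
Proof.
move=> [mF [K FK]]; have mw := @measurable_quartic_weight n.
have w0 (t : tup n) : 0 <= quartic_weight t by rewrite (le_trans _ (quartic_weight_ge1 t)).
have iw : (iid P n).-integrable setT (EFin \o @quartic_weight n).
  apply/integrableP; split; first exact/measurable_EFinP.
  under eq_integral do rewrite /= ger0_norm//.
  by rewrite integral_quartic_weight ltry.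
exact: EFin_le_integrable mF FK (EFin_integrableZl K iw).
Qed.

Lemma quartic_growth_slice_tail n (F : tup n.+1 -> R) (x : measurableTypeR R) :
  quartic_growth F -> quartic_growth (fun t : tup n => F [tuple of x :: t]).
Proof.
move=> [mF [K FK]]; split.
  apply: (measurableT_comp mF).
  exact: measurable_cons.
exists (K * (1 + (x - p) ^+ 4)) => t.
by rewrite -mulrA -quartic_weight_cons.
Qed.

Lemma quartic_growth_slice_head n (F : tup n.+1 -> R) (t : tup n) :
  quartic_growth F ->
  P.-integrable setT (EFin \o (fun x => F [tuple of x :: t])).
Proof.
move=> [mF [K FK]].
have i1 := EFin_integrableD (finite_measure_integrable_cst P 1 measurableT) i4.
apply: EFin_le_integrable (EFin_integrableZl (K * quartic_weight t) i1).
  apply: (measurableT_comp mF).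
  exact: measurable_cons.
move=> x; apply: (le_trans (FK _)).
by rewrite quartic_weight_cons -mulrA (mulrC (quartic_weight t)).
Qed.

Lemma quartic_growth_integrable_pair n (F : tup n.+1 -> R) : quartic_growth F ->
  (P \x iid P n)%E.-integrable setT
    (EFin \o (fun z : measurableTypeR R * tup n => F (tuple_cons z))).
Proof.
move=> gF; have /integrableP[mF iF] := quartic_growth_integrable gF.
apply/integrableP; split.
  by apply: (measurableT_comp mF); exact: measurable_tuple_cons.
move: iF; rewrite ge0_integral_iidS//.
exact: measurableT_comp.
Qed.

(** Both orders of integration serve: with the head outermost the moments follow by induction on the
    tail, with the head innermost a single coordinate is replaced while the others stay fixed. *)
Lemma Rintegral_iidS_head n (F : tup n.+1 -> R) : quartic_growth F ->
  \int[iid P n.+1]_t F t = \int[P]_x (\int[iid P n]_t F [tuple of x :: t]).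
Proof.
move=> gF; have mF := EFin_measurable (quartic_growth_integrable gF).
rewrite /Rintegral integral_iidS; last exact: quartic_growth_integrable_pair.
  congr fine; rewrite -integral12_prod_meas1; last exact: quartic_growth_integrable_pair.
  apply: eq_integral => x _; rewrite /fubini_F/= EFin_Rintegral//.
  exact/quartic_growth_integrable/quartic_growth_slice_tail.
exact/measurable_EFinP.
Qed.

Lemma Rintegral_iidS_tail n (F : tup n.+1 -> R) : quartic_growth F ->
  \int[iid P n.+1]_t F t = \int[iid P n]_t (\int[P]_x F [tuple of x :: t]).
Proof.
move=> gF; have mF := EFin_measurable (quartic_growth_integrable gF).
rewrite /Rintegral integral_iidS; last exact: quartic_growth_integrable_pair.
  congr fine; rewrite -integral21_prod_meas1; last exact: quartic_growth_integrable_pair.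
  apply: eq_integral => x _; rewrite /fubini_G/= EFin_Rintegral//.
  exact: quartic_growth_slice_head.
exact/measurable_EFinP.
Qed.

Lemma quartic_growth_Rintegral n (F : tup n.+1 -> R) : quartic_growth F ->
  quartic_growth (fun t : tup n => \int[P]_x F [tuple of x :: t]).
Proof.
move=> gF; have ip := quartic_growth_integrable_pair gF.
have mF := EFin_measurable (quartic_growth_integrable gF).
split.
  have := measurable_fubini_G ip.
  rewrite /fubini_G /= => mG; apply/measurable_EFinP.
  congr (measurable_fun _ _): mG; apply/funext => t /=; rewrite EFin_Rintegral//.
  exact: quartic_growth_slice_head.
have [_ [K FK]] := gF; exists (K * M4) => t.
have i1 := EFin_integrableD (finite_measure_integrable_cst P 1 measurableT) i4.
have iH := quartic_growth_slice_head t gF.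
apply: (le_trans (le_normr_Rintegral _ iH)) => //.
have -> : K * M4 * quartic_weight t =
    \int[P]_x (K * quartic_weight t * (1 + (x - p) ^+ 4)).
  by rewrite RintegralZl// [in RHS]/Rintegral M4E/= mulrAC.
apply: le_Rintegral => //.
- exact: integrable_norm.
- exact: EFin_integrableZl.
- move=> x _; apply: (le_trans (FK _)).
  by rewrite quartic_weight_cons -mulrA (mulrC (quartic_weight t)).
Qed.

Lemma quartic_growth_integrable_head n (F : tup n.+1 -> R) : quartic_growth F ->
  P.-integrable setT (EFin \o (fun x => \int[iid P n]_t F [tuple of x :: t])).
Proof.
move=> gF; have := integrable_fubini_F (quartic_growth_integrable_pair gF).
congr (_.-integrable _ _); apply/funext => x /=; rewrite /fubini_F EFin_Rintegral//.
exact/quartic_growth_integrable/quartic_growth_slice_tail.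
Qed.

End IID.

(** * Multilinear polynomials and the Lindeberg replacement *)

Section Lift.
Variable n : nat.

(** Inductions on the number of variables peel off coordinate 0. Precomposing a coefficient function
    with [slift false] and [slift true] gives the two halves of the splitting f = f0 + y_0 f1. *)
Definition slift (b : bool) (T : {set 'I_n}) : {set 'I_n.+1} :=
  [set i | if unlift ord0 i is Some j then j \in T else b]%SET.

Lemma in_slift0 b T : (ord0 \in slift b T) = b.
Proof. by rewrite inE unlift_none. Qed.

Lemma in_slift b T j : (lift ord0 j \in slift b T) = (j \in T).
Proof. by rewrite inE liftK. Qed.

Lemma slift_surj (S : {set 'I_n.+1}) :
  S = slift (ord0 \in S) [set j | lift ord0 j \in S]%SET.
Proof.
by apply/setP => i; rewrite inE; case: unliftP => [j ->|->//]; rewrite inE.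
Qed.

Lemma setU1_slift0 T : (ord0 |: slift false T)%SET = slift true T.
Proof.
apply/setP => i; rewrite !inE; case: unliftP => [j ->|->]; last by rewrite eqxx.
by rewrite eq_sym (negbTE (neq_lift _ _)).
Qed.

Lemma setU1_slift b i T : (lift ord0 i |: slift b T)%SET = slift b (i |: T)%SET.
Proof.
apply/setP => j; rewrite !inE; case: unliftP => [k ->|->].
  by rewrite (inj_eq lift_inj) !inE.
by rewrite (negbTE (neq_lift _ _)).
Qed.

Lemma card_slift b T : #|slift b T| = (b + #|T|)%N.
Proof.
rewrite -!sum1_card big_mkcond big_ord_recl in_slift0; congr (_ + _)%N.
by rewrite [RHS]big_mkcond; apply: eq_bigr => j _; rewrite in_slift.
Qed.

Lemma sum_slift (V : nmodType) (F : {set 'I_n.+1} -> V) :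
  \sum_S F S = \sum_T F (slift false T) + \sum_T F (slift true T).
Proof.
have cnd b : \sum_(S : {set 'I_n.+1} | (ord0 \in S) == b) F S = \sum_T F (slift b T).
  rewrite (reindex_onto (slift b) (fun S => [set j | lift ord0 j \in S]%SET)); last first.
    by move=> S /eqP Sb; rewrite [RHS]slift_surj Sb.
  apply: eq_bigl => T; rewrite in_slift0 eqxx; apply/eqP/setP => j.
  by rewrite inE in_slift.
rewrite (bigID (fun S : {set 'I_n.+1} => ord0 \in S)) addrC -!cnd /=.
by congr (_ + _); apply: eq_bigl => S; case: (_ \in _).
Qed.

Lemma prod_slift (A : comPzRingType) b T (y : 'I_n.+1 -> A) :
  \prod_(i in slift b T) y i =
  (if b then y ord0 else 1) * \prod_(j in T) y (lift ord0 j).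
Proof.
rewrite big_mkcond big_ord_recl in_slift0; congr (_ * _).
by rewrite [RHS]big_mkcond; apply: eq_bigr => j _; rewrite in_slift.
Qed.

Definition fcons (b : bool) (x : {ffun 'I_n -> bool}) : {ffun 'I_n.+1 -> bool} :=
  [ffun i => if unlift ord0 i is Some j then x j else b].

Lemma fcons0 b x : fcons b x ord0 = b.
Proof. by rewrite ffunE unlift_none. Qed.

Lemma fconsS b x j : fcons b x (lift ord0 j) = x j.
Proof. by rewrite ffunE liftK. Qed.

Lemma sum_fcons (V : nmodType) (F : {ffun 'I_n.+1 -> bool} -> V) :
  \sum_x F x = \sum_x F (fcons true x) + \sum_x F (fcons false x).
Proof.
have cnd b : \sum_(x : {ffun 'I_n.+1 -> bool} | x ord0 == b) F x = \sum_x F (fcons b x).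
  rewrite (reindex_onto (fcons b) (fun x => [ffun j => x (lift ord0 j)])); last first.
    move=> x /eqP xb; apply/ffunP => i; rewrite ffunE.
    by case: unliftP => [j ->|->//]; rewrite ffunE.
  apply: eq_bigl => x; rewrite fcons0 eqxx; apply/eqP/ffunP => j.
  by rewrite ffunE fconsS.
rewrite (bigID (fun x : {ffun 'I_n.+1 -> bool} => x ord0)) -!cnd /=.
by congr (_ + _); apply: eq_bigl => x; case: (x _).
Qed.

End Lift.

Section Multilinear.
Context {R : realFieldType}.
Implicit Types (n : nat).

Definition mlin n (c : {set 'I_n} -> R) (y : 'I_n -> R) : R :=
  \sum_S c S * \prod_(i in S) y i.

Lemma mlin_cons n (c : {set 'I_n.+1} -> R) y :
  mlin c y = mlin (c \o slift false) (y \o lift ord0)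
             + y ord0 * mlin (c \o slift true) (y \o lift ord0).
Proof.
rewrite /mlin sum_slift; congr (_ + _).
  by apply: eq_bigr => T _; rewrite prod_slift mul1r.
by rewrite big_distrr; apply: eq_bigr => T _; rewrite prod_slift/= mulrCA.
Qed.

Lemma eq_mlin n (c : {set 'I_n} -> R) y y' : y =1 y' -> mlin c y = mlin c y'.
Proof. by move=> yy; apply: eq_bigr => S _; congr (_ * _); apply: eq_bigr. Qed.

Lemma mlin_lincomb n (c c' : {set 'I_n} -> R) u y :
  mlin (fun S => c S + u * c' S) y = mlin c y + u * mlin c' y.
Proof.
rewrite /mlin big_distrr -big_split; apply: eq_bigr => S _ /=.
by rewrite mulrDl mulrA.
Qed.

(* [wnorm (p * (1 - p)) c] is the second moment of [mlin c (x - p)] both for the biased cube and for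
   the Gaussian with the same variance; [wnorm 4 c] squared bounds its Gaussian fourth moment. *)
Definition wnorm (g : R) n (c : {set 'I_n} -> R) : R := \sum_(S : {set 'I_n}) g ^+ #|S| * c S ^+ 2.

Lemma sum_set_ord0 (F : {set 'I_0} -> R) : \sum_S F S = F finset.set0.
Proof. by apply: big_pred1 => S; apply/esym/eqP/setP => -[]. Qed.

Lemma mlin0 (c : {set 'I_0} -> R) y : mlin c y = c finset.set0.
Proof. by rewrite /mlin sum_set_ord0 big_set0 mulr1. Qed.

Lemma wnorm0 (g : R) (c : {set 'I_0} -> R) : wnorm g c = c finset.set0 ^+ 2.
Proof. by rewrite /wnorm sum_set_ord0 cards0 mul1r. Qed.

Lemma wnorm_cons (g : R) n (c : {set 'I_n.+1} -> R) :
  wnorm g c = wnorm g (c \o slift false) + g * wnorm g (c \o slift true).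
Proof.
rewrite /wnorm sum_slift; congr (_ + _).
  by apply: eq_bigr => T _; rewrite card_slift.
by rewrite big_distrr; apply: eq_bigr => T _; rewrite card_slift exprD /= expr1 mulrA.
Qed.

Lemma wnorm_ge0 (g : R) n (c : {set 'I_n} -> R) : 0 <= g -> 0 <= wnorm g c.
Proof. by move=> g0; apply: sumr_ge0 => S _; rewrite mulr_ge0 ?sqr_ge0 ?exprn_ge0. Qed.

Lemma wnorm_le (g g' : R) n (c : {set 'I_n} -> R) : 0 <= g -> g <= g' ->
  wnorm g c <= wnorm g' c.
Proof.
by move=> g0 gg; apply: ler_sum => S _; rewrite ler_wpM2r ?sqr_ge0// lerXn2r ?nnegrE// (le_trans g0).
Qed.

(** Each monomial changes by (g'/g)^|S| with |S| <= d. This is the passage from [wnorm 4] back to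
    the true variance. *)
Lemma wnorm_degree_le (g g' : R) d n (c : {set 'I_n} -> R) : 0 < g -> g <= g' ->
  (forall S : {set 'I_n}, (d < #|S|)%N -> c S = 0) -> wnorm g' c <= (g' / g) ^+ d * wnorm g c.
Proof.
move=> g0 gg cd; rewrite /wnorm big_distrr; apply: ler_sum => S _ /=.
have [/cd->|Sd] := ltnP d #|S|; first by rewrite expr0n !mulr0.
rewrite mulrA ler_wpM2r ?sqr_ge0//.
have gg1 : 1 <= g' / g by rewrite ler_pdivlMr ?mul1r.
apply: (@le_trans _ _ ((g' / g) ^+ #|S| * g ^+ #|S|)).
  by rewrite -exprMn divfK ?gt_eqF.
by rewrite ler_wpM2r ?exprn_ge0 ?(ltW g0)// ler_weXn2l.
Qed.

Definition cderiv n (i : 'I_n) (c : {set 'I_n} -> R) : {set 'I_n} -> R :=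
  fun S => if i \in S then 0 else c (i |: S)%SET.

Lemma cderiv_lift n (i : 'I_n) b (c : {set 'I_n.+1} -> R) :
  cderiv (lift ord0 i) c \o slift b =1 cderiv i (c \o slift b).
Proof. by move=> T; rewrite /cderiv /= in_slift setU1_slift. Qed.

Lemma wnorm_cderiv0 (g : R) n (c : {set 'I_n.+1} -> R) :
  wnorm g (cderiv ord0 c) = wnorm g (c \o slift true).
Proof.
rewrite wnorm_cons (_ : wnorm g (_ \o slift true) = 0) ?mulr0 ?addr0.
  apply: eq_bigr => T _; congr (_ * _ ^+ 2).
  by rewrite /cderiv /= in_slift0 setU1_slift0.
by apply: big1 => T _; rewrite /= /cderiv in_slift0 expr0n mulr0.
Qed.

Lemma eq_wnorm (g : R) n (c c' : {set 'I_n} -> R) : c =1 c' -> wnorm g c = wnorm g c'.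
Proof. by move=> cc; apply: eq_bigr => S _; rewrite cc. Qed.

End Multilinear.

Section CubeExpect.
Context {R : realType}.
Variable p : R.

Lemma cube_expect_cons n (g : {ffun 'I_n.+1 -> bool} -> R) :
  cube_expect p g = p * cube_expect p (g \o fcons true)
                    + (1 - p) * cube_expect p (g \o fcons false).
Proof.
rewrite /cube_expect sum_fcons !big_distrr/=; congr (_ + _); apply: eq_bigr => x _;
  rewrite big_ord_recl fcons0 mulrA; congr (_ * _ * _); apply: eq_bigr => i _;
  by rewrite fconsS.
Qed.

Lemma cube_expect0 (g : {ffun 'I_0 -> bool} -> R) x : cube_expect p g = g x.
Proof.
rewrite /cube_expect (big_pred1 x); first by rewrite big_ord0 mul1r.
by move=> y /=; apply/esym/eqP/ffunP => -[].
Qed.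

End CubeExpect.

Section WnormLine.
Context {R : realFieldType}.
Variables (g : R) (n : nat) (c c' : {set 'I_n} -> R).
Hypothesis g_ge0 : 0 <= g.

Let wdot := \sum_(S : {set 'I_n}) g ^+ #|S| * (c S * c' S).

Lemma wnorm_line u : wnorm g (fun S => c S + u * c' S) =
  wnorm g c + 2 * u * wdot + u ^+ 2 * wnorm g c'.
Proof.
rewrite /wnorm /wdot !big_distrr -!big_split; apply: eq_bigr => S _ /=; ring.
Qed.

(** Cauchy-Schwarz, read off from the nonnegativity in u of the quadratic of [wnorm_line]. *)
Lemma wdot_sqr_le : wdot ^+ 2 <= wnorm g c * wnorm g c'.
Proof.
have pos u : 0 <= wnorm g c + 2 * u * wdot + u ^+ 2 * wnorm g c'.
  by rewrite -wnorm_line wnorm_ge0.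
have A0 := wnorm_ge0 c g_ge0; have := wnorm_ge0 c' g_ge0.
rewrite le_eqVlt => /predU1P[D0|D0].
  rewrite -D0 mulr0; have [->|w0] := eqVneq wdot 0; first by rewrite expr0n.
  (* When the quadratic coefficient vanishes the polynomial is affine in u, and this point gives it
     the value -1. *)
  have := pos (- (wnorm g c + 1) / (2 * wdot)); rewrite -D0 mulr0 addr0.
  set A := wnorm g c.
  have -> : A + 2 * (- (A + 1) / (2 * wdot)) * wdot = - 1 by field.
  lra.
have := pos (- wdot / wnorm g c').
set D := wnorm g c' in D0 *; set A := wnorm g c in A0 *.
rewrite -(pmulr_rge0 _ D0); apply: contraTT; rewrite -!ltNge => h.
have -> : D * (A + 2 * (- wdot / D) * wdot + (- wdot / D) ^+ 2 * D) = A * D - wdot ^+ 2.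
  by field; rewrite gt_eqF.
by rewrite subr_lt0.
Qed.

(* Chosen so that its mean over a centered variable of variance at most 1 and fourth moment at most 5
   is at most [(wnorm 4 c + 4 * wnorm 4 c') ^+ 2]. *)
Definition quartic_majorant u :=
  wnorm g c ^+ 2 + 4 * (wnorm g c * wdot) * u + 8 * (wnorm g c * wnorm g c') * u ^+ 2
  + 3 * wnorm g c' ^+ 2 * u ^+ 4.

(** With A, D the two norms and B the inner product, the odd term satisfies 4 u^3 B D <= 2 u^2 B^2 +
    2 u^4 D^2, and then B^2 <= A D. The term linear in u is kept because it has mean zero. *)
Lemma wnorm_line_sqr_le u :
  wnorm g (fun S => c S + u * c' S) ^+ 2 <= quartic_majorant u.
Proof.
rewrite wnorm_line /quartic_majorant; have := wdot_sqr_le.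
have := wnorm_ge0 c' g_ge0; have := wnorm_ge0 c g_ge0.
move: (wnorm g c) (wnorm g c') wdot => A D B A0 D0 BAD.
have h1 : 0 <= (u * B - u ^+ 2 * D) ^+ 2 by rewrite sqr_ge0.
have h2 : 0 <= u ^+ 2 * (A * D - B ^+ 2) by rewrite mulr_ge0 ?sqr_ge0// subr_ge0.
nra.
Qed.

End WnormLine.

(** * Replacement of biased bits by a law with the same mean and variance *)

Section GaussianSide.
Context {R : realType}.
Variables (P : probability (measurableTypeR R) R) (p s2 m4 : R).
Local Notation tup n := (n.-tuple (measurableTypeR R)).
Hypothesis intX : forall k, P.-integrable setT (EFin \o (fun x => (x - p) ^+ k)).
Hypothesis mean0 : \int[P]_x (x - p) = 0.
Hypothesis var_s2 : \int[P]_x (x - p) ^+ 2 = s2.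
Hypothesis moment4 : \int[P]_x (x - p) ^+ 4 <= m4.
Hypothesis s2_le1 : s2 <= 1.
Hypothesis m4_le : m4 <= 5.

Let s2_ge0 : 0 <= s2.
Proof. by rewrite -var_s2 Rintegral_ge0// => x _; rewrite sqr_ge0. Qed.

Let int1 : P.-integrable setT (EFin \o (fun x => x - p)) := intX 1.

Lemma integrable_quartic a b c d :
  P.-integrable setT (EFin \o (fun x => a + b * (x - p) + c * (x - p) ^+ 2 + d * (x - p) ^+ 4)).
Proof.
apply: EFin_integrableD; last exact: EFin_integrableZl.
apply: EFin_integrableD; last exact: EFin_integrableZl.
apply: EFin_integrableD; last exact: EFin_integrableZl.
exact: finite_measure_integrable_cst.
Qed.

Lemma Rintegral_quartic a b c d :
  \int[P]_x (a + b * (x - p) + c * (x - p) ^+ 2 + d * (x - p) ^+ 4) =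
  a + c * s2 + d * \int[P]_x (x - p) ^+ 4.
Proof.
have ia : P.-integrable setT (EFin \o (fun x => a)) by exact: finite_measure_integrable_cst.
have ib := EFin_integrableZl b int1; have ic := EFin_integrableZl c (intX 2).
have id' := EFin_integrableZl d (intX 4).
have iab := EFin_integrableD ia ib; have iabc := EFin_integrableD iab ic.
rewrite !RintegralD// !RintegralZl// Rintegral_probability_cst mean0 var_s2.
by rewrite mulr0 addr0.
Qed.

Lemma Rintegral_iid0 (F : tup 0 -> R) : measurable_fun setT F ->
  \int[iid P 0]_t F t = F [tuple].
Proof.
move=> mF; rewrite /Rintegral integral_dirac//; last exact/measurable_EFinP.
by rewrite diracE in_setT mul1e.
Qed.

Definition teval n (c : {set 'I_n} -> R) (t : tup n) : R := mlin c (fun i => tnth t i - p).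

Lemma teval_cons n (c : {set 'I_n.+1} -> R) x (t : tup n) :
  teval c [tuple of x :: t] =
  teval (c \o slift false) t + (x - p) * teval (c \o slift true) t.
Proof.
rewrite /teval mlin_cons tnth0; congr (_ + _ * _); apply: eq_mlin => i /=;
  by rewrite tnthS.
Qed.

Lemma teval_lincomb n (c c' : {set 'I_n} -> R) u t :
  teval (fun S => c S + u * c' S) t = teval c t + u * teval c' t.
Proof. exact: mlin_lincomb. Qed.

Lemma measurable_teval n (c : {set 'I_n} -> R) : measurable_fun setT (teval c).
Proof.
apply: measurable_sum => S; apply: measurable_funM => //.
rewrite /=; under eq_fun do rewrite big_mkcond.
apply: measurable_prod => i _.
by case: (i \in S) => //; exact: measurable_tnth_sub.
Qed.

Lemma teval_growth n (c : {set 'I_n} -> R) :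
  exists K : R, forall t, teval c t ^+ 4 <= K * quartic_weight p t.
Proof.
elim: n c => [|n IH] c.
  exists (teval c [tuple] ^+ 4) => t; rewrite tuple0 /quartic_weight big_ord0.
  by rewrite mulr1.
have [K0 K0P] := IH (c \o slift false); have [K1 K1P] := IH (c \o slift true).
exists (8 * (`|K0| + `|K1|)) => t; rewrite (tuple_eta t) teval_cons quartic_weight_cons.
move: (thead t) (behead_tuple t) => x {}t.
have := K1P t; have := K0P t; set a := teval _ t; set b := teval _ t.
set w := quartic_weight p t => a4 b4.
have w0 : 0 <= w by rewrite (le_trans _ (quartic_weight_ge1 p t)).
set u := x - p; have u4 : 0 <= u ^+ 4 by rewrite exprn_even_ge0.
have h1 : (a + u * b) ^+ 4 <= 8 * (a ^+ 4 + u ^+ 4 * b ^+ 4).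
  rewrite -exprMn; move: (u * b) => v; have := sqr_ge0 (a - v).
  have := sqr_ge0 (a ^+ 2 - v ^+ 2); have := sqr_ge0 (a + v); nra.
apply: (le_trans h1); rewrite -[leRHS]mulrA ler_wpM2l//.
have k0 : a ^+ 4 <= `|K0| * w by rewrite (le_trans a4)// ler_wpM2r// ler_norm.
have k1 : b ^+ 4 <= `|K1| * w by rewrite (le_trans b4)// ler_wpM2r// ler_norm.
have k2 : u ^+ 4 * b ^+ 4 <= u ^+ 4 * (`|K1| * w) by rewrite ler_wpM2l.
have k3 : 0 <= u ^+ 4 * (`|K0| * w) by rewrite mulr_ge0// mulr_ge0.
have k4 : 0 <= `|K1| * w by rewrite mulr_ge0.
nra.
Qed.

Lemma quartic_growth_comp n (c : {set 'I_n} -> R) (h : R -> R) (K : R) :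
  measurable_fun setT h -> (forall y, `|h y| <= K * (1 + y ^+ 4)) ->
  quartic_growth p (h \o teval c).
Proof.
move=> mh hK; split; first exact: (measurableT_comp mh (measurable_teval c)).
have [K' K'P] := teval_growth c; exists (`|K| * (1 + `|K'|)) => t.
apply: (le_trans (hK _)).
have w1 := quartic_weight_ge1 p t; set w := quartic_weight p t in w1 *.
have y4 : 0 <= teval c t ^+ 4 by rewrite exprn_even_ge0.
apply: (@le_trans _ _ (`|K| * (1 + teval c t ^+ 4))).
  by rewrite ler_wpM2r ?ler_norm// addr_ge0.
rewrite -mulrA ler_wpM2l// mulrDl mul1r lerD//.
apply: (le_trans (K'P t)); rewrite ler_wpM2r ?ler_norm//.
by rewrite (le_trans _ w1).
Qed.

Let growth2 n (c : {set 'I_n} -> R) : quartic_growth p (fun t => teval c t ^+ 2).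
Proof.
apply: (@quartic_growth_comp _ c (fun y => y ^+ 2) 1); first exact: measurable_funX.
move=> y; rewrite ger0_norm ?sqr_ge0// mul1r; nra.
Qed.

Let growth4 n (c : {set 'I_n} -> R) : quartic_growth p (fun t => teval c t ^+ 4).
Proof.
apply: (@quartic_growth_comp _ c (fun y => y ^+ 4) 1); first exact: measurable_funX.
by move=> y; rewrite ger0_norm ?exprn_even_ge0// mul1r lerDr.
Qed.

Lemma teval_second_moment n (c : {set 'I_n} -> R) :
  \int[iid P n]_t teval c t ^+ 2 = wnorm s2 c.
Proof.
elim: n c => [|n IH] c.
  rewrite Rintegral_iid0 ?/teval ?mlin0 ?wnorm0//.
  by apply: measurable_funX; exact: measurable_teval.
rewrite (Rintegral_iidS_head (intX 4))//.
(* The zero quartic coefficient gives the integrand the shape of [Rintegral_quartic]. *)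
transitivity (\int[P]_x (wnorm s2 (c \o slift false) +
   2 * (\sum_(S : {set 'I_n}) s2 ^+ #|S| * ((c \o slift false) S * (c \o slift true) S)) * (x - p)
   + wnorm s2 (c \o slift true) * (x - p) ^+ 2 + 0 * (x - p) ^+ 4)).
  apply: eq_Rintegral => x _.
  under eq_Rintegral do rewrite teval_cons -teval_lincomb.
  by rewrite IH wnorm_line mul0r addr0; ring.
by rewrite Rintegral_quartic mul0r addr0 wnorm_cons mulrC.
Qed.

(** Conditioning on the head leaves the mean of [quartic_majorant], which is at most A^2 + 8 A D s2
    + 3 D^2 m4. Since s2 <= 1 and m4 <= 5, this is at most (A + 4 D)^2: here the weight 4 is needed
    for the cross term and for 15 <= 16. *)
Lemma teval_fourth_moment n (c : {set 'I_n} -> R) :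
  \int[iid P n]_t teval c t ^+ 4 <= wnorm 4 c ^+ 2.
Proof.
elim: n c => [|n IH] c.
  rewrite Rintegral_iid0 ?/teval ?mlin0 ?wnorm0// -?exprM//.
  by apply: measurable_funX; exact: measurable_teval.
rewrite (Rintegral_iidS_head (intX 4))//.
set c0 := c \o slift false; set c1 := c \o slift true.
apply: (@le_trans _ _ (\int[P]_x quartic_majorant 4 c0 c1 (x - p))).
  apply: le_Rintegral => //.
  - exact: (quartic_growth_integrable_head (intX 4) (growth4 c)).
  - exact: integrable_quartic.
  - move=> x _; under eq_Rintegral do rewrite teval_cons -teval_lincomb.
    by rewrite (le_trans (IH _))// wnorm_line_sqr_le.
rewrite Rintegral_quartic wnorm_cons -/c0 -/c1.
have A0 : 0 <= wnorm 4 c0 by rewrite wnorm_ge0.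
have D0 : 0 <= wnorm 4 c1 by rewrite wnorm_ge0.
have AD : wnorm 4 c0 * wnorm 4 c1 * s2 <= wnorm 4 c0 * wnorm 4 c1.
  by rewrite ler_piMr// mulr_ge0.
have DD : wnorm 4 c1 ^+ 2 * \int[P]_x (x - p) ^+ 4 <= wnorm 4 c1 ^+ 2 * 5.
  by rewrite ler_wpM2l ?sqr_ge0// (le_trans moment4).
nra.
Qed.

Definition ceval n (c : {set 'I_n} -> R) (x : {ffun 'I_n -> bool}) : R :=
  mlin c (fun i => (x i)%:R - p).

Lemma ceval_fcons n (c : {set 'I_n.+1} -> R) b x :
  ceval c (fcons b x) =
  ceval (fun S => (c \o slift false) S + (b%:R - p) * (c \o slift true) S) x.
Proof.
rewrite /ceval mlin_lincomb mlin_cons fcons0; congr (_ + _ * _); apply: eq_mlin => i /=;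
  by rewrite fconsS.
Qed.

Hypothesis p01 : 0 < p <= 1 / 2.
Hypothesis s2E : s2 = p * (1 - p).

Variables (phi alpha beta : R -> R) (M K : R).
Hypothesis mphi : measurable_fun setT phi.
Hypothesis phi_growth : forall y, `|phi y| <= K * (1 + y ^+ 4).
Hypothesis phi_taylor : forall a h,
  `|phi (a + h) - phi a - h * alpha a - h ^+ 2 * beta a| <= M * `|h| ^+ 3.

Let M_ge0 : 0 <= M.
Proof. by have := phi_taylor 0 1; rewrite normr1 !expr1n mulr1 => /(le_trans (normr_ge0 _)). Qed.

Let gphi n (c : {set 'I_n} -> R) : quartic_growth p (phi \o teval c).
Proof. exact: quartic_growth_comp phi_growth. Qed.

(** The terms of order 0, 1, 2 cancel because the bit and [P] share mean and variance. The remainder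
    is at most M |b|^3 |u|^3 with |u|^3 <= 1 + u^4; the bit contributes at most 2 and [P] at most 1
    + 5, which makes 8. *)
Lemma one_coordinate_swap a b :
  `|p * phi (a + (1 - p) * b) + (1 - p) * phi (a + (0 - p) * b)
    - \int[P]_x phi (a + (x - p) * b)| <= 8 * M * `|b| ^+ 3.
Proof.
have [p0 p1] := andP p01.
pose T (u : R) := phi (a + u * b) - phi a - u * b * alpha a - (u * b) ^+ 2 * beta a.
have TB u : `|T u| <= M * `|b| ^+ 3 * (1 + u ^+ 4).
  apply: (le_trans (phi_taylor a (u * b))).
  rewrite normrM exprMn (mulrC (_ ^+ 3)) mulrA ler_wpM2l ?mulr_ge0 ?exprn_ge0//.
  have -> : u ^+ 4 = `|u| ^+ 4 by rewrite -normrX ger0_norm// exprn_even_ge0.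
  have := normr_ge0 u; move: `|u| => r r0; have := sqr_ge0 (r - 1).
  have := sqr_ge0 (r ^+ 2 - 1); nra.
have mT : measurable_fun setT (fun x : measurableTypeR R => T (x - p)).
  have mx : measurable_fun setT (fun x : measurableTypeR R => x - p).
    exact: measurable_funB.
  have mxb : measurable_fun setT (fun x : measurableTypeR R => (x - p) * b).
    exact: measurable_funM.
  rewrite /T; apply: measurable_funB; last first.
    by apply: measurable_funM => //; exact: measurable_funX.
  apply: measurable_funB; last exact: measurable_funM.
  apply: measurable_funB => //; apply: (measurableT_comp mphi).
  exact: measurable_funD.
have Tle x : `|T (x - p)| <= M * `|b| ^+ 3 + 0 * (x - p) + 0 * (x - p) ^+ 2
    + M * `|b| ^+ 3 * (x - p) ^+ 4.
  by apply: (le_trans (TB _)); rewrite !mul0r !addr0 mulrDr mulr1.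
have iT : P.-integrable setT (EFin \o (fun x => T (x - p))).
  by apply: EFin_le_integrable mT Tle _; exact: integrable_quartic.
have iq := integrable_quartic (phi a) (b * alpha a) (b ^+ 2 * beta a) 0.
have -> : \int[P]_x phi (a + (x - p) * b) =
    (phi a + b ^+ 2 * beta a * s2) + \int[P]_x T (x - p).
  rewrite -[X in X + _]addr0 -(mul0r (\int[P]_x (x - p) ^+ 4)).
  rewrite -(Rintegral_quartic _ (b * alpha a)) -RintegralD//.
  by apply: eq_Rintegral => x _; rewrite /T; ring.
have IT : `|\int[P]_x T (x - p)| <= M * `|b| ^+ 3 * 6.
  apply: (le_trans (le_normr_Rintegral _ iT)) => //.
  apply: (@le_trans _ _ (\int[P]_x (M * `|b| ^+ 3 + 0 * (x - p) + 0 * (x - p) ^+ 2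
      + M * `|b| ^+ 3 * (x - p) ^+ 4))).
    apply: le_Rintegral => //; first exact: integrable_norm.
    exact: integrable_quartic.
  rewrite Rintegral_quartic mul0r addr0 -{1}[M * _]mulr1 -mulrDr.
  rewrite ler_wpM2l ?mulr_ge0 ?exprn_ge0//; have := moment4; have := m4_le; lra.
have T1 : `|T (1 - p)| <= M * `|b| ^+ 3 * 2.
  apply: (le_trans (TB _)); rewrite ler_wpM2l ?mulr_ge0 ?exprn_ge0//.
  have : (1 - p) ^+ 4 <= 1 by rewrite exprn_ile1//; lra.
  lra.
have T0 : `|T (0 - p)| <= M * `|b| ^+ 3 * 2.
  apply: (le_trans (TB _)); rewrite ler_wpM2l ?mulr_ge0 ?exprn_ge0//.
  have : (0 - p) ^+ 4 <= 1 by rewrite sub0r exprNn -signr_odd mul1r exprn_ile1//; lra.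
  lra.
have -> : p * phi (a + (1 - p) * b) + (1 - p) * phi (a + (0 - p) * b)
    - (phi a + b ^+ 2 * beta a * s2 + \int[P]_x T (x - p)) =
    p * T (1 - p) + (1 - p) * T (0 - p) - \int[P]_x T (x - p).
  by rewrite s2E /T; ring.
have -> : 8 * M * `|b| ^+ 3 = (p * (M * `|b| ^+ 3 * 2) + (1 - p) * (M * `|b| ^+ 3 * 2))
    + M * `|b| ^+ 3 * 6 by ring.
apply: (le_trans (ler_normB _ _)); apply: lerD => //.
have q0 : 0 <= 1 - p by lra.
apply: (le_trans (ler_normD _ _)); rewrite !normrM (ger0_norm q0) (gtr0_norm p0).
by rewrite lerD// ler_wpM2l// ltW.
Qed.

(** Conditioning on bit 0 leaves polynomials in n variables, to which induction applies; bit 0 is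
    then replaced while the other coordinates are already distributed as [P]. That last step costs a
    third moment of the derivative in direction 0, split by 2 r^3 <= l r^2 + r^4/l. *)
Theorem lindeberg n (c : {set 'I_n} -> R) (l : R) : 0 < l ->
  `|cube_expect p (phi \o ceval c) - \int[iid P n]_t phi (teval c t)| <=
  8 * M * \sum_(i < n) (l * wnorm 4 (cderiv i c) + wnorm 4 (cderiv i c) ^+ 2 / l).
Proof.
move=> l0; elim: n c => [|n IH] c.
  rewrite big_ord0 mulr0 (cube_expect0 _ _ [ffun=> false]) Rintegral_iid0; last first.
    exact: (gphi c).1.
  by rewrite /= /ceval /teval !mlin0 subrr normr0.
set c0 := c \o slift false; set c1 := c \o slift true.
pose cb (b : bool) S := c0 S + (b%:R - p) * c1 S.
have cubeE : cube_expect p (phi \o ceval c) =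
    p * cube_expect p (phi \o ceval (cb true))
    + (1 - p) * cube_expect p (phi \o ceval (cb false)).
  rewrite cube_expect_cons; congr (_ * _ + _ * _); apply: eq_bigr => x _ /=;
    by rewrite ceval_fcons.
pose G (b : bool) := \int[iid P n]_t phi (teval (cb b) t).
pose B (c : {set 'I_n} -> R) := \sum_(i < n) (l * wnorm 4 (cderiv i c) + wnorm 4 (cderiv i c) ^+ 2 / l).
have [p0 p1] := andP p01; have q0 : 0 <= 1 - p by lra.
have step1 : `|cube_expect p (phi \o ceval c) - (p * G true + (1 - p) * G false)| <=
    8 * M * (p * B (cb true) + (1 - p) * B (cb false)).
  rewrite cubeE; set et := cube_expect _ _; set ef := cube_expect _ _.
  have -> : p * et + (1 - p) * ef - (p * G true + (1 - p) * G false) =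
    p * (et - G true) + (1 - p) * (ef - G false) by ring.
  rewrite [leRHS]mulrDr.
  apply: (le_trans (ler_normD _ _)); rewrite !normrM (ger0_norm q0) (gtr0_norm p0).
  by rewrite !(mulrCA (8 * M)) lerD// ler_wpM2l ?(ltW p0)//; exact: IH.
(* Fixing bit 0 does not increase the error bound on average: this is the two-point form of the
   fourth-moment induction, with the variance of the bit at most 1 and its fourth central moment
   [kappa] at most 1. *)
have step2 : p * B (cb true) + (1 - p) * B (cb false) <=
    \sum_(i < n) (l * wnorm 4 (cderiv (lift ord0 i) c)
                   + wnorm 4 (cderiv (lift ord0 i) c) ^+ 2 / l).
  rewrite /B !big_distrr -big_split; apply: ler_sum => i _ /=.
  have cbE b : wnorm 4 (cderiv i (cb b)) =
      wnorm 4 (fun S => cderiv i c0 S + (b%:R - p) * cderiv i c1 S).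
    by apply: eq_wnorm => S; rewrite /cderiv; case: ifP => _; rewrite ?mulr0 ?addr0.
  have -> : wnorm 4 (cderiv (lift ord0 i) c) =
      wnorm 4 (cderiv i c0) + 4 * wnorm 4 (cderiv i c1).
    by rewrite wnorm_cons; congr (_ + _ * _); apply: eq_wnorm => S; rewrite -cderiv_lift.
  rewrite !cbE.
  have le2 b := @wnorm_line_sqr_le _ 4 _ (cderiv i c0) (cderiv i c1) (ler0n _ _) (b%:R - p).
  have := le2 true; have := le2 false; rewrite /quartic_majorant !wnorm_line.
  have := wnorm_ge0 (cderiv i c0) (ler0n R 4); have := wnorm_ge0 (cderiv i c1) (ler0n R 4).
  move: (wnorm 4 _) (wnorm 4 _) (\sum_(S : {set 'I_n}) _) => D A w D0 A0 l2f l2t.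
  set qt := A + 2 * (true%:R - p) * w + _ in l2t *.
  set qf := A + 2 * (false%:R - p) * w + _ in l2f *.
  have E1 : p * qt + (1 - p) * qf <= A + 4 * D.
    rewrite /qt /qf; have -> : p * (A + 2 * (true%:R - p) * w + (true%:R - p) ^+ 2 * D)
      + (1 - p) * (A + 2 * (false%:R - p) * w + (false%:R - p) ^+ 2 * D) = A + s2 * D.
      by rewrite s2E /=; ring.
    by rewrite lerD2l ler_wpM2r// (le_trans s2_le1)// ler1n.
  have E2 : p * qt ^+ 2 + (1 - p) * qf ^+ 2 <= (A + 4 * D) ^+ 2.
    apply: (le_trans (lerD (ler_wpM2l (ltW p0) l2t) (ler_wpM2l q0 l2f))).
    pose kappa := p * (1 - p) ^+ 4 + (1 - p) * p ^+ 4.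
    have kappa1 : kappa <= 1.
      have k1 : (1 - p) ^+ 4 <= 1 by rewrite exprn_ile1//; lra.
      have k2 : p ^+ 4 <= 1 by rewrite exprn_ile1//; lra.
      by rewrite /kappa; nra.
    rewrite [leLHS](_ : _ = A ^+ 2 + 8 * (A * D) * s2 + 3 * D ^+ 2 * kappa); last first.
      by rewrite s2E /kappa /=; ring.
    have AD : 8 * (A * D) * s2 <= 8 * (A * D) by rewrite ler_piMr// mulr_ge0// mulr_ge0.
    have DD : 3 * D ^+ 2 * kappa <= 3 * D ^+ 2 by rewrite ler_piMr// mulr_ge0// sqr_ge0.
    have := sqr_ge0 D; nra.
  rewrite [leLHS](_ : _ = l * (p * qt + (1 - p) * qf) + (p * qt ^+ 2 + (1 - p) * qf ^+ 2) / l).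
    by rewrite lerD// ?ler_wpM2l ?(ltW l0)// ler_wpM2r// invr_ge0 ltW.
  by ring.
have step3 : `|(p * G true + (1 - p) * G false) - \int[iid P n.+1]_t phi (teval c t)| <=
    8 * M * (l * wnorm 4 c1 + wnorm 4 c1 ^+ 2 / l).
  rewrite (Rintegral_iidS_tail (intX 4) (gphi c)).
  have gphicb b : (iid P n).-integrable setT (EFin \o (fun t => phi (teval (cb b) t))).
    exact: (quartic_growth_integrable (intX 4) (gphi (cb b))).
  have gtail := quartic_growth_integrable (intX 4)
    (quartic_growth_Rintegral (intX 4) (gphi c)).
  have ipG := EFin_integrableZl p (gphicb true).
  have iqG := EFin_integrableZl (1 - p) (gphicb false).
  have ipq := EFin_integrableD ipG iqG.
  have ipqr := EFin_integrableB ipq gtail.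
  rewrite /G -!RintegralZl// -RintegralD// -RintegralB//.
  apply: (le_trans (le_normr_Rintegral _ ipqr)) => //.
  have i2 := quartic_growth_integrable (intX 4) (growth2 c1).
  have i4 := quartic_growth_integrable (intX 4) (growth4 c1).
  have i24 := EFin_integrableD (EFin_integrableZl l i2) (EFin_integrableZl l^-1 i4).
  apply: (@le_trans _ _ (\int[iid P n]_t (8 * M * (l * teval c1 t ^+ 2 + l^-1 * teval c1 t ^+ 4)))).
    apply: le_Rintegral => //; first exact: integrable_norm.
      exact: EFin_integrableZl.
    move=> t _; rewrite /cb !teval_lincomb.
    under [X in _ - X]eq_Rintegral do rewrite /= teval_cons.
    apply: (le_trans (one_coordinate_swap _ _)); rewrite ler_wpM2l ?mulr_ge0//.
    rewrite -/c0 -/c1 -[X in l * X]real_normK ?num_real//.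
    have -> : teval c1 t ^+ 4 = `|teval c1 t| ^+ 4.
      by rewrite -normrX ger0_norm// exprn_even_ge0.
    have := normr_ge0 (teval c1 t); move: `|teval c1 t| => r r0.
    have -> : l * r ^+ 2 + l^-1 * r ^+ 4 = (2 * r ^+ 3) + r ^+ 2 * (l - r) ^+ 2 / l.
      by field; rewrite gt_eqF.
    have : 0 <= r ^+ 2 * (l - r) ^+ 2 / l by rewrite divr_ge0 ?(ltW l0)// mulr_ge0 ?sqr_ge0.
    have : 0 <= r ^+ 3 by rewrite exprn_ge0.
    lra.
  rewrite RintegralZl// RintegralD//; last 2 first.
    exact: EFin_integrableZl.
    exact: EFin_integrableZl.
  rewrite !RintegralZl// teval_second_moment ler_wpM2l ?mulr_ge0// [leRHS]addrC addrC.
  rewrite (mulrC (_ ^+ 2)) lerD// ler_wpM2l ?invr_ge0 ?(ltW l0)//.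
    by apply: wnorm_le => //; rewrite (le_trans s2_le1)// ler1n.
  exact: teval_fourth_moment.
rewrite big_ord_recl wnorm_cderiv0 mulrDr [leRHS]addrC.
apply: le_trans (ler_distD (p * G true + (1 - p) * G false) _ _) _.
apply: lerD => //; apply: (le_trans step1).
by rewrite ler_wpM2l// mulr_ge0.
Qed.

End GaussianSide.

(** * Smoothing of a Lipschitz function *)

Section Antiderivative.
Context {R : realType}.
Local Notation mu := (@lebesgue_measure R).
Variable f : R -> R.
Hypothesis cf : continuous f.

Let integrable_segment (a b : R) : mu.-integrable `[a, b] (EFin \o f).
Proof.
apply: continuous_compact_integrable; first exact: segment_compact.
exact: continuous_subspaceT.
Qed.

Let segment_from (N x : R) := \int[mu]_(t in `[- N, x]) f t.

Let segment_fromB (M N x y : R) : M <= N -> - M < x -> - M < y ->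
  segment_from N x - segment_from N y = segment_from M x - segment_from M y.
Proof.
move=> MN Mx My.
have E z : - M < z -> segment_from N z = segment_from N (- M) + segment_from M z.
  move=> Mz; apply/eqP; rewrite -subr_eq0 opprD addrA subr_eq0; apply/eqP.
  rewrite /segment_from Rintegral_itvB//.
  - rewrite Rintegral_itv_obnd_cbnd//.
    by apply: integrableS (integrable_segment (- N) z) => //; apply: subset_itvr; rewrite bnd_simp lerN2.
  - by rewrite bnd_simp lerN2.
  - by rewrite bnd_simp ltW.
by rewrite (E x)// (E y)//; ring.
Qed.

(** The integral from -N to x minus the integral from -N to 0 does not depend on N once -N lies
    below both x and 0. So N may vary with x in the definition of [F], yet be frozen near a given
    point when differentiating. *)
Lemma continuous_antiderivative : exists F : R -> R, forall x : R, is_derive x (1 : R) F (f x).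
Proof.
pose F (x : R) := segment_from (`|x| + 1) x - segment_from (`|x| + 1) 0.
exists F => x0; pose N : R := `|x0| + 2.
have N0 : - N < x0.
  by rewrite /N; have := ler_norm (- x0); rewrite normrN; lra.
have [dF dFE] : derivable (segment_from N) x0 1 /\ derive1 (segment_from N) x0 = f x0.
  apply: (@continuous_FTC1 R f (BLeft (- N)) x0 (x0 + 1)) => //.
  - by rewrite ltrDl.
  - exact: cf.
have dN : is_derive x0 (1 : R) (segment_from N) (f x0).
  by apply: DeriveDef; [exact: dF|rewrite -derive1E].
have n1 : \forall x \near x0, `|x0 - x| <= 1.
  by apply: (@cvgr_dist_le _ _ _ (nbhs x0) _ id) => //; exact: cvg_id.
have FN : {near x0, (fun x => segment_from N x - segment_from N 0) =1 F}.
  near=> x; rewrite /F; apply: segment_fromB.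
  - have x0x : `|x0 - x| <= 1 by near: x; exact: n1.
    by rewrite /N; have := ler_dist_dist x x0; rewrite (distrC x) ler_norml => /andP[_]; lra.
  - by have := ler_norm (- x); rewrite normrN; lra.
  - by have := normr_ge0 x; lra.
apply: (near_eq_is_derive FN).
by apply: is_derive_eq; rewrite subr0.
Unshelve. all: by end_near. Qed.

End Antiderivative.

Section Smoothing.
Context {R : realType}.
Variables (psi : R -> R) (C e : R).
Hypothesis psi_lip : forall x y, `|psi x - psi y| <= C * `|x - y|.
Hypothesis e_gt0 : 0 < e.

Lemma lipschitz_continuous : continuous psi.
Proof.
have C0 : 0 <= C.
  by have := psi_lip 1 0; rewrite subr0 normr1 mulr1 => /(le_trans (normr_ge0 _)).
move=> x; apply/cvgrPdist_le => eps eps0; near=> y.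
apply: (le_trans (psi_lip _ _)).
have : `|x - y| <= eps / (C + 1).
  near: y; apply: (@cvgr_dist_le _ _ _ (nbhs x) _ id); first exact: cvg_id.
  by rewrite divr_gt0// ltr_pwDr.
rewrite ler_pdivlMr ?ltr_pwDr// => h; have := normr_ge0 (x - y); nra.
Unshelve. all: by end_near. Qed.

(* Second difference of step [e] of a second antiderivative of [psi]; [phi2] is half its second
   derivative, which is [4 * C / e ^+ 2]-Lipschitz. *)
Lemma smooth_approximation : exists phi phi1 phi2 : R -> R,
  [/\ continuous phi,
      forall x, `|phi x - psi x| <= 10 * C * e &
      forall a h, `|phi (a + h) - phi a - h * phi1 a - h ^+ 2 * phi2 a|
                  <= 4 * C / e ^+ 2 * `|h| ^+ 3].
Proof.
have [F1 dF1] := continuous_antiderivative lipschitz_continuous.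
have cF1 : continuous F1.
  by move=> x; apply/differentiable_continuous/derivable1_diffP; have [] := dF1 x.
have [F dF] := continuous_antiderivative cF1.
pose D2 (f : R -> R) x := e ^- 2 * (f (x + 2 * e) - 2 * f (x + e) + f x).
have e2 : 0 < e ^+ 2 by rewrite exprn_gt0.
have sh (f f' : R -> R) (c : R) : (forall x : R, is_derive x (1 : R) f (f' x)) ->
    forall x : R, is_derive x (1 : R) (fun t => f (t + c)) (f' (x + c)).
  move=> df x; have dfa := df (x + c).
  have := @is_derive1_comp _ f (fun t => t + c) x (f' (x + c)) 1.
  rewrite mulr1; apply => //.
  by rewrite -[X in is_derive _ _ _ X]addr0; exact: (@is_deriveD _ _ _ id (cst c)).
have dD2 (f f' : R -> R) : (forall x : R, is_derive x (1 : R) f (f' x)) ->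
    forall x : R, is_derive x (1 : R) (D2 f) (D2 f' x).
  move=> df x; have d1 := sh _ _ (2 * e) df x; have d2 := sh _ _ e df x.
  by rewrite /D2; apply: is_derive_eq; rewrite /GRing.scale/=; ring.
exists (D2 F), (D2 F1), (fun x => D2 psi x / 2); split.
- move=> x; apply/differentiable_continuous/derivable1_diffP.
  by have [] := dD2 _ _ dF x.
- move=> x.
  (* The remainders at steps 2e and e are at most 8 C e^3 and C e^3. In the second difference the
     first-order terms cancel and the second-order ones add up to e^2 psi(x), which leaves an error
     of (8 + 2) C e^3. *)
  have tl h := taylor2_bound dF dF1 (fun y _ => psi_lip y x) (h := h).
  have := tl e; have := tl (2 * e); rewrite (gtr0_norm e_gt0) (@gtr0_norm _ (2 * e)) ?mulr_gt0//.
  rewrite !ler_norml => /andP[l1 u1] /andP[l2 u2].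
  have -> : D2 F x - psi x = e ^- 2 * (F (x + 2 * e) - 2 * F (x + e) + F x - e ^+ 2 * psi x).
    by rewrite mulrBr mulKf// gt_eqF.
  rewrite -ler_norml normrM gtr0_norm ?invr_gt0// ler_pdivrMl// ler_norml.
  by apply/andP; split; lra.
- move=> a h; have := taylor2_bound (dD2 _ _ dF) (dD2 _ _ dF1) (a := a) (h := h)
    (L := 4 * C / e ^+ 2).
  rewrite (_ : h ^+ 2 / 2 * D2 psi a = h ^+ 2 * (D2 psi a / 2)); last by ring.
  apply => x _.
  (* The three Lipschitz increments carry weights 1, 2, 1, whence 4 C. *)
  have -> : D2 psi x - D2 psi a = e ^- 2 * ((psi (x + 2 * e) - psi (a + 2 * e))
    - 2 * (psi (x + e) - psi (a + e)) + (psi x - psi a)) by rewrite /D2; ring.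
  rewrite normrM ger0_norm ?invr_ge0 ?(ltW e2)// [leRHS]mulrAC [leRHS]mulrC.
  rewrite ler_wpM2l ?invr_ge0 ?(ltW e2)//.
  have h0 := psi_lip x a; have h1 := psi_lip (x + e) (a + e).
  have h2 := psi_lip (x + 2 * e) (a + 2 * e).
  have shE c : x + c - (a + c) = x - a by ring.
  rewrite !shE in h1 h2.
  move: h0 h1 h2; rewrite !ler_norml => /andP[? ?] /andP[? ?] /andP[? ?].
  by apply/andP; split; lra.
Qed.

End Smoothing.

(** * Harmonic polynomials on the slices *)

Section CoordinateDerivatives.
Context {R : realFieldType} {n : nat}.
Implicit Types (c : {set 'I_n} -> R) (y : 'I_n -> R).

(** The sum is the coefficient at T of the sum of all partial derivatives. *)
Definition harmonic c := forall T : {set 'I_n}, \sum_(i | i \notin T) c (i |: T)%SET = 0.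
Definition homogeneous (e : nat) c := forall S : {set 'I_n}, #|S| != e -> c S = 0.

Lemma sum_setU1 (V : nmodType) i (F : {set 'I_n} -> V) :
  \sum_(S : {set 'I_n} | i \in S) F S = \sum_(T : {set 'I_n} | i \notin T) F (i |: T)%SET.
Proof.
rewrite (reindex_onto (fun T => i |: T)%SET (fun S => S :\ i)%SET); last first.
  by move=> S iS; rewrite finset.setD1K.
apply: eq_bigl => T; rewrite finset.setU11 /=; apply/eqP/idP => [<-|iT]; first by rewrite setD11.
by rewrite finset.setU1K.
Qed.

Lemma mlin_cderivE i c y :
  mlin (cderiv i c) y = \sum_(S : {set 'I_n} | i \in S) c S * \prod_(j in S :\ i) y j.
Proof.
rewrite sum_setU1 /mlin /cderiv [RHS]big_mkcond; apply: eq_bigr => T _ /=.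
by case: (boolP (i \in T)) => iT /=; rewrite ?mul0r// finset.setU1K.
Qed.

Lemma mul_mlin_cderiv i c y :
  y i * mlin (cderiv i c) y = \sum_(S : {set 'I_n} | i \in S) c S * \prod_(j in S) y j.
Proof.
rewrite mlin_cderivE big_distrr; apply: eq_bigr => S iS /=.
by rewrite mulrCA [in RHS](big_setD1 i).
Qed.

Lemma mlin_update i c y y' : (forall j, j != i -> y' j = y j) ->
  mlin c y' = mlin c y + (y' i - y i) * mlin (cderiv i c) y.
Proof.
move=> yy.
have split z : mlin c z = \sum_(S : {set 'I_n} | i \notin S) c S * \prod_(j in S) z j
    + z i * mlin (cderiv i c) z.
  by rewrite mul_mlin_cderiv addrC /mlin (bigID (fun S : {set 'I_n} => i \in S)).
rewrite !split [X in X + _ = _](_ : _ = \sum_(S : {set 'I_n} | i \notin S) c S * \prod_(j in S) y j).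
  rewrite [X in _ + _ * X = _](_ : _ = mlin (cderiv i c) y); first by ring.
  rewrite !mlin_cderivE; apply: eq_bigr => S iS; congr (_ * _); apply: eq_bigr => j.
  by rewrite !inE => /andP[ji _]; exact: yy.
apply: eq_bigr => S iS; congr (_ * _); apply: eq_bigr => j jS; apply: yy.
by apply: contraNneq iS => <-.
Qed.

Lemma euler e c y : homogeneous e c -> \sum_i y i * mlin (cderiv i c) y = e%:R * mlin c y.
Proof.
move=> ce; under eq_bigr do rewrite mul_mlin_cderiv.
rewrite (exchange_big_dep xpredT)//= /mlin big_distrr; apply: eq_bigr => S _ /=.
rewrite (eq_bigl (mem S))// sumr_const mulr_natl.
by have [->//|/ce->] := eqVneq #|S| e; rewrite mul0r !mul0rn.
Qed.

Lemma harmonic_sum_cderiv c y : harmonic c -> \sum_i mlin (cderiv i c) y = 0.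
Proof.
move=> hc; rewrite /mlin exchange_big big1// => T _ /=.
rewrite -big_distrl /= [X in X * _](_ : _ = 0) ?mul0r//.
rewrite -[RHS](hc T) [RHS]big_mkcond; apply: eq_bigr => i _.
by rewrite /cderiv; case: (i \in T).
Qed.

End CoordinateDerivatives.

Lemma card_ltn_ord n m : (m <= n)%N -> #|[pred j : 'I_n | (j < m)%N]| = m.
Proof.
by move=> mn; rewrite -sum1_card -(big_ord_widen n (fun=> 1%N))// sum_nat_const card_ord muln1.
Qed.

Section RandomOrder.
Context {R : realFieldType} {n : nat}.
Local Notation cube := {ffun 'I_n -> bool}.
Implicit Types (c : {set 'I_n} -> R) (x : cube) (s : {perm 'I_n}).

Definition feval c x : R := mlin c (fun i => (x i)%:R).

(* A uniform ordering of the coordinates yields, by truncation, a monotone coupling of all slices. *)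
Definition prefix_point (l : nat) s : cube := [ffun i => (s i < l)%N].

(** Exchanging the ranks l and j in the ordering makes the coordinate of rank j the next one to be
    switched on. The increment of f is exactly a partial derivative, since f is affine in each
    coordinate. *)
Lemma prefix_point_up c l (j : 'I_n) s : (l <= j)%N ->
  forall ln : (l < n)%N,
  feval c (prefix_point l.+1 (s * tperm (Ordinal ln) j)%g) =
  feval c (prefix_point l s) + mlin (cderiv ((s^-1)%g j) c) (fun i => (prefix_point l s i)%:R).
Proof.
move=> lj ln; rewrite /feval (@mlin_update _ _ ((s^-1)%g j) _ (fun i => (prefix_point l s i)%:R)).
  rewrite !ffunE permM permKV tpermR /= ltnSn ltnNge lj /=; congr (_ + _).
  by rewrite subr0 mul1r.
move=> i ij; rewrite !ffunE permM; congr (_%:R); congr (nat_of_bool _).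
have sij : s i != j by apply: contraNneq ij => <-; rewrite permK.
case: tpermP => [sl|sj|/eqP sl _].
- have jl : (l < j)%N.
    rewrite ltn_neqAle lj andbT; apply: contraNneq sij => jl.
    by rewrite sl; apply/eqP/val_inj.
  by rewrite sl /= ltnn ltnS leqNgt jl.
- by rewrite sj eqxx in sij.
- by rewrite ltnS leq_eqVlt -[l in _ == l]/(val (Ordinal ln)) val_eqE (negbTE sl).
Qed.

Lemma prefix_point_down c k (j : 'I_n) s : (j <= k)%N ->
  forall kn : (k < n)%N,
  feval c (prefix_point k (s * tperm (Ordinal kn) j)%g) =
  feval c (prefix_point k.+1 s) -
  mlin (cderiv ((s^-1)%g j) c) (fun i => (prefix_point k.+1 s i)%:R).
Proof.
move=> jk kn; rewrite /feval (@mlin_update _ _ ((s^-1)%g j) _ (fun i => (prefix_point k.+1 s i)%:R)).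
  rewrite !ffunE permM permKV tpermR /= ltnn ltnS jk /=; congr (_ + _).
  by rewrite sub0r mulN1r.
move=> i ij; rewrite !ffunE permM; congr (_%:R); congr (nat_of_bool _).
have sij : s i != j by apply: contraNneq ij => <-; rewrite permK.
case: tpermP => [sk|sj|/eqP sk _].
- have jl : (j < k)%N.
    rewrite ltn_neqAle jk andbT; apply: contraNneq sij => kj.
    by rewrite sk; apply/eqP/val_inj.
  by rewrite sk /= ltnSn jl.
- by rewrite sj eqxx in sij.
- by rewrite ltnS [in RHS]leq_eqVlt -[k in _ == k]/(val (Ordinal kn)) val_eqE (negbTE sk).
Qed.

Lemma prefix_point_tperm l m (j : 'I_n) s (ln : (l < n)%N) :
  (m <= l)%N && (m <= j)%N || (l < m)%N && (j < m)%N ->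
  prefix_point m (s * tperm (Ordinal ln) j)%g = prefix_point m s.
Proof.
move=> h; apply/ffunP => i; rewrite !ffunE permM.
case: tpermP => [->|->|//] /=; case/orP: h => /andP[h1 h2]; lia.
Qed.

Definition order_sum (h g : cube -> R) (k l : nat) : R :=
  \sum_s h (prefix_point k s) * g (prefix_point l s).

Lemma order_sumC h g k l : order_sum h g k l = order_sum g h l k.
Proof. by apply: eq_bigr => s _; rewrite mulrC. Qed.

(* The [l]-th coordinate of the ordering is uniform among those not yet switched on: by harmonicity the
   average increment is a sum over the coordinates that are on, which Euler's identity evaluates. *)
Lemma order_sum_up e c (h : cube -> R) k l : harmonic c -> homogeneous e c ->
  (k <= l)%N -> (l < n)%N ->
  (n - l)%:R * order_sum h (feval c) k l.+1 = ((n - l)%:R - e%:R) * order_sum h (feval c) k l.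
Proof.
move=> hc ec kl ln.
have card : #|[pred j : 'I_n | (l <= j)%N]| = (n - l)%N.
  have := cardC [pred j : 'I_n | (j < l)%N]; rewrite card_ord card_ltn_ord ?(ltnW ln)// => cc.
  rewrite -[in RHS]cc addKn; apply: eq_card => j; by rewrite !inE -leqNgt.
transitivity (\sum_(j : 'I_n | (l <= j)%N) order_sum h (feval c) k l.+1).
  by rewrite sumr_const card mulr_natl.
transitivity (\sum_(j : 'I_n | (l <= j)%N) \sum_s h (prefix_point k s) *
    (feval c (prefix_point l s)
     + mlin (cderiv ((s^-1)%g j) c) (fun i => (prefix_point l s i)%:R))).
  apply: eq_bigr => j lj.
  rewrite /order_sum (reindex_inj (mulIg (tperm (Ordinal ln) j))) /=.
  apply: eq_bigr => s _; rewrite prefix_point_up// prefix_point_tperm//.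
  by rewrite kl (leq_trans kl lj).
rewrite exchange_big /order_sum big_distrr; apply: eq_bigr => s _ /=.
rewrite -big_distrr mulrCA; congr (_ * _); rewrite big_split sumr_const card mulrBl /=.
congr (_ + _); first by rewrite mulr_natl.
set y := fun i => (prefix_point l s i)%:R : R.
rewrite (reindex_inj (@perm_inj _ s)) /=; under eq_bigr do rewrite permK.
transitivity (\sum_i (mlin (cderiv i c) y - y i * mlin (cderiv i c) y)); last first.
  by rewrite sumrB harmonic_sum_cderiv// (euler _ ec) sub0r.
rewrite big_mkcond.
apply: eq_bigr => i _; rewrite /y ffunE leqNgt; case: ltnP => _ /=; ring.
Qed.

(** The coordinate of rank k is uniform among the k + 1 that are on. Removing it costs a derivative
    in that direction, and Euler's identity sums these derivatives over the coordinates that are on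
    to e f. *)
Lemma order_sum_down e c (h : cube -> R) k l : homogeneous e c ->
  (k < l)%N -> (l <= n)%N ->
  k.+1%:R * order_sum (feval c) h k l = (k.+1%:R - e%:R) * order_sum (feval c) h k.+1 l.
Proof.
move=> ec kl ln; have kn := leq_trans kl ln.
have card : #|[pred j : 'I_n | (j < k.+1)%N]| = k.+1 by exact: card_ltn_ord.
transitivity (\sum_(j : 'I_n | (j < k.+1)%N) order_sum (feval c) h k l).
  by rewrite sumr_const card mulr_natl.
transitivity (\sum_(j : 'I_n | (j < k.+1)%N) \sum_s
    (feval c (prefix_point k.+1 s)
     - mlin (cderiv ((s^-1)%g j) c) (fun i => (prefix_point k.+1 s i)%:R)) * h (prefix_point l s)).
  apply: eq_bigr => j jk.
  rewrite /order_sum (reindex_inj (mulIg (tperm (Ordinal kn) j))) /=.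
  apply: eq_bigr => s _; rewrite prefix_point_down// prefix_point_tperm//.
  by rewrite kl (leq_trans jk kl) orbT.
rewrite exchange_big /order_sum big_distrr; apply: eq_bigr => s _ /=.
rewrite -big_distrl mulrA; congr (_ * _); rewrite sumrB sumr_const card mulrBl /=.
congr (_ - _); first by rewrite mulr_natl.
set y := fun i => (prefix_point k.+1 s i)%:R : R.
rewrite (reindex_inj (@perm_inj _ s)) /=; under eq_bigr do rewrite permK.
rewrite -(euler y ec) big_mkcond.
apply: eq_bigr => i _; rewrite /y ffunE; case: ltnP => _ /=; ring.
Qed.

End RandomOrder.

(** * Slice averages as averages over orderings, and slice moments *)

Section Symmetrization.
Context {R : realType} {n : nat}.
Local Notation cube := {ffun 'I_n -> bool}.
Implicit Types (x : cube) (s : {perm 'I_n}) (g : cube -> R).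

Definition weight x : nat := (\sum_(i < n) x i)%N.
Definition permute s x : cube := [ffun i => x (s i)].

Lemma permute_inj s : injective (permute s).
Proof.
move=> x y xy; apply/ffunP => i; rewrite -(permKV s i).
by have /ffunP/(_ ((s^-1)%g i)) := xy; rewrite !ffunE.
Qed.

Lemma weight_permute s x : weight (permute s x) = weight x.
Proof.
rewrite /weight [RHS](reindex_inj (@perm_inj _ s)).
by apply: eq_bigr => i _; rewrite ffunE.
Qed.

Lemma permute_prefix_point m s s' :
  permute s (prefix_point m s') = prefix_point m (s * s')%g.
Proof. by apply/ffunP => i; rewrite !ffunE permM. Qed.

Lemma weight_prefix_point m s : (m <= n)%N -> weight (prefix_point m s) = m.
Proof.
move=> mn; rewrite -[RHS](card_ltn_ord mn) -sum1_card big_mkcond.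
rewrite [RHS](reindex_inj (@perm_inj _ s)); apply: eq_bigr => i _.
by rewrite ffunE /= unfold_in; case: ltnP.
Qed.

Lemma weight_le x : (weight x <= n)%N.
Proof.
rewrite -[leqRHS]card_ord -sum1_card; apply: leq_sum => i _; exact: leq_b1.
Qed.

(** The ordering lists the coordinates that are on before those that are off. *)
Lemma prefix_point_surj x : exists s, x = prefix_point (weight x) s.
Proof.
pose e := enum [pred i | x i] ++ enum [pred i | ~~ x i].
have ue : uniq e.
  rewrite cat_uniq !enum_uniq andbT /=; apply/hasPn => i.
  by rewrite !mem_enum !inE.
have me i : i \in e by rewrite mem_cat !mem_enum !inE orbN.
have se : size e = n.
  rewrite size_cat -!cardE -[RHS]card_ord -(cardC [pred i | x i]); congr (_ + _)%N.
have lt i : (index i e < n)%N by rewrite -[X in (_ < X)%N]se index_mem.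
pose f i := Ordinal (lt i).
have fi : injective f.
  by move=> i j /(congr1 val)/= ij; rewrite -(nth_index i (me i)) ij nth_index.
exists (perm fi); apply/ffunP => i; rewrite ffunE permE /= /e index_cat.
have -> : weight x = size (enum [pred i | x i]).
  by rewrite -cardE -sum1_card [RHS]big_mkcond; apply: eq_bigr => j _; rewrite inE; case: (x j).
rewrite mem_enum inE; case: (boolP (x i)) => xi; last by rewrite ltnNge leq_addr.
by rewrite index_mem mem_enum inE xi.
Qed.

Definition order_avg g (l : nat) : R := (\sum_s g (prefix_point l s)) / n`!%:R.

Lemma sum_permute x g : (\sum_s g (permute s x)) / n`!%:R = order_avg g (weight x).
Proof.
have [s' {1}->] := prefix_point_surj x; congr (_ / _).
rewrite [RHS](reindex_inj (mulIg s')); apply: eq_bigr => s _.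
by rewrite permute_prefix_point.
Qed.

(** Averaging over the symmetric group replaces g by its mean over the orbit, and the orbits are the
    slices. It serves both the indicator of a slice and the product weights of the cube. *)
Lemma sum_symmetric (w g : cube -> R) : (forall s x, w (permute s x) = w x) ->
  \sum_x w x * g x = \sum_x w x * order_avg g (weight x).
Proof.
move=> ws; transitivity (\sum_(s : {perm 'I_n}) (\sum_x w x * g x) / n`!%:R).
  rewrite sumr_const (_ : #|_| = n`!); last by rewrite -card_Sn; apply: eq_card.
  by rewrite -[RHS]mulr_natr divfK// pnatr_eq0 -lt0n fact_gt0.
transitivity (\sum_(s : {perm 'I_n}) (\sum_x w x * g (permute s x)) / n`!%:R).
  apply: eq_bigr => s _; congr (_ / _); rewrite (reindex_inj (@permute_inj s)).
  by apply: eq_bigr => x _; rewrite ws.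
rewrite -mulr_suml exchange_big mulr_suml; apply: eq_bigr => x _ /=.
by rewrite -big_distrr /= -mulrA sum_permute.
Qed.

Lemma slice_expectE k g : (k <= n)%N -> slice_expect k g = order_avg g k.
Proof.
move=> kn; rewrite /slice_expect.
have k0 : (0 < #|@slice n k|)%N.
  apply/card_gt0P; exists (prefix_point k 1%g).
  by rewrite inE; apply/eqP; exact: weight_prefix_point.
have -> : \sum_(x in slice k) g x = \sum_x (x \in slice k)%:R * g x.
  by rewrite big_mkcond; apply: eq_bigr => x _; case: (_ \in _); rewrite ?mul1r ?mul0r.
rewrite (sum_symmetric (w := fun x => (x \in slice k)%:R)); last first.
  by move=> s x; rewrite !inE -/(weight x) -/(weight (permute s x)) weight_permute.
rewrite (eq_bigr (fun x => (x \in slice k)%:R * order_avg g k)); last first.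
  by move=> x _; rewrite inE -/(weight x); case: eqP => [->|_]; rewrite ?mul0r.
rewrite -mulr_suml -natr_sum.
have -> : (\sum_(x : cube) (x \in slice k) = #|@slice n k|)%N.
  by rewrite -sum1_card [RHS]big_mkcond; apply: eq_bigr => x _; case: (_ \in _).
by rewrite mulrAC divff ?mul1r// pnatr_eq0 -lt0n.
Qed.

Lemma cube_expect_order_avg p g :
  cube_expect p g = cube_expect p (fun x => order_avg g (weight x)).
Proof.
rewrite /cube_expect sum_symmetric// => s x.
rewrite [RHS](reindex_inj (@perm_inj _ s)).
by apply: eq_bigr => i _; rewrite ffunE.
Qed.

End Symmetrization.

Section SliceMoments.
Context {R : realType} {n : nat}.
Local Notation cube := {ffun 'I_n -> bool}.
Implicit Types (c : {set 'I_n} -> R) (h g : cube -> R).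

Definition pair_avg h g k l : R := order_sum h g k l / n`!%:R.

Lemma pair_avgC h g k l : pair_avg h g k l = pair_avg g h l k.
Proof. by rewrite /pair_avg order_sumC. Qed.

Lemma pair_avg_diag h g k : pair_avg h g k k = order_avg (fun x => h x * g x) k.
Proof. by []. Qed.

Lemma pair_avg_up e c h k l : harmonic c -> homogeneous e c -> (k <= l)%N -> (l < n)%N ->
  (n - l)%:R * pair_avg h (feval c) k l.+1 = ((n - l)%:R - e%:R) * pair_avg h (feval c) k l.
Proof. by move=> hc ec kl ln; rewrite /pair_avg mulrA (order_sum_up h hc ec)// mulrA. Qed.

Lemma pair_avg_down e c h k l : homogeneous e c -> (k < l)%N -> (l <= n)%N ->
  k.+1%:R * pair_avg (feval c) h k l = (k.+1%:R - e%:R) * pair_avg (feval c) h k.+1 l.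
Proof. by move=> ec kl ln; rewrite /pair_avg mulrA (order_sum_down h ec)// mulrA. Qed.

(** The two cross-correlations between levels k and k+1 are computed both upwards, from the diagonal
    value b at level k, and downwards, from the diagonal value at level k+1. Eliminating the latter
    leaves (k+1)(e-e')(n+1-e-e') b = 0. *)
Lemma homogeneous_orthogonal e e' c c' k : harmonic c -> harmonic c' ->
  homogeneous e c -> homogeneous e' c' -> e != e' -> (e + e' <= n)%N -> (k < n)%N ->
  pair_avg (feval c) (feval c') k k = 0.
Proof.
move=> hc hc' ec ec' ee' een kn.
have u1 := pair_avg_up (feval c) hc' ec' (leqnn k) kn.
have u2 := pair_avg_up (feval c') hc ec (leqnn k) kn.
have d1 := pair_avg_down (feval c') ec (ltnSn k) kn.
have d2 := pair_avg_down (feval c) ec' (ltnSn k) kn.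
rewrite [pair_avg (feval c') (feval c) k k]pair_avgC in u2.
rewrite [pair_avg (feval c') (feval c) k.+1 k.+1]pair_avgC in d2.
move: u1 u2 d1 d2; rewrite natrB 1?ltnW//.
move: (pair_avg _ _ k k) (pair_avg _ _ k k.+1) (pair_avg _ _ k k.+1) (pair_avg _ _ k.+1 k.+1).
move=> b m m' b' u1 u2 d1 d2; apply/eqP.
have : (k.+1%:R : R) * (e%:R - e'%:R) * (n.+1%:R - e%:R - e'%:R) * b = 0.
  have -> : (k.+1%:R : R) * (e%:R - e'%:R) * (n.+1%:R - e%:R - e'%:R) * b =
     (k.+1%:R * ((n%:R - k%:R - e'%:R) * b)) * (k.+1%:R - e'%:R) -
     (k.+1%:R * ((n%:R - k%:R - e%:R) * b)) * (k.+1%:R - e%:R) by rewrite -!natr1; ring.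
  rewrite -u1 -u2 !(mulrCA k.+1%:R) d1 d2; ring.
move/eqP; rewrite -subr_eq0 subr0 !mulf_eq0 pnatr_eq0 /= subr_eq0 eqr_nat (negbTE ee') /=.
by rewrite -addrA -opprD -natrD subr_eq0 eqr_nat gtn_eqF.
Qed.

Lemma ffact_pred_natr (m e : nat) :
  (m.+1%:R : R) * (m ^_ e)%:R = (m.+1%:R - e%:R) * (m.+1 ^_ e)%:R.
Proof.
case: e => [|e]; first by rewrite !ffactn0 subr0.
rewrite ffactSS natrM mulrCA; congr (_ * _); rewrite ffactnSr natrM mulrC.
have [em|me] := leqP e m; last by rewrite ffact_small// !mulr0.
by rewrite natrB// -!natr1; congr (_ * _); ring.
Qed.

(** The one-step recursion telescopes to a quotient of falling factorials, kept in product form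
    because these may vanish. *)
Lemma pair_avg_upE e c h k l : harmonic c -> homogeneous e c -> (k <= l)%N -> (l <= n)%N ->
  pair_avg h (feval c) k l * ((n - k) ^_ e)%:R = pair_avg h (feval c) k k * ((n - l) ^_ e)%:R.
Proof.
move=> hc ec; elim: l => [|l IH]; first by rewrite leqn0 => /eqP->.
rewrite leq_eqVlt => /predU1P[->//|]; rewrite ltnS => kl ln.
have nl0 : (n - l)%:R != 0 :> R by rewrite pnatr_eq0 -lt0n subn_gt0.
apply: (mulfI nl0); rewrite mulrA (pair_avg_up h hc ec)// -mulrA (IH kl (ltnW ln)).
rewrite mulrCA [RHS]mulrCA; congr (_ * _).
by rewrite -subSS subSn// ffact_pred_natr.
Qed.

Lemma pair_avg_downE e c h k l : homogeneous e c -> (l <= k)%N -> (k <= n)%N ->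
  pair_avg (feval c) h l k * (k ^_ e)%:R = pair_avg (feval c) h k k * (l ^_ e)%:R.
Proof.
move=> ec; move=> lk kn; have : exists i, l = (k - i)%N /\ (i <= k)%N.
  by exists (k - l)%N; rewrite subKn// leq_subr.
case=> i [->]; elim: i => [|i IH]; first by rewrite subn0.
move=> ik; have [j kj] : exists j, (k - i)%N = j.+1.
  by exists (k - i).-1; rewrite prednK// subn_gt0.
have := IH (ltnW ik); rewrite subnS kj /= => {}IH.
have jk : (j < k)%N by rewrite -kj leq_subr.
apply: (@mulfI _ j.+1%:R); first by rewrite pnatr_eq0.
rewrite mulrA (pair_avg_down h ec)// -mulrA IH mulrCA [RHS]mulrCA; congr (_ * _).
by rewrite ffact_pred_natr.
Qed.

(** The correlation between levels k and l is reached from either end, so the second moment on level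
    l is proportional to l^_e (n-l)^_e. The hypotheses on e keep the factors at level k nonzero. *)
Lemma diag_ratio e c k l : harmonic c -> homogeneous e c ->
  (e <= k)%N -> (e <= n - k)%N -> (k <= n)%N -> (l <= n)%N ->
  pair_avg (feval c) (feval c) l l * (k ^_ e * (n - k) ^_ e)%:R =
  pair_avg (feval c) (feval c) k k * (l ^_ e * (n - l) ^_ e)%:R.
Proof.
move=> hc ec ek enk kn ln.
have a0 : (k ^_ e)%:R != 0 :> R by rewrite pnatr_eq0 -lt0n ffact_gt0.
have b0 : ((n - k) ^_ e)%:R != 0 :> R by rewrite pnatr_eq0 -lt0n ffact_gt0.
rewrite !natrM; have [kl|lk] := leqP k l.
  have c0 : (l ^_ e)%:R != 0 :> R by rewrite pnatr_eq0 -lt0n ffact_gt0 (leq_trans ek).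
  have u := pair_avg_upE (feval c) hc ec kl ln.
  have d := pair_avg_downE (feval c) ec kl ln.
  have -> : pair_avg (feval c) (feval c) l l =
     pair_avg (feval c) (feval c) k l * (l ^_ e)%:R / (k ^_ e)%:R.
    by rewrite d mulfK.
  by rewrite [RHS]mulrCA -u; field.
have c0 : ((n - l) ^_ e)%:R != 0 :> R.
  by rewrite pnatr_eq0 -lt0n ffact_gt0 (leq_trans enk)// leq_sub2l// ltnW.
have u := pair_avg_upE (feval c) hc ec (ltnW lk) kn.
have d := pair_avg_downE (feval c) ec (ltnW lk) kn.
have -> : pair_avg (feval c) (feval c) l l =
   pair_avg (feval c) (feval c) l k * ((n - l) ^_ e)%:R / ((n - k) ^_ e)%:R.
  by rewrite u mulfK.
by rewrite [RHS]mulrA -d; field.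
Qed.

End SliceMoments.

(** * Translation invariance and moments on the cube *)

Section Translation.
Context {R : realType}.

Lemma eq_mlin_coef n (c c' : {set 'I_n} -> R) y : c =1 c' -> mlin c y = mlin c' y.
Proof. by move=> cc; apply: eq_bigr => S _; rewrite cc. Qed.

Lemma is_derive_mlin_line n (c : {set 'I_n} -> R) (y v : 'I_n -> R) (t : R) :
  is_derive t (1 : R) (fun u : R => mlin c (fun i => y i + u * v i))
    (\sum_i v i * mlin (cderiv i c) (fun i => y i + t * v i)).
Proof.
elim: n c y v => [|n IH] c y v.
  rewrite big_ord0 (_ : (fun u => _) = cst (c finset.set0)); first exact: is_derive_cst.
  by apply/funext => u; rewrite mlin0.
pose Y (u : R) i := (y \o lift ord0) i + u * (v \o lift ord0) i.
have E : (fun u : R => mlin c (fun i => y i + u * v i)) =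
    (fun u => mlin (c \o slift false) (Y u)
              + (y ord0 + u * v ord0) * mlin (c \o slift true) (Y u)).
  by apply/funext => u; rewrite mlin_cons.
rewrite E.
have d0 := IH (c \o slift false) (y \o lift ord0) (v \o lift ord0).
have d1 := IH (c \o slift true) (y \o lift ord0) (v \o lift ord0).
rewrite /Y; apply: is_derive_eq; rewrite big_ord_recl.
have -> : mlin (cderiv ord0 c) (fun i => y i + t * v i) = mlin (c \o slift true) (Y t).
  rewrite mlin_cons [X in _ + _ * X](_ : _ = 0) ?mulr0 ?addr0.
    by apply: eq_mlin_coef => T; rewrite /cderiv/= in_slift0 setU1_slift0.
  by apply: big1 => T _; rewrite /cderiv/= in_slift0 mul0r.
have -> : \sum_(i < n) v (lift ord0 i) * mlin (cderiv (lift ord0 i) c) (fun i => y i + t * v i) =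
    \sum_(i < n) v (lift ord0 i) * mlin (cderiv i (c \o slift false)) (Y t)
    + (y ord0 + t * v ord0) * \sum_(i < n) v (lift ord0 i) * mlin (cderiv i (c \o slift true)) (Y t).
  rewrite big_distrr -big_split; apply: eq_bigr => i _ /=.
  rewrite mlin_cons !(eq_mlin_coef _ (cderiv_lift _ _ _)); ring.
rewrite /GRing.scale /=; ring.
Qed.

(** The derivative along (1,...,1) is the sum of the partial derivatives, hence zero, and the mean
    value bound with constant 0 applies. *)
Lemma harmonic_translation n (c : {set 'I_n} -> R) (y : 'I_n -> R) (t : R) :
  harmonic c -> mlin c (fun i => y i - t) = mlin c y.
Proof.
move=> hc; pose f (u : R) := mlin c (fun i => y i + u * - 1).
have df (u : R) : is_derive u (1 : R) f 0.
  apply: is_derive_eq; first exact: is_derive_mlin_line.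
  by rewrite -big_distrr /= harmonic_sum_cderiv// mulr0.
have : `|f (0 + t) - f 0| <= `|t| * 0.
  by apply: (derive_bound_lipschitz df) => x _; rewrite normr0.
rewrite mulr0 normr_le0 subr_eq0 add0r => /eqP ft.
transitivity (f t); first by apply: eq_mlin => i; rewrite mulrN1.
by rewrite ft; apply: eq_mlin => i; rewrite mul0r addr0.
Qed.

Lemma harmonic_ceval n (c : {set 'I_n} -> R) p x : harmonic c -> feval c x = ceval p c x.
Proof. by move=> hc; rewrite /ceval harmonic_translation. Qed.

End Translation.

Section CubeMoments.
Context {R : realType}.
Variable p : R.
Hypothesis p01 : 0 < p <= 1 / 2.
Local Notation s2 := (p * (1 - p)).

Lemma eq_cube_expect n (g h : {ffun 'I_n -> bool} -> R) : g =1 h ->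
  cube_expect p g = cube_expect p h.
Proof. by move=> gh; apply: eq_bigr => x _; rewrite gh. Qed.

Lemma cube_expectD n (g h : {ffun 'I_n -> bool} -> R) :
  cube_expect p (fun x => g x + h x) = cube_expect p g + cube_expect p h.
Proof. by rewrite /cube_expect -big_split; apply: eq_bigr => x _; rewrite mulrDr. Qed.

Lemma cube_expectZ n r (g : {ffun 'I_n -> bool} -> R) :
  cube_expect p (fun x => r * g x) = r * cube_expect p g.
Proof. by rewrite /cube_expect big_distrr; apply: eq_bigr => x _; rewrite mulrCA. Qed.

Lemma cube_expectB n (g h : {ffun 'I_n -> bool} -> R) :
  cube_expect p (fun x => g x - h x) = cube_expect p g - cube_expect p h.
Proof.
rewrite -[X in _ - X]mul1r -mulNr -cube_expectZ -cube_expectD.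
by apply: eq_cube_expect => x; rewrite mulN1r.
Qed.

Lemma cube_expect_cst n r : cube_expect p (fun _ : {ffun 'I_n -> bool} => r) = r.
Proof.
elim: n => [|n IH]; first by rewrite (cube_expect0 _ _ [ffun=> false]).
by rewrite cube_expect_cons /comp IH; ring.
Qed.

Let p_ge0 : 0 <= p. Proof. by case/andP: p01 => /ltW. Qed.
Let q_ge0 : 0 <= 1 - p. Proof. case/andP: p01 => _; lra. Qed.

Lemma le_cube_expect n (g h : {ffun 'I_n -> bool} -> R) : (forall x, g x <= h x) ->
  cube_expect p g <= cube_expect p h.
Proof.
move=> gh; apply: ler_sum => x _; rewrite ler_wpM2l//.
by apply: prodr_ge0 => i _; rewrite /bernoulli_pmf; case: ifP.
Qed.

Lemma normr_cube_expect n (g : {ffun 'I_n -> bool} -> R) :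
  `|cube_expect p g| <= cube_expect p (fun x => `|g x|).
Proof.
rewrite ler_norml; apply/andP; split; last by apply: le_cube_expect => x; exact: ler_norm.
rewrite -[X in - X]mul1r -mulNr -cube_expectZ; apply: le_cube_expect => x.
by rewrite mulN1r lerNl -normrN ler_norm.
Qed.

Lemma ceval_second_moment n (c : {set 'I_n} -> R) :
  cube_expect p (fun x => ceval p c x ^+ 2) = wnorm s2 c.
Proof.
elim: n c => [|n IH] c.
  by rewrite (cube_expect0 _ _ [ffun=> false]) /ceval mlin0 wnorm0.
rewrite cube_expect_cons.
rewrite (eq_cube_expect (h := fun x => ceval p (fun S => (c \o slift false) S + (true%:R - p) * (c \o slift true) S) x ^+ 2)); last first.
  by move=> x /=; rewrite ceval_fcons.
rewrite [X in _ + _ * X](eq_cube_expect (h := fun x => ceval p (fun S => (c \o slift false) S + (false%:R - p) * (c \o slift true) S) x ^+ 2)); last first.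
  by move=> x /=; rewrite ceval_fcons.
by rewrite !IH !wnorm_line wnorm_cons /=; ring.
Qed.

(** The product counts ordered choices of a coordinates that are on and b that are off; each of the
    n^_(a+b) candidates succeeds with probability p^a (1-p)^b. The proof is by induction on n. *)
Lemma cube_expect_ffact n a b :
  cube_expect p (fun x : {ffun 'I_n -> bool} =>
    (weight x ^_ a)%:R * ((n - weight x) ^_ b)%:R) =
  (n ^_ (a + b))%:R * p ^+ a * (1 - p) ^+ b.
Proof.
(* Difference rule for falling factorials; at k = 0 the value of [k.-1] is harmless because of the
   factor k. *)
have rec m k : (m.+1 ^_ k)%:R = (m ^_ k)%:R + k%:R * (m ^_ k.-1)%:R :> R.
  case: k => [|k]; first by rewrite !ffactn0 mul0r addr0.
  rewrite /= ffactSS ffactnSr !natrM; have [km|mk] := leqP k m; last first.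
    by rewrite ffact_small// !(mul0r, mulr0) addr0.
  by rewrite natrB// -!natr1; ring.
elim: n a b => [|n IH] a b.
  rewrite (cube_expect0 _ _ [ffun=> false]) /weight big_ord0 subn0.
  case: a => [|a]; last by rewrite addSn !ffact0n !mul0r.
  by rewrite ffactn0 mul1r mulr1 add0n; case: b => [|b]; rewrite ?ffactn0 ?ffact0n ?mul0r// mulr1.
have w1 x : weight (@fcons n true x) = (weight x).+1.
  rewrite /weight big_ord_recl fcons0 add1n; congr _.+1.
  by apply: eq_bigr => i _; rewrite fconsS.
have w0 x : weight (@fcons n false x) = weight x.
  rewrite /weight big_ord_recl fcons0 add0n.
  by apply: eq_bigr => i _; rewrite fconsS.
rewrite cube_expect_cons.
rewrite (eq_cube_expect (h := fun x : {ffun 'I_n -> bool} =>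
    (weight x ^_ a)%:R * ((n - weight x) ^_ b)%:R
    + a%:R * ((weight x ^_ a.-1)%:R * ((n - weight x) ^_ b)%:R))); last first.
  by move=> x; rewrite /= w1 subSS rec mulrDl mulrA.
rewrite [X in _ + _ * X](eq_cube_expect (h := fun x : {ffun 'I_n -> bool} =>
    (weight x ^_ a)%:R * ((n - weight x) ^_ b)%:R
    + b%:R * ((weight x ^_ a)%:R * ((n - weight x) ^_ b.-1)%:R))); last first.
  by move=> x; rewrite /= w0 subSn ?weight_le// rec mulrDr; congr (_ + _); ring.
rewrite !cube_expectD !cube_expectZ !IH rec.
case: a => [|a] /=; case: b => [|b] /=.
- by rewrite !ffactn0; ring.
- by rewrite !add0n natrM; rewrite -!natr1 !exprS; ring.
- by rewrite !addn0 -!natr1 !exprS; ring.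
- by rewrite !addSn !addnS /= -!natr1 natrD !exprS; ring.
Qed.

End CubeMoments.

(** * Estimates of falling factorials *)

Section FallingFactorial.

Lemma expn_le_ffact_2 m e : (2 * e <= m)%N -> (m ^ e <= 2 ^ e * m ^_ e)%N.
Proof.
elim: e => [//|e IH] em; have {}IH : (m ^ e <= 2 ^ e * m ^_ e)%N by apply: IH; lia.
rewrite expnSr (expnSr 2) ffactnSr -mulnA (mulnCA 2) mulnA leq_mul//.
lia.
Qed.

(** Each of the m factors of (2m)^_m is at least m, and (2m)^_m is m! times a binomial coefficient
    bounded by 4^m. *)
Lemma expn_le_fact m : (m ^ m <= 4 ^ m * m`!)%N.
Proof.
have lo j : (j <= m)%N -> (m ^ j <= (2 * m) ^_ j)%N.
  elim: j => [//|j IH] jm; rewrite expnSr ffactnSr leq_mul ?IH//; lia.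
apply: (leq_trans (lo m (leqnn m))); rewrite -bin_ffact leq_mul2r orbC.
have -> : (4 ^ m = 2 ^ (2 * m))%N by rewrite expnM.
have := expnDn 1 1 (2 * m); rewrite addn1 => ->.
have mm : (m < (2 * m).+1)%N by lia.
by rewrite (bigD1 (Ordinal mm))//= !exp1n !muln1 leq_addr.
Qed.

(** If 2e > m, then m^m <= 4^m m^_e (m-e)!, where (m-e)! <= m^(m-e) and 4^m <= 16^e. This covers
    degrees all the way up to m. *)
Lemma expn_le_ffact_16 m e : (e <= m)%N -> (m ^ e <= 16 ^ e * m ^_ e)%N.
Proof.
move=> em; have [e2|e2] := leqP (2 * e) m.
  apply: (leq_trans (expn_le_ffact_2 e2)); rewrite leq_mul2r orbC.
  by have [->//|e0] := posnP e; rewrite leq_exp2r.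
have f0 : (0 < (m - e)`!)%N by exact: fact_gt0.
have m0 : (0 < m)%N by lia.
have mm0 : (0 < m ^ (m - e))%N by rewrite expn_gt0 m0.
have fe : ((m - e)`! <= m ^ (m - e))%N.
  apply: (@leq_trans ((m - e) ^ (m - e))%N).
    by elim: (m - e)%N => // j IH; rewrite factS expnS leq_mul// (leq_trans IH)//; case: j {IH} => // j; rewrite leq_exp2r.
  by case: (m - e)%N (leq_subr e m) => // j jm; rewrite leq_exp2r.
have main : (m ^ e * m ^ (m - e) <= 16 ^ e * m ^_ e * m ^ (m - e))%N.
  rewrite -expnD subnKC//; apply: (leq_trans (expn_le_fact m)).
  rewrite -(ffact_fact em) mulnA leq_mul// leq_mul2r orbC.
  rewrite (_ : 16 = 4 ^ 2)%N// -expnM leq_exp2l//; lia.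
by move: main; rewrite leq_pmul2r.
Qed.

End FallingFactorial.

Section FallingFactorialReal.
Context {R : realFieldType}.

Lemma leq_double_sqr d : (d <= 2 * d ^ 2)%N.
Proof. by case: d => // m; rewrite expnS; lia. Qed.

(** That is, m^_e >= m^e (1 - e^2/m), cleared of denominators. Where the left side is not positive
    the claim is trivial; elsewhere e <= m and one more factor m - e is absorbed. *)
Lemma ffact_lower_sqr (m e : nat) :
  m%:R ^+ e * (m%:R - e%:R ^+ 2) <= m%:R * (m ^_ e)%:R :> R.
Proof.
elim: e => [|e IH]; first by rewrite expr0n subr0 mul1r ffactn0 mulr1.
have M0 : 0 <= m%:R :> R := ler0n _ _.
have E0 : 0 <= e%:R :> R := ler0n _ _.
have F0 : 0 <= (m ^_ e)%:R :> R := ler0n _ _.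
have P0 : 0 <= m%:R ^+ e :> R by rewrite exprn_ge0.
have [neg|pos] := leP (m%:R - e.+1%:R ^+ 2 : R) 0.
  by rewrite (@le_trans _ _ 0)// ?mulr_ge0// mulr_ge0_le0// exprn_ge0.
have em : (e <= m)%N.
  have : (e.+1%:R : R) ^+ 2 <= m%:R by lra.
  by rewrite -natrX ler_nat; lia.
rewrite ffactnSr natrM natrB// exprSr mulrA.
have em' : e%:R <= m%:R :> R by rewrite ler_nat.
apply: (@le_trans _ _ (m%:R ^+ e * (m%:R - e%:R ^+ 2) * (m%:R - e%:R))); last first.
  by rewrite ler_wpM2r// subr_ge0.
rewrite -!mulrA ler_wpM2l// -natr1; nra.
Qed.

(** A Bernoulli inequality: the quotient (m'-j)/(m-j) is at least 1 - 2(m-m')/m as long as j <=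
    m/2. *)
Lemma ffact_ratio_lower (m m' e : nat) : (m' <= m)%N -> (2 * e <= m)%N ->
  (m ^_ e)%:R * (m%:R - 2 * e%:R * (m - m')%:R) <= m%:R * (m' ^_ e)%:R :> R.
Proof.
move=> mm; elim: e => [|e IH] em; first by rewrite !ffactn0 mulr0 mul0r subr0 mulrC.
have {}IH := IH (leq_trans (leq_mul (leqnn 2) (leqnSn e)) em).
have M0 : 0 <= m%:R :> R := ler0n _ _.
have [neg|pos] := leP (m%:R - 2 * e.+1%:R * (m - m')%:R : R) 0.
  by rewrite (@le_trans _ _ 0)// ?mulr_ge0// mulr_ge0_le0.
have mm' : m'%:R <= m%:R :> R by rewrite ler_nat.
have em2 : 2 * (e%:R + 1) <= m%:R :> R by rewrite natr1 -natrM ler_nat.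
have em' : (e <= m')%N.
  rewrite leqNgt; apply/negP => lt; move: pos; rewrite natrB//.
  have : m'%:R + 1 <= e%:R :> R by rewrite natr1 ler_nat.
  have : 0 <= m'%:R :> R by rewrite ler0n.
  rewrite -natr1; nra.
rewrite !ffactnSr !natrM !natrB//; last by lia.
have me : e%:R <= m'%:R :> R by rewrite ler_nat.
have E0 : 0 <= e%:R :> R := ler0n _ _.
have F0 : 0 <= (m ^_ e)%:R :> R := ler0n _ _.
rewrite natrB// in IH.
apply: (@le_trans _ _ ((m ^_ e)%:R * (m%:R - 2 * e%:R * (m%:R - m'%:R)) * (m'%:R - e%:R))).
  have D0 : 0 <= (m%:R - m'%:R) * (m%:R - 2 * e%:R + 2 * e%:R * (m%:R - m'%:R)) :> R.
    by rewrite mulr_ge0 ?subr_ge0// addr_ge0 ?mulr_ge0 ?subr_ge0//; lra.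
  by rewrite -!mulrA ler_wpM2l// -natr1; lra.
by rewrite mulrA ler_wpM2r// subr_ge0.
Qed.

End FallingFactorialReal.

(** * Homogeneous parts and the comparison of L2 norms *)

Section Decomposition.
Context {R : realType} {n : nat}.
Implicit Types (c : {set 'I_n} -> R).

Definition degree_le d c := forall S : {set 'I_n}, (d < #|S|)%N -> c S = 0.
Definition hpart (e : nat) c : {set 'I_n} -> R := fun S => if #|S| == e then c S else 0.

Lemma homogeneous_hpart e c : homogeneous e (hpart e c).
Proof. by move=> S /negbTE Se; rewrite /hpart Se. Qed.

Lemma harmonic_hpart e c : harmonic c -> harmonic (hpart e c).
Proof.
move=> hc T; rewrite /hpart.
rewrite (eq_bigr (fun i => if (#|T|.+1 == e)%N then c (i |: T)%SET else 0)); last first.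
  by move=> i iT; rewrite cardsU1 iT.
by case: eqP => _; [exact: hc|rewrite big1].
Qed.

Lemma sum_hpart d c (V : nmodType) (F : {set 'I_n} -> V) :
  (forall S : {set 'I_n}, (d < #|S|)%N -> F S = 0) ->
  \sum_S F S = \sum_(e < d.+1) \sum_(S : {set 'I_n} | #|S| == e) F S.
Proof.
move=> Fd; rewrite (exchange_big_dep xpredT)//=; apply: eq_bigr => S _.
have [Sd|Sd] := ltnP d #|S|; first by rewrite Fd// big1.
by rewrite (big_pred1 (Ordinal (Sd : #|S| < d.+1)%N)).
Qed.

Lemma feval_hpart d c x : degree_le d c -> feval c x = \sum_(e < d.+1) feval (hpart e c) x.
Proof.
move=> dc; rewrite /feval /mlin (@sum_hpart d c); last first.
  by move=> S /dc ->; rewrite mul0r.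
apply: eq_bigr => e _; rewrite big_mkcond; apply: eq_bigr => S _.
by rewrite /hpart; case: eqP => // _; rewrite mul0r.
Qed.

Lemma wnorm_hpart g d c : degree_le d c -> wnorm g c = \sum_(e < d.+1) wnorm g (hpart e c).
Proof.
move=> dc; rewrite /wnorm (@sum_hpart d c); last first.
  by move=> S /dc ->; rewrite expr0n mulr0.
apply: eq_bigr => e _; rewrite big_mkcond; apply: eq_bigr => S _.
by rewrite /hpart; case: eqP => // _; rewrite expr0n mulr0.
Qed.

Lemma order_avg_sum (I : Type) (r : seq I) (g : I -> {ffun 'I_n -> bool} -> R) k :
  order_avg (fun x => \sum_(i <- r) g i x) k = \sum_(i <- r) order_avg (g i) k.
Proof. by rewrite /order_avg exchange_big mulr_suml. Qed.

Lemma slice_parseval d c k : harmonic c -> degree_le d c -> (2 * d <= n)%N -> (k < n)%N ->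
  order_avg (fun x => feval c x ^+ 2) k =
  \sum_(e < d.+1) pair_avg (feval (hpart e c)) (feval (hpart e c)) k k.
Proof.
move=> hc dc dn kn.
transitivity (order_avg (fun x => \sum_(e < d.+1) \sum_(e' < d.+1)
    feval (hpart e c) x * feval (hpart e' c) x) k).
  congr (_ / _); apply: eq_bigr => s _.
  by rewrite expr2 {1 2}(feval_hpart _ dc) big_distrl; apply: eq_bigr => e _; rewrite big_distrr.
rewrite order_avg_sum; apply: eq_bigr => e _.
rewrite order_avg_sum (bigD1 e)//= [X in _ + X]big1 ?addr0// => e' e'e.
rewrite -pair_avg_diag; apply: (@homogeneous_orthogonal _ _ e e') => //.
- exact: harmonic_hpart.
- exact: harmonic_hpart.
- exact: homogeneous_hpart.
- exact: homogeneous_hpart.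
- by rewrite eq_sym; apply: contraNneq e'e => ee; exact/eqP/val_inj.
- have := ltn_ord e; have := ltn_ord e'; lia.
Qed.

End Decomposition.

Section NormComparison.
Context {R : realType} {n : nat}.
Implicit Types (c : {set 'I_n} -> R).
Variables (p : R) (k : nat).
Hypothesis p01 : 0 < p <= 1 / 2.
Hypothesis pn : p * n%:R = k%:R.
Local Notation s2 := (p * (1 - p)).

Let p_gt0 : 0 < p. Proof. by case/andP: p01. Qed.
Let p_le : p <= 1 / 2. Proof. by case/andP: p01. Qed.

Lemma qn : (1 - p) * n%:R = (n - k)%:R.
Proof.
have kn : (k <= n)%N.
  rewrite -(ler_nat R) -pn; have := ler0n R n; have := p_gt0; have := p_le; nra.
by rewrite natrB// -pn; ring.
Qed.

Lemma k_le_n : (k <= n - k)%N.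
Proof. by rewrite -(ler_nat R) -qn -pn; have := ler0n R n; have := p_gt0; have := p_le; nra. Qed.

Let kn : (k <= n)%N. Proof. have := k_le_n; lia. Qed.

Lemma cube_diag_avg e c : harmonic c -> homogeneous e c ->
  cube_expect p (fun x : {ffun 'I_n -> bool} => pair_avg (feval c) (feval c) (weight x) (weight x)) = wnorm s2 c.
Proof.
move=> hc ec; rewrite -(ceval_second_moment p).
rewrite [RHS]cube_expect_order_avg; apply: eq_cube_expect => x.
rewrite pair_avg_diag; congr (_ / _); apply: eq_bigr => s _.
by rewrite -harmonic_ceval.
Qed.

(** The proportionality of [diag_ratio] is averaged over the weight of a random point of the cube:
    one side becomes the cube norm, the other a mixed factorial moment. *)
Lemma wnorm_diag e c : harmonic c -> homogeneous e c -> (e <= k)%N ->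
  wnorm s2 c * (k ^_ e * (n - k) ^_ e)%:R =
  pair_avg (feval c) (feval c) k k * ((n ^_ (e + e))%:R * p ^+ e * (1 - p) ^+ e).
Proof.
move=> hc ec ek; rewrite -(cube_diag_avg hc ec) mulrC -cube_expectZ -cube_expect_ffact//.
rewrite -cube_expectZ; apply: eq_cube_expect => x.
rewrite mulrC (diag_ratio hc ec)//; last exact: weight_le.
  by rewrite natrM.
exact: leq_trans k_le_n.
Qed.

Lemma pair_avg_sqr_ge0 (h : {ffun 'I_n -> bool} -> R) l : 0 <= pair_avg h h l l.
Proof. by rewrite divr_ge0// sumr_ge0// => s _; rewrite -expr2 sqr_ge0. Qed.

(** Bounding n^_(2e) by n^(2e) turns the factor into k^e (n-k)^e. The quotient [rho] is a parameter
    because two estimates of it are used: a crude one valid for all e <= k, and one close to 1 when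
    e^2 is small against k. *)
Lemma wnorm_diag_le (e : nat) c (rho : R) : harmonic c -> homogeneous e c -> (e <= k)%N ->
  k%:R ^+ e * (n - k)%:R ^+ e <= rho * (k ^_ e * (n - k) ^_ e)%:R ->
  wnorm s2 c <= rho * pair_avg (feval c) (feval c) k k.
Proof.
move=> hc ec ek rhoP.
have B0 : 0 < (k ^_ e * (n - k) ^_ e)%:R :> R.
  by rewrite ltr0n muln_gt0 !ffact_gt0 ek (leq_trans ek)// k_le_n.
rewrite -(ler_pM2r B0) (wnorm_diag hc ec ek) (mulrC rho) -[leRHS]mulrA.
rewrite ler_wpM2l ?pair_avg_sqr_ge0//; apply: le_trans rhoP.
rewrite -pn -qn !exprMn [leRHS](_ : _ = n%:R ^+ (e + e) * p ^+ e * (1 - p) ^+ e); last first.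
  by rewrite exprD; ring.
have q0 : 0 <= 1 - p by have := p_le; lra.
rewrite ler_wpM2r ?exprn_ge0// ler_wpM2r ?exprn_ge0 ?(ltW p_gt0)//.
rewrite -natrX ler_nat; elim: (e + e)%N => // j IH.
by rewrite ffactnSr expnSr leq_mul// leq_subr.
Qed.

Lemma norm_comparison d c (rho : R) : harmonic c -> degree_le d c -> (d <= k)%N -> (k < n)%N ->
  (forall e, (e <= d)%N ->
    k%:R ^+ e * (n - k)%:R ^+ e <= rho * (k ^_ e * (n - k) ^_ e)%:R) ->
  wnorm s2 c <= rho * order_avg (fun x => feval c x ^+ 2) k.
Proof.
move=> hc dc dk kltn rhoP.
have dn : (2 * d <= n)%N by have := k_le_n; lia.
rewrite (wnorm_hpart _ dc) (slice_parseval hc dc)// big_distrr; apply: ler_sum => e _ /=.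
apply: (@wnorm_diag_le e).
- exact: harmonic_hpart.
- exact: homogeneous_hpart.
- by rewrite (leq_trans _ dk)// -ltnS.
- by apply: rhoP; rewrite -ltnS.
Qed.

Lemma ratio_256 e : (e <= k)%N ->
  k%:R ^+ e * (n - k)%:R ^+ e <= 256 ^+ e * (k ^_ e * (n - k) ^_ e)%:R :> R.
Proof.
move=> ek; rewrite -!natrX -!natrM ler_nat.
have h1 := expn_le_ffact_16 ek.
have h2 := expn_le_ffact_16 (leq_trans ek k_le_n).
apply: (leq_trans (leq_mul h1 h2)).
by rewrite (_ : 256 = 16 * 16)%N// expnMn mulnACA.
Qed.

Lemma ratio_sqr e : (0 < k)%N -> (2 * e ^ 2 <= k)%N ->
  k%:R ^+ e * (n - k)%:R ^+ e <=
  (1 + 6 * e%:R ^+ 2 / k%:R) * (k ^_ e * (n - k) ^_ e)%:R :> R.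
Proof.
move=> k0 ek.
have K0 : 0 < k%:R :> R by rewrite ltr0n.
have h1 := @ffact_lower_sqr R k e.
have h2 := @ffact_lower_sqr R (n - k) e.
have knk : k%:R <= (n - k)%:R :> R by rewrite ler_nat k_le_n.
have e2 : 2 * e%:R ^+ 2 <= k%:R :> R by rewrite -natrX -natrM ler_nat.
rewrite natrM.
set m := (n - k)%:R : R in h2 knk *.
set t := e%:R ^+ 2 / k%:R : R.
have t0 : 0 <= t by rewrite divr_ge0// ?sqr_ge0.
have t1 : t <= 1 / 2 by rewrite ler_pdivrMr//; lra.
have m0 : 0 < m by lra.
have {}h1 : k%:R ^+ e * (1 - t) <= (k ^_ e)%:R.
  rewrite -(ler_pM2l K0); apply: le_trans h1.
  by rewrite mulrCA mulrBr mulr1 /t (mulrCA k%:R) divff ?mulr1// gt_eqF.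
have {}h2 : m ^+ e * (1 - t) <= ((n - k) ^_ e)%:R.
  rewrite -(ler_pM2l m0); apply: le_trans h2.
  rewrite mulrCA ler_wpM2l ?exprn_ge0 ?(ltW m0)// mulrBr mulr1 lerD2l lerN2.
  rewrite /t mulrCA ler_peMr ?sqr_ge0// ler_pdivlMr// mul1r//.
have -> : 6 * e%:R ^+ 2 / k%:R = 6 * t by rewrite /t [RHS]mulrA.
have P0 : 0 <= k%:R ^+ e :> R by rewrite exprn_ge0.
have Q0 : 0 <= m ^+ e by rewrite exprn_ge0// ltW.
have h12 : k%:R ^+ e * (1 - t) * (m ^+ e * (1 - t)) <= (k ^_ e)%:R * ((n - k) ^_ e)%:R.
  by apply: ler_pM => //; rewrite mulr_ge0//; lra.
(* The difference of the two sides factors as t (1 - 2t)(4 - 3t), which is nonnegative for t <=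
   1/2. *)
have t6 : 1 <= (1 + 6 * t) * (1 - t) ^+ 2.
  have : 0 <= t * ((1 - 2 * t) * (4 - 3 * t)) by rewrite mulr_ge0// mulr_ge0//; lra.
  lra.
have PQ : 0 <= k%:R ^+ e * m ^+ e by rewrite mulr_ge0.
apply: (@le_trans _ _ ((1 + 6 * t) * (k%:R ^+ e * (1 - t) * (m ^+ e * (1 - t))))).
  rewrite (_ : (1 + 6 * t) * _ = k%:R ^+ e * m ^+ e * ((1 + 6 * t) * (1 - t) ^+ 2)); last by ring.
  by rewrite ler_peMr.
by rewrite ler_wpM2l// addr_ge0// mulr_ge0.
Qed.

End NormComparison.

(** * Comparison of a slice with the biased cube *)

Section SliceVersusCube.
Context {R : realType} {n : nat}.
Implicit Types (c : {set 'I_n} -> R).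
Local Notation cube := {ffun 'I_n -> bool}.
Variables (p : R) (k : nat).
Hypothesis p01 : 0 < p <= 1 / 2.
Hypothesis pn : p * n%:R = k%:R.
Hypothesis k_gt0 : (0 < k)%N.
Local Notation s2 := (p * (1 - p)).

Let k_le := k_le_n p01 pn.
Let kn : (k < n)%N. Proof. have := k_le; have := k_gt0; lia. Qed.
Let K0 : 0 < k%:R :> R. Proof. by rewrite ltr0n. Qed.

Definition sq_diff_avg (h : cube -> R) (l : nat) : R :=
  (\sum_s (h (prefix_point k s) - h (prefix_point l s)) ^+ 2) / n`!%:R.

Lemma sq_diff_avgE h l :
  sq_diff_avg h l = pair_avg h h k k + pair_avg h h l l - 2 * pair_avg h h k l.
Proof.
rewrite /sq_diff_avg /pair_avg /order_sum mulrA -mulrDl -mulrBl; congr (_ / _).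
by rewrite big_distrr -big_split -sumrB; apply: eq_bigr => s _ /=; ring.
Qed.

(** Moving up consumes factors from n-k and moving down from k. Both pools have at least k elements,
    so the loss per step is controlled by 2e/k in either direction. *)
Lemma pair_avg_lower e c l : harmonic c -> homogeneous e c -> (2 * e <= k)%N -> (l <= n)%N ->
  pair_avg (feval c) (feval c) k k * (1 - 2 * e%:R * `|k%:R - l%:R| / k%:R)
  <= pair_avg (feval c) (feval c) k l.
Proof.
move=> hc ec ek ln; set a := pair_avg _ _ k k.
have a0 : 0 <= a by exact: pair_avg_sqr_ge0.
set t := 2 * _ * _ / _.
have t0 : 0 <= t by rewrite divr_ge0 ?(ltW K0)// mulr_ge0// mulr_ge0.
have tE : 2 * e%:R * `|k%:R - l%:R| = k%:R * t by rewrite [RHS]mulrC /t divfK// gt_eqF.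
have key (m F G M : R) : 0 < F -> 0 < m -> M * F = a * G -> k%:R <= m ->
    F * (m - 2 * e%:R * `|k%:R - l%:R|) <= m * G -> a * (1 - t) <= M.
  move=> F0 m0 E km h; rewrite tE in h; rewrite -(ler_pM2r F0) E.
  rewrite -mulrA ler_wpM2l// -(ler_pM2l m0); apply: le_trans h.
  rewrite (_ : m * ((1 - t) * F) = F * (m - m * t)); last by ring.
  by rewrite ler_wpM2l ?(ltW F0)// lerD2l lerN2 ler_wpM2r.
have [kl|lk] := leqP k l.
  have ek' : (2 * e <= n - k)%N by have := k_le; lia.
  have h := @ffact_ratio_lower R _ _ _ (leq_sub2l n kl) ek'.
  apply: (key (n - k)%:R _ _ _ _ _ (pair_avg_upE (feval c) hc ec kl ln)).
  - by rewrite ltr0n ffact_gt0; have := k_le; lia.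
  - by rewrite ltr0n subn_gt0.
  - by rewrite ler_nat k_le.
  - move: h; rewrite (_ : (n - k - (n - l) = l - k)%N); last by lia.
    have -> : `|k%:R - l%:R| = (l - k)%:R :> R.
      by rewrite natrB// ler0_norm ?opprB// subr_le0 ler_nat.
    exact.
have h := @ffact_ratio_lower R _ _ _ (ltnW lk) ek.
rewrite pair_avgC; apply: (key k%:R _ _ _ _ _ (pair_avg_downE (feval c) ec (ltnW lk) (ltnW kn))) => //.
- by rewrite ltr0n ffact_gt0; lia.
- move: h; have -> : `|k%:R - l%:R| = (k - l)%:R :> R.
    by rewrite natrB ?(ltnW lk)// ger0_norm// subr_ge0 ler_nat ltnW.
  exact.
Qed.

Lemma ffact2_natr m : (m ^_ 2)%:R = m%:R * (m%:R - 1) :> R.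
Proof.
case: m => [|m]; first by rewrite ffact0n mul0r.
by rewrite ffactSS ffactn1 natrM -natr1; ring.
Qed.

(** The factorial moments give variance p(1-p)n. With r = sqrt n, |u| <= r/2 + u^2/(2r) then takes
    the place of Cauchy-Schwarz. *)
Lemma weight_deviation :
  cube_expect p (fun x : cube => `|k%:R - (weight x)%:R|) <= Num.sqrt n%:R.
Proof.
have n0 : 0 < n%:R :> R by rewrite ltr0n; have := kn; lia.
set r := Num.sqrt n%:R; have r0 : 0 < r by rewrite sqrtr_gt0.
have rr : r ^+ 2 = n%:R by rewrite sqr_sqrtr// ltW.
have var : cube_expect p (fun x : cube => (k%:R - (weight x)%:R) ^+ 2) = s2 * n%:R.
  rewrite (@eq_cube_expect _ _ _ _ ( fun x : cube => k%:R ^+ 2 +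
     ((1 - 2 * k%:R) * ((weight x ^_ 1)%:R * ((n - weight x) ^_ 0)%:R) +
      (weight x ^_ 2)%:R * ((n - weight x) ^_ 0)%:R))); last first.
    move=> x; rewrite ffactn0 ffactn1 !mulr1.
    by rewrite ffact2_natr; ring.
  have E1 := @cube_expect_ffact R p n 1 0; have E2 := @cube_expect_ffact R p n 2 0.
  rewrite cube_expectD cube_expectD cube_expect_cst E2.
  have -> : forall r0 : R, cube_expect p (fun x : cube => r0 * ((weight x ^_ 1)%:R * ((n - weight x) ^_ 0)%:R)) = r0 * (n%:R * p).
    by move=> r1; rewrite cube_expectZ E1 addn0 ffactn1 expr1 expr0 mulr1.
  rewrite addn0 expr0 mulr1.
  by rewrite ffact2_natr -pn; ring.
apply: (@le_trans _ _ (cube_expect p (fun x : cube =>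
    r / 2 + (2 * r)^-1 * (k%:R - (weight x)%:R) ^+ 2))).
  apply: le_cube_expect => // x; set u := _ - _.
  have -> : u ^+ 2 = `|u| ^+ 2 by rewrite real_normK ?num_real.
  move: `|u| => v; rewrite -subr_ge0.
  have -> : r / 2 + (2 * r)^-1 * v ^+ 2 - v = (r - v) ^+ 2 / (2 * r) by field; rewrite gt_eqF.
  by rewrite divr_ge0 ?sqr_ge0// mulr_ge0// ltW.
rewrite cube_expectD cube_expect_cst cube_expectZ var -rr.
have -> : r / 2 + (2 * r)^-1 * (s2 * r ^+ 2) = r * ((1 + s2) / 2) by field; rewrite gt_eqF.
rewrite ler_piMr ?(ltW r0)//.
by have [pp pp'] := andP p01; nra.
Qed.

(** Averaged over the random weight W, the second moment at level W becomes the cube norm, exceeding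
    the slice norm by a factor at most 1 + 6e^2/k. The cross term loses 4e E|k-W|/k relative to the
    slice norm. *)
Lemma sq_diff_expect_le e c : harmonic c -> homogeneous e c -> (2 * e ^ 2 <= k)%N ->
  cube_expect p (fun x : cube => sq_diff_avg (feval c) (weight x)) <=
  (6 * e%:R ^+ 2 / k%:R + 4 * e%:R * Num.sqrt n%:R / k%:R) *
  pair_avg (feval c) (feval c) k k.
Proof.
move=> hc ec ek; have ek1 : (2 * e <= k)%N.
  by apply: leq_trans ek; rewrite leq_mul2l /=; case: (e) => // m; rewrite expnS leq_pmulr.
have eek : (e <= k)%N by lia.
set a := pair_avg _ _ k k.
have a0 : 0 <= a by exact: pair_avg_sqr_ge0.
apply: (@le_trans _ _ (cube_expect p (fun x : cube =>
    pair_avg (feval c) (feval c) (weight x) (weight x) +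
    (- a + (4 * e%:R * a / k%:R) * `|k%:R - (weight x)%:R|)))).
  apply: le_cube_expect => // x; rewrite sq_diff_avgE -/a.
  have := pair_avg_lower hc ec ek1 (weight_le x); rewrite -/a.
  set M := pair_avg _ _ k _; set D := `|_|; move=> h.
  have -> : 4 * e%:R * a / k%:R * D = 2 * (a * (2 * e%:R * D / k%:R)) by ring.
  rewrite mulrBr mulr1 in h; lra.
rewrite cube_expectD (cube_diag_avg p _ ec)// cube_expectD cube_expect_cst cube_expectZ.
have := wnorm_diag_le p01 pn hc ec eek (ratio_sqr p01 pn k_gt0 ek); rewrite -/a => w.
have dev := weight_deviation.
have c0 : 0 <= 4 * e%:R * a / k%:R by rewrite divr_ge0 ?(ltW K0)// mulr_ge0// mulr_ge0.
have := ler_wpM2l c0 dev.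
have -> : 4 * e%:R * a / k%:R * Num.sqrt n%:R = 4 * e%:R * Num.sqrt n%:R / k%:R * a by ring.
lra.
Qed.

(** In the coupling, the increment of each homogeneous part is bounded by v <= theta + v^2/theta, so
    that only second moments remain; these are summed by orthogonality on the slice. It is applied
    to the nonconstant part, where the second moment is the variance. *)
Lemma slice_vs_cube_mean0 d c (psi : R -> R) (C theta : R) :
  harmonic c -> degree_le d c -> (2 * d ^ 2 <= k)%N ->
  order_avg (fun x => feval c x ^+ 2) k <= 1 -> 0 < theta -> 0 <= C ->
  (forall x y, `|psi x - psi y| <= C * `|x - y|) ->
  `|order_avg (psi \o feval c) k - cube_expect p (psi \o feval c)| <=
  C * (d.+1%:R * theta + (6 * d%:R ^+ 2 / k%:R + 4 * d%:R * Num.sqrt n%:R / k%:R) / theta).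
Proof.
move=> hc dc dk a1 t0 C0 lip.
pose fe e := feval (hpart e c).
have nf : 0 < n`!%:R :> R by rewrite ltr0n fact_gt0.
rewrite cube_expect_order_avg.
rewrite -[X in `|X - _|](cube_expect_cst p n) -cube_expectB.
apply: (le_trans (normr_cube_expect p01 _)).
apply: (@le_trans _ _ (cube_expect p (fun x : cube =>
   C * \sum_(e < d.+1) (theta + theta^-1 * sq_diff_avg (fe e) (weight x))))).
  apply: le_cube_expect => // x; set l := weight x.
  rewrite /order_avg -mulrBl -sumrB normrM [`|_^-1|]gtr0_norm ?invr_gt0//.
  rewrite ler_pdivrMr//; apply: (le_trans (ler_norm_sum _ _ _)).
  rewrite -mulrA mulr_suml.
  have -> : C * \sum_(e < d.+1) (theta + theta^-1 * sq_diff_avg (fe e) l) * n`!%:R =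
     \sum_s C * \sum_(e < d.+1) (theta + theta^-1 * (fe e (prefix_point k s) - fe e (prefix_point l s)) ^+ 2).
    rewrite -big_distrr; congr (_ * _); rewrite [RHS]exchange_big; apply: eq_bigr => e _ /=.
    rewrite big_split sumr_const /= (_ : #|_| = n`!); last by rewrite -card_Sn; apply: eq_card.
    rewrite mulrDl mulr_natr -big_distrr /= -mulrA; congr (_ + _ * _).
    by rewrite /sq_diff_avg divfK// gt_eqF.
  apply: ler_sum => s _; apply: (le_trans (lip _ _)); rewrite ler_wpM2l//.
  rewrite !(feval_hpart _ dc) -sumrB; apply: (le_trans (ler_norm_sum _ _ _)).
  apply: ler_sum => e _; rewrite -/(fe e); set u := _ - _.
  have -> : u ^+ 2 = `|u| ^+ 2 by rewrite real_normK ?num_real.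
  have := normr_ge0 u; move: `|u| => v v0; rewrite -subr_ge0.
  have -> : theta + theta^-1 * v ^+ 2 - v = ((theta - v / 2) ^+ 2 + 3 / 4 * v ^+ 2) / theta.
    by field; rewrite gt_eqF.
  by rewrite divr_ge0 ?(ltW t0)// addr_ge0 ?sqr_ge0// mulr_ge0// sqr_ge0.
rewrite cube_expectZ ler_wpM2l//.
rewrite (@eq_cube_expect _ _ _ _ ( fun x : cube => d.+1%:R * theta +
    theta^-1 * \sum_(e < d.+1) sq_diff_avg (fe e) (weight x))); last first.
  by move=> x; rewrite big_split sumr_const card_ord /= mulr_natl big_distrr.
rewrite cube_expectD cube_expect_cst cube_expectZ lerD2l mulrC ler_wpM2r ?invr_ge0 ?(ltW t0)//.
have -> : cube_expect p (fun x : cube => \sum_(e < d.+1) sq_diff_avg (fe e) (weight x)) =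
    \sum_(e < d.+1) cube_expect p (fun x : cube => sq_diff_avg (fe e) (weight x)).
  by rewrite /cube_expect exchange_big; apply: eq_bigr => x _; rewrite big_distrr.
set rho := 6 * _ / _ + _.
have rho0 : 0 <= rho.
  by rewrite addr_ge0// divr_ge0 ?(ltW K0)// ?mulr_ge0 ?sqr_ge0 ?sqrtr_ge0.
apply: (@le_trans _ _ (\sum_(e < d.+1) rho * pair_avg (fe e) (fe e) k k)).
  apply: ler_sum => e _; have ed : (e <= d)%N by rewrite -ltnS.
  have ek : (2 * e ^ 2 <= k)%N by apply: leq_trans dk; rewrite leq_mul2l leq_sqr.
  have := sq_diff_expect_le (harmonic_hpart e hc) (@homogeneous_hpart _ _ _ _) ek.
  move=> h; apply: le_trans h _.
  rewrite ler_wpM2r ?pair_avg_sqr_ge0// /rho.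
  have edr : e%:R <= d%:R :> R by rewrite ler_nat.
  by rewrite lerD// ler_wpM2r ?invr_ge0 ?(ltW K0)// ?ler_wpM2r ?sqrtr_ge0// ler_wpM2l// lerXn2r ?nnegrE.
rewrite -big_distrr /= -[leRHS]mulr1 ler_wpM2l//.
have dd : (d <= k)%N.
  exact: leq_trans (leq_double_sqr d) dk.
rewrite -(slice_parseval hc dc)//.
have := k_le; have : (2 * d <= k)%N.
  by apply: leq_trans dk; rewrite leq_mul2l /=; case: (d) => // m; rewrite expnS leq_pmulr.
lia.
Qed.

End SliceVersusCube.

(** * From polynomials to coefficient functions, and removal of the mean *)

Section Coefficients.
Context {R : realType} {n : nat}.
Implicit Types (f : mpoly n R).

Definition mcoef f (S : {set 'I_n}) : R := mcoeff (mesym1 S) f.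

(** The coefficient of the second derivative at m - 2 e_i is m_i (m_i - 1) times the coefficient at
    m. *)
Lemma mcoeff_multilinear f (m : multinom n) i : mpoly_multilinear f -> (1 < m i)%N -> mcoeff m f = 0.
Proof.
move=> mf mi; have := mf i; move/(congr1 (mcoeff (mnm_sub m (mnm_add (mnm1 i) (mnm1 i))))).
rewrite mcoeff_deriv mcoeff_deriv raddf0.
set m1 := mnm_add (mnm_add _ _) _.
have -> : m1 = m.
  apply/mnmP => j; rewrite /m1 !(mnmDE, mnmBE, mnm1E); case: eqP => [<-|_] /=; last by rewrite subn0 !addn0.
  by rewrite -addnA subnK.
by rewrite -mulrnA => /eqP; rewrite mulrn_eq0 /= => /eqP.
Qed.

Lemma multilinearE f : mpoly_multilinear f ->
  f = \sum_S mcoef f S *: mpolyX R (mesym1 S).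
Proof.
move=> mf; apply/mpolyP => m; rewrite raddf_sum /=.
have [/existsP[i mi]|] := boolP [exists i, (1 < m i)%N].
  rewrite (mcoeff_multilinear mf mi) big1// => S _; rewrite mcoeffZ mcoeffX.
  by case: eqP => [mE|_]; rewrite ?mulr0//; move: mi; rewrite -mE mnmE; case: (i \in S).
rewrite negb_exists => /forallP m1.
have mE : m = mesym1 [set i | (0 < m i)%N]%SET.
  apply/mnmP => i; rewrite mnmE inE; have := m1 i; case: (m i) => [//|[//|]].
  by move=> ?.
rewrite {1}mE -/(mcoef f _) (bigD1 [set i | (0 < m i)%N]%SET)//= mcoeffZ mcoeffX -mE eqxx mulr1.
rewrite big1 ?addr0// => S SE; rewrite mcoeffZ mcoeffX [X in (_ == X)]mE (inj_eq (@inj_mesym1 n)) (negbTE SE).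
by rewrite mulr0.
Qed.

Lemma mevalX_mesym1 (v : 'I_n -> R) (S : {set 'I_n}) :
  meval v (mpolyX R (mesym1 S)) = \prod_(i in S) v i.
Proof.
rewrite mevalX [RHS]big_mkcond; apply: eq_bigr => i _; rewrite mnmE.
by case: (i \in S); rewrite ?expr1 ?expr0.
Qed.

Lemma meval_mlin f v : mpoly_multilinear f -> meval v f = mlin (mcoef f) v.
Proof.
move=> mf; rewrite {1}(multilinearE mf) raddf_sum; apply: eq_bigr => S _ /=.
by rewrite mevalZ mevalX_mesym1.
Qed.

Lemma meval_mderiv f i v : mpoly_multilinear f ->
  meval v (mderiv i f) = mlin (cderiv i (mcoef f)) v.
Proof.
move=> mf; rewrite {1}(multilinearE mf) (linear_sum (mderiv i)) raddf_sum mlin_cderivE [RHS]big_mkcond.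
apply: eq_bigr => S _ /=; rewrite mderivZ mderivX !mevalZ mnmE.
case: ifP => iS; last by rewrite mul0r mulr0.
rewrite mul1r -mevalX_mesym1; congr (_ * meval v (mpolyX R _)).
apply/mnmP => j; rewrite mnmBE mnm1E !mnmE in_setD1 eq_sym.
by case: eqP => [->|_]; rewrite ?iS ?subn0.
Qed.

Lemma harmonic_mcoef f : mpoly_multilinear f -> mpoly_harmonic f -> harmonic (mcoef f).
Proof.
move=> mf hf T; have /(congr1 (mcoeff (mesym1 T))) := hf.
rewrite raddf_sum raddf0 => E; rewrite -[RHS]E big_mkcond; apply: eq_bigr => i _.
rewrite /= mcoeff_deriv mnmE; case: ifP => iT.
  rewrite (negbTE iT) mulr1n /mcoef; congr (mcoeff _ f); apply/mnmP => j.
  rewrite mnmDE mnm1E !mnmE in_setU1 eq_sym.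
  by case: eqP => [<-|_]; rewrite ?(negbTE iT)// ?addn0.
rewrite (@mcoeff_multilinear _ _ i) ?mul0rn//.
by move/negbFE: iT => iT; rewrite mnmDE mnm1E mnmE iT eqxx.
Qed.

Lemma degree_le_mcoef f : degree_le (mdegree f) (mcoef f).
Proof.
move=> S; rewrite /mdegree => dS; apply: memN_msupp_eq0; apply/negP => Sf.
have := mmeasure_mnm_lt mdeg Sf; rewrite /= mdeg_mesym1; lia.
Qed.

Lemma cube_evalE f x : mpoly_multilinear f -> cube_eval f x = feval (mcoef f) x.
Proof. exact: meval_mlin. Qed.

Lemma tuple_evalE f p (t : n.-tuple R) : mpoly_multilinear f -> mpoly_harmonic f ->
  tuple_eval f t = mlin (mcoef f) (fun i => tnth t i - p).
Proof.
move=> mf hf; rewrite harmonic_translation; last exact: harmonic_mcoef.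
exact: meval_mlin.
Qed.

Lemma harmonic_cderiv (c : {set 'I_n} -> R) i : harmonic c -> harmonic (cderiv i c).
Proof.
move=> hc T; rewrite /cderiv; have [iT|iT] := boolP (i \in T).
  by rewrite big1// => j _; rewrite in_setU1 iT orbT.
rewrite -[RHS](hc (i |: T)%SET) big_mkcond [RHS]big_mkcond; apply: eq_bigr => j _.
rewrite !in_setU1 (negbTE iT) orbF negb_or eq_sym andbC.
by case: eqP => //= _; case: (j \in T) => //=; rewrite finset.setUCA.
Qed.

Lemma cube_infE f i p : mpoly_multilinear f -> mpoly_harmonic f ->
  cube_inf p f i = wnorm (p * (1 - p)) (cderiv i (mcoef f)).
Proof.
move=> mf hf; rewrite -ceval_second_moment; apply: eq_cube_expect => x.
rewrite -harmonic_ceval; last by apply: harmonic_cderiv; exact: harmonic_mcoef.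
by rewrite /cube_eval meval_mderiv.
Qed.

End Coefficients.

Section Nonconstant.
Context {R : realType} {n : nat}.
Implicit Types (c : {set 'I_n} -> R).

Definition nonconstant c (S : {set 'I_n}) : R := if S == finset.set0 then 0 else c S.

Lemma nonconstantU1 c i T : nonconstant c (i |: T)%SET = c (i |: T)%SET.
Proof.
rewrite /nonconstant; case: eqP => // iT0.
by have := setU11 i T; rewrite iT0 inE.
Qed.

Lemma mlin_nonconstant c y : mlin c y = c finset.set0 + mlin (nonconstant c) y.
Proof.
rewrite /mlin (bigD1 finset.set0)//= big_set0 mulr1 [in RHS](bigD1 finset.set0)//=.
rewrite [nonconstant c finset.set0]/nonconstant eqxx mul0r add0r; congr (_ + _).
by apply: eq_bigr => S /negbTE S0; rewrite /nonconstant S0.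
Qed.

Lemma harmonic_nonconstant c : harmonic c -> harmonic (nonconstant c).
Proof. by move=> hc T; rewrite -[RHS](hc T); apply: eq_bigr => i _; rewrite nonconstantU1. Qed.

Lemma degree_le_nonconstant d c : degree_le d c -> degree_le d (nonconstant c).
Proof. by move=> dc S /dc; rewrite /nonconstant; case: eqP. Qed.

(** The constant 1 is harmonic of degree 0, so it is orthogonal to every homogeneous part of
    positive degree. Hence the mean on the slice is the coefficient of the empty set. *)
Lemma order_avg_nonconstant d c k : harmonic c -> degree_le d c -> (d <= n)%N -> (k < n)%N ->
  order_avg (feval (nonconstant c)) k = 0.
Proof.
move=> hc dc dn kn; have hz := harmonic_nonconstant hc; have dz := degree_le_nonconstant dc.
pose u (S : {set 'I_n}) : R := if S == finset.set0 then 1 else 0.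
have fu x : feval u x = 1.
  rewrite /feval /mlin (bigD1 finset.set0)//= /u eqxx big_set0 mulr1 big1 ?addr0// => S /negbTE ->.
  by rewrite mul0r.
have hu : harmonic u.
  move=> T; rewrite big1// => i _; rewrite /u; case: eqP => // iT0.
  by have := setU11 i T; rewrite iT0 inE.
have u0 : homogeneous 0 u by move=> S; rewrite cards_eq0 /u => /negbTE->.
transitivity (\sum_(e < d.+1) order_avg (feval (hpart e (nonconstant c))) k).
  rewrite -order_avg_sum; congr (_ / _); apply: eq_bigr => s _; exact: feval_hpart.
apply: big1 => e _; have [e0|e0] := eqVneq (e : nat) 0%N.
  rewrite /order_avg big1 ?mul0r// => s _; rewrite /feval /mlin big1// => S _.
  by rewrite /hpart e0 cards_eq0 /nonconstant; case: eqP; rewrite mul0r.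
have <- : pair_avg (feval (hpart e (nonconstant c))) (feval u) k k =
    order_avg (feval (hpart e (nonconstant c))) k.
  by rewrite pair_avg_diag; congr (_ / _); apply: eq_bigr => s _; rewrite fu mulr1.
apply: (@homogeneous_orthogonal _ _ e 0) => //.
- exact: harmonic_hpart.
- exact: homogeneous_hpart.
- have := ltn_ord e; lia.
Qed.

Lemma order_avgD_cst r g k : order_avg (fun x : {ffun 'I_n -> bool} => r + g x) k = r + order_avg g k :> R.
Proof.
rewrite /order_avg big_split sumr_const /= mulrDl; congr (_ + _).
have -> : #|{perm 'I_n}| = n`! by rewrite -card_Sn; apply: eq_card.
by rewrite -[r *+ _]mulr_natr mulfK// pnatr_eq0 -lt0n fact_gt0.
Qed.

Lemma slice_var_nonconstant d c k : harmonic c -> degree_le d c -> (d <= n)%N -> (k < n)%N ->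
  slice_var k (feval c) = order_avg (fun x => feval (nonconstant c) x ^+ 2) k.
Proof.
move=> hc dc dn kn; rewrite /slice_var !slice_expectE ?(ltnW kn)//.
have -> : order_avg (feval c) k = c finset.set0.
  rewrite -[RHS]addr0 -(order_avg_nonconstant hc dc dn kn) -order_avgD_cst.
  by congr (_ / _); apply: eq_bigr => s _; exact: mlin_nonconstant.
congr (_ / _); apply: eq_bigr => s _.
by rewrite {1}/feval mlin_nonconstant addrC addKr.
Qed.

End Nonconstant.

(** * Influences *)

Section Influence.
Context {R : realType} {n : nat}.
Implicit Types (c : {set 'I_n} -> R) (i j : 'I_n) (S T : {set 'I_n}).

(** Coefficients of f minus its swap: exchanging two arguments acts on index sets by the
    transposition. The result is again harmonic of degree at most d, so the norm comparison applies
    to it. *)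
Definition swap_diff i j c S : R := c S - c (tperm i j @: S)%SET.

Lemma tperm_imsetK i j : involutive (fun S => tperm i j @: S)%SET.
Proof.
by move=> S; rewrite -imset_comp -[RHS]imset_id; apply: eq_imset => l /=; rewrite tpermK.
Qed.

Lemma feval_swap_diff i j c x :
  feval (swap_diff i j c) x = feval c x - feval c (coord_swap i j x).
Proof.
rewrite /feval {1 2}/mlin /swap_diff; under eq_bigr do rewrite mulrBl.
rewrite sumrB; congr (_ - _).
rewrite (reindex_inj (inv_inj (tperm_imsetK i j))) /mlin; apply: eq_bigr => S _.
rewrite tperm_imsetK; congr (_ * _); rewrite big_imset /=; last by move=> ? ? _ _; exact: perm_inj.
by apply: eq_bigr => l _; rewrite ffunE.
Qed.

Lemma harmonic_swap_diff i j c : harmonic c -> harmonic (swap_diff i j c).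
Proof.
move=> hc T; rewrite /swap_diff sumrB hc sub0r.
apply/eqP; rewrite oppr_eq0; apply/eqP; rewrite -[RHS](hc (tperm i j @: T)%SET).
rewrite [RHS](reindex_inj (@perm_inj _ (tperm i j))); apply: eq_big => l.
  by rewrite mem_imset//; exact: perm_inj.
by move=> _; rewrite imsetU1.
Qed.

Lemma degree_le_swap_diff d i j c : degree_le d c -> degree_le d (swap_diff i j c).
Proof.
move=> dc S dS; rewrite /swap_diff !dc ?subr0// card_imset//; exact: perm_inj.
Qed.

Lemma swap_diffU1 i j c T : i \notin T -> j \notin T ->
  swap_diff i j c (i |: T) = c (i |: T)%SET - c (j |: T)%SET.
Proof.
move=> iT jT; rewrite /swap_diff imsetU1 tpermL; congr (_ - c (_ |: _)%SET).
rewrite -[RHS]imset_id; apply: eq_in_imset => l lT.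
by rewrite tpermD//; apply: contraTneq lT => <-.
Qed.

Lemma sqr_sum_le (I : finType) (P : pred I) (F : I -> R) :
  (\sum_(l | P l) F l) ^+ 2 <= #|P|%:R * \sum_(l | P l) F l ^+ 2.
Proof.
set s := \sum_(l | P l) F l; set N : R := #|P|%:R.
have [P0|P0] := eqVneq #|P| 0%N.
  rewrite /s big_pred0 ?expr0n ?mulr_ge0 ?sumr_ge0// => [l _|l]; first exact: sqr_ge0.
  by apply/negbTE; have /card0_eq/(_ l) := P0; rewrite unfold_in => ->.
have N0 : 0 < N by rewrite ltr0n lt0n.
have : 0 <= \sum_(l | P l) (N * F l - s) ^+ 2 by rewrite sumr_ge0// => l _; exact: sqr_ge0.
have -> : \sum_(l | P l) (N * F l - s) ^+ 2 = N * (N * \sum_(l | P l) F l ^+ 2 - s ^+ 2).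
  rewrite (eq_bigr (fun l => N ^+ 2 * F l ^+ 2 - (2 * N * s) * F l + s ^+ 2)); last by move=> l _; ring.
  rewrite big_split sumrB -!big_distrr sumr_const /= -/s -[_ *+ _]mulr_natl -/N; ring.
by rewrite pmulr_rge0// subr_ge0.
Qed.

(* Harmonicity gives [(n - #|T|) * c (i |: T) = \sum_(j | j \notin T) (c (i |: T) - c (j |: T))]. *)
Lemma harmonic_coef_le c i T : harmonic c -> i \notin T ->
  (n - #|T|)%:R * c (i |: T)%SET ^+ 2 <= \sum_(j | j \notin T) swap_diff i j c (i |: T) ^+ 2.
Proof.
move=> hc iT; set m := (n - #|T|)%N.
have cT : #|[pred j | j \notin T]| = m.
  have := cardC (mem T); rewrite card_ord => E; apply/eqP; rewrite -(eqn_add2l #|T|) subnKC; last by rewrite -[X in (_ <= X)%N]card_ord max_card.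
  by rewrite -[X in _ == X]E; apply/eqP; congr (_ + _)%N; apply: eq_card => j; rewrite !inE.
have m0 : 0 < m%:R :> R by rewrite ltr0n -cT; apply/card_gt0P; exists i.
rewrite -(ler_pM2l m0).
have -> : m%:R * (m%:R * c (i |: T)%SET ^+ 2) = (\sum_(j | j \notin T) swap_diff i j c (i |: T)) ^+ 2.
  rewrite (eq_bigr (fun j => c (i |: T)%SET - c (j |: T)%SET)); last by move=> j jT; exact: swap_diffU1.
  by rewrite sumrB hc subr0 sumr_const -[_ *+ _]mulr_natl cT; ring.
by rewrite -{1}cT; exact: sqr_sum_le.
Qed.

Lemma wnorm_cderivE g i c :
  g * wnorm g (cderiv i c) = \sum_(T : {set 'I_n} | i \notin T) g ^+ #|(i |: T)%SET| * c (i |: T)%SET ^+ 2.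
Proof.
rewrite /wnorm big_distrr [RHS]big_mkcond; apply: eq_bigr => T _ /=.
rewrite /cderiv; case: ifP => iT /=; first by rewrite expr0n !mulr0.
by rewrite mulrA -exprS cardsU1 iT add1n.
Qed.

(** The coefficient bound is summed over the sets T; the factor 2 comes from n <= 2(n - |T|), valid
    because |T| < d and 2d <= n. *)
Lemma wnorm_cderiv_swap g d i c : 0 <= g -> harmonic c -> degree_le d c -> (2 * d <= n)%N ->
  n%:R * (g * wnorm g (cderiv i c)) <= 2 * \sum_j wnorm g (swap_diff i j c).
Proof.
move=> g0 hc dc dn; rewrite wnorm_cderivE.
apply: (@le_trans _ _ (2 * \sum_j \sum_(T : {set 'I_n} | i \notin T)
   if j \notin T then g ^+ #|(i |: T)%SET| * swap_diff i j c (i |: T) ^+ 2 else 0)); last first.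
  rewrite ler_wpM2l//; apply: ler_sum => j _.
  pose F S := if j \notin (S :\ i)%SET then g ^+ #|S| * swap_diff i j c S ^+ 2 else 0.
  rewrite /wnorm (eq_bigr (fun T => F (i |: T)%SET)); last by move=> T iT; rewrite /F finset.setU1K.
  rewrite -sum_setU1 [leLHS]big_mkcond; apply: ler_sum => S _.
  have U0 : 0 <= g ^+ #|S| * swap_diff i j c S ^+ 2 by rewrite mulr_ge0 ?sqr_ge0 ?exprn_ge0.
  by rewrite /F; case: (i \in S) => //; case: ifP.
rewrite exchange_big !big_distrr; apply: ler_sum => T iT /=.
rewrite -big_mkcond -big_distrr /= !(mulrCA _ (g ^+ _)) ler_wpM2l ?exprn_ge0//.
apply: (@le_trans _ _ (2 * ((n - #|T|)%:R * c (i |: T)%SET ^+ 2))); last first.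
  by rewrite ler_wpM2l// harmonic_coef_le.
have [Td|Td] := leqP #|(i |: T)%SET| d; last by rewrite dc// expr0n !mulr0.
rewrite mulrA ler_wpM2r ?sqr_ge0// -natrM ler_nat.
move: Td; rewrite cardsU1 iT add1n; set t := #|_|; move: (t) => t'; lia.
Qed.

(** The previous bound, with the cube norm of each swap difference compared to its norm on the
    slice, that is, to a slice influence. *)
Lemma wnorm_cderiv_slice p k d i c rho : 0 < p <= 1 / 2 -> p * n%:R = k%:R ->
  harmonic c -> degree_le d c -> (d <= k)%N -> (0 < k)%N ->
  (forall e, (e <= d)%N ->
    k%:R ^+ e * (n - k)%:R ^+ e <= rho * (k ^_ e * (n - k) ^_ e)%:R) ->
  p * (1 - p) * wnorm (p * (1 - p)) (cderiv i c) <=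
  2 * rho * (n%:R^-1 * \sum_j slice_expect k (fun x => (feval c x - feval c (coord_swap i j x)) ^+ 2)).
Proof.
move=> p01 pn hc dc dk k0 rhoP; have kk := k_le_n p01 pn.
have n0 : 0 < n%:R :> R by rewrite ltr0n; lia.
have g0 : 0 <= p * (1 - p) by have [p0 p1] := andP p01; rewrite mulr_ge0//; lra.
rewrite -(ler_pM2l n0); apply: (@le_trans _ _ (2 * \sum_j wnorm (p * (1 - p)) (swap_diff i j c))).
  by apply: wnorm_cderiv_swap hc dc _ => //; lia.
have -> : n%:R * (2 * rho * (n%:R^-1 * \sum_j slice_expect k (fun x => (feval c x - feval c (coord_swap i j x)) ^+ 2)))
   = 2 * (rho * \sum_j slice_expect k (fun x => (feval c x - feval c (coord_swap i j x)) ^+ 2)).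
  by field; rewrite gt_eqF.
rewrite ler_wpM2l// big_distrr; apply: ler_sum => j _ /=; rewrite slice_expectE; last by lia.
have := norm_comparison p01 pn (harmonic_swap_diff i j hc) (degree_le_swap_diff i j dc) dk _ rhoP.
move/(_ ltac:(lia)) => h; apply: le_trans h _; rewrite le_eqVlt; apply/predU1P; left; congr (_ * (_ / _)).
by apply: eq_bigr => s _; rewrite feval_swap_diff.
Qed.

(** Total influence: a monomial S is counted once for each of its at most d elements. *)
Lemma sum_wnorm_cderiv g d c : 0 <= g -> degree_le d c ->
  g * \sum_i wnorm g (cderiv i c) <= d%:R * wnorm g (nonconstant c).
Proof.
move=> g0 dc; rewrite big_distrr /=.
under eq_bigr do rewrite wnorm_cderivE -(sum_setU1 _ (fun S => g ^+ #|S| * c S ^+ 2)).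
rewrite (exchange_big_dep xpredT)//= /wnorm big_distrr; apply: ler_sum => S _ /=.
rewrite /nonconstant; have [->|S0] := eqVneq S finset.set0.
  by rewrite expr0n !mulr0 big_pred0// => i; rewrite inE.
rewrite (eq_bigl (mem S))// sumr_const -[_ *+ _]mulr_natl.
have [Sd|Sd] := leqP #|S| d; last by rewrite dc// expr0n !mulr0.
by rewrite ler_wpM2r ?ler_nat// mulr_ge0 ?sqr_ge0 ?exprn_ge0.
Qed.

End Influence.

(** * Lipschitz functionals: concentration around the mean, and cube versus Gaussian space *)

Section LipschitzExpectations.
Context {R : realType}.
Variables (psi : R -> R) (C : R).
Hypothesis psi_lip : forall x y, `|psi x - psi y| <= C * `|x - y|.

Lemma lipschitz_cst_ge0 : 0 <= C.
Proof. by have := psi_lip 1 0; rewrite subr0 normr1 mulr1 => /(le_trans (normr_ge0 _)). Qed.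

Let C_ge0 := lipschitz_cst_ge0.

Lemma measurable_lipschitz : measurable_fun setT psi.
Proof. by apply: continuous_measurable_fun; exact: lipschitz_continuous psi_lip. Qed.

Lemma lipschitz_growth y : `|psi y| <= (`|psi 0| + C) * (1 + y ^+ 4).
Proof.
have h : `|psi y| <= `|psi 0| + C * `|y|.
  rewrite -[X in `|X|](subrK (psi 0)) (le_trans (ler_normD _ _))// addrC lerD2l.
  by have := psi_lip y 0; rewrite subr0.
apply: (le_trans h).
have -> : y ^+ 4 = `|y| ^+ 4 by rewrite -normrX ger0_norm// exprn_even_ge0.
have := normr_ge0 (psi 0); have := normr_ge0 y; move=> r0 a0; set r : R := `|y| in r0 *; set a : R := `|psi 0| in a0 *.
have r4 : 0 <= r ^+ 4 by rewrite exprn_ge0.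
have rr : r <= 1 + r ^+ 4.
  have := sqr_ge0 (r ^+ 2 - 1 / 2); have := sqr_ge0 (r - 1 / 2); lra.
rewrite mulrDl lerD//; last by rewrite ler_wpM2l.
by rewrite ler_peMr// lerDl.
Qed.

(** From |z| <= delta + z^2/delta. For delta > 1 this reduces everything to bounds on the
    variance. *)
Lemma lipschitz_sqr_le m z (delta : R) : 0 < delta ->
  `|psi (m + z) - psi m| <= C * delta + C / delta * z ^+ 2.
Proof.
move=> d0; apply: (le_trans (psi_lip _ _)); rewrite (addrC m) addrK.
rewrite (_ : C * delta + C / delta * z ^+ 2 = C * (delta + z ^+ 2 / delta)); last by ring.
rewrite ler_wpM2l// -[z ^+ 2]real_normK ?num_real//.
move: `|z| (normr_ge0 z) => v v0; rewrite -subr_ge0.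
have -> : delta + v ^+ 2 / delta - v = ((delta - v / 2) ^+ 2 + 3 / 4 * v ^+ 2) / delta.
  by field; rewrite gt_eqF.
by rewrite divr_ge0 ?(ltW d0)// addr_ge0 ?sqr_ge0// mulr_ge0// sqr_ge0.
Qed.

Context {n : nat}.
Implicit Types (c : {set 'I_n} -> R).

Lemma slice_lipschitz c k (delta : R) : 0 < delta ->
  `|order_avg (psi \o feval c) k - psi (c finset.set0)| <=
  C * delta + C / delta * order_avg (fun x => feval (nonconstant c) x ^+ 2) k.
Proof.
move=> d0; rewrite -[X in `|_ - X|]addr0.
have <- : order_avg (fun x : {ffun 'I_n -> bool} => 0) k = 0 :> R.
  by rewrite /order_avg big1 ?mul0r.
rewrite -order_avgD_cst.
have -> : C / delta * order_avg (fun x => feval (nonconstant c) x ^+ 2) k =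
    order_avg (fun x => C / delta * feval (nonconstant c) x ^+ 2) k.
  by rewrite /order_avg mulrA big_distrr.
rewrite -order_avgD_cst /order_avg -mulrBl -sumrB normrM [`|_^-1|]ger0_norm//.
rewrite ler_wpM2r// (le_trans (ler_norm_sum _ _ _))//; apply: ler_sum => s _ /=.
by rewrite addr0 {1}/feval mlin_nonconstant lipschitz_sqr_le.
Qed.

Lemma cube_lipschitz p c (delta : R) : 0 < p <= 1 / 2 -> harmonic c -> 0 < delta ->
  `|cube_expect p (psi \o feval c) - psi (c finset.set0)| <=
  C * delta + C / delta * wnorm (p * (1 - p)) (nonconstant c).
Proof.
move=> p01 hc d0; rewrite -(cube_expect_cst p n (psi _)) -cube_expectB.
apply: (le_trans (normr_cube_expect p01 _)).
rewrite -ceval_second_moment -cube_expectZ -(cube_expect_cst p n (C * delta)) -cube_expectD.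
apply: le_cube_expect => // x; rewrite /= -(harmonic_ceval p); last exact: harmonic_nonconstant.
by rewrite {1}/feval mlin_nonconstant lipschitz_sqr_le.
Qed.

End LipschitzExpectations.

Section Gaussian.
Context {R : realType}.
Variable p : R.
Hypothesis p01 : 0 < p <= 1 / 2.
Local Notation s2 := (p * (1 - p)).
Local Notation P := (normal_prob p (Num.sqrt s2) : probability (measurableTypeR R) R).

Lemma s2_gt0 : 0 < s2.
Proof. by have [p0 p1] := andP p01; rewrite mulr_gt0//; lra. Qed.

Let s2_le : s2 <= 1 / 4.
Proof. by have := sqr_ge0 (p - 1 / 2); lra. Qed.

Let sqrt_neq0 : Num.sqrt s2 != 0.
Proof. by rewrite gt_eqF// sqrtr_gt0 s2_gt0. Qed.

Let sqrtK : Num.sqrt s2 ^+ 2 = s2.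
Proof. by rewrite sqr_sqrtr// ltW// s2_gt0. Qed.

Let intX k : P.-integrable setT (EFin \o (fun x => (x - p) ^+ k)).
Proof. exact: normal_integrable_exprn. Qed.

Let mean0 : \int[P]_x (x - p) = 0.
Proof. by have [] := normal_mean_var p sqrt_neq0. Qed.

Let var_s2 : \int[P]_x (x - p) ^+ 2 = s2.
Proof. by have [_ ->] := normal_mean_var p sqrt_neq0. Qed.

Let moment4 : \int[P]_x (x - p) ^+ 4 <= 5.
Proof.
(* With t = 4 the bound reads (48/256) exp(8 p(1-p)), where 8 p(1-p) <= 2 and e^2 <= 16; it is at
   most 3. *)
have := normal_moment4 p sqrt_neq0 (ltr0Sn R 3); rewrite sqrtK => /le_trans; apply.
have e2 : expR (1 / 2) <= 2 :> R.
  have := expR_ge1Dx (- (1 / 2) : R); rewrite expRN => h.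
  have e0 := expR_gt0 (1 / 2 : R).
  have : expR (1 / 2) * (1 - 1 / 2) <= expR (1 / 2) / expR (1 / 2) :> R by rewrite ler_wpM2l// ltW.
  by rewrite divff ?gt_eqF//; lra.
have e16 : expR (4 ^+ 2 * s2 / 2) <= 16 :> R.
  apply: (@le_trans _ _ (expR (1 / 2) ^+ 4)).
    by rewrite -expRM_natl ler_expR; have := s2_le; lra.
  by rewrite (_ : 16 = 2 ^+ 4 :> R) ?lerXn2r ?nnegrE ?expR_ge0//; ring.
have := expR_ge0 (4 ^+ 2 * s2 / 2); lra.
Qed.

Context {n : nat}.
Implicit Types (c : {set 'I_n} -> R).

Lemma gauss_integrable c (h : R -> R) (K : R) : measurable_fun setT h ->
  (forall y, `|h y| <= K * (1 + y ^+ 4)) ->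
  (gauss p n).-integrable setT (EFin \o (h \o teval p c)).
Proof. by move=> mh hK; apply: (quartic_growth_integrable (intX 4)); exact: quartic_growth_comp hK. Qed.

Section Lipschitz.
Variables (psi : R -> R) (C : R).
Hypothesis psi_lip : forall x y, `|psi x - psi y| <= C * `|x - y|.

Lemma gauss_integrable_lipschitz c : (gauss p n).-integrable setT (EFin \o (psi \o teval p c)).
Proof. exact: gauss_integrable (measurable_lipschitz psi_lip) (lipschitz_growth psi_lip). Qed.

Lemma gauss_lipschitz c (delta : R) : 0 < delta ->
  `|\int[gauss p n]_t psi (teval p c t) - psi (c finset.set0)| <=
  C * delta + C / delta * wnorm s2 (nonconstant c).
Proof.
move=> d0; have i1 := gauss_integrable_lipschitz c.
have icst r := finite_measure_integrable_cst (gauss p n) r measurableT.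
have i2 : (gauss p n).-integrable setT (EFin \o (fun t => teval p (nonconstant c) t ^+ 2)).
  apply: (@gauss_integrable _ (fun y => y ^+ 2) 1); first exact: measurable_funX.
  by move=> y; rewrite ger0_norm ?sqr_ge0// mul1r; nra.
rewrite -[X in `|_ - X|](Rintegral_probability_cst (gauss p n)) -RintegralB//; last exact: icst.
apply: (le_trans (le_normr_Rintegral _ (EFin_integrableB i1 (icst _)))) => //.
have i3 := EFin_integrableD (icst (C * delta)) (EFin_integrableZl (C / delta) i2).
apply: (@le_trans _ _ (\int[gauss p n]_t (C * delta + C / delta * teval p (nonconstant c) t ^+ 2))).
  apply: le_Rintegral => //; first exact/integrable_norm/EFin_integrableB.
  by move=> t _; rewrite /= {1}/teval mlin_nonconstant lipschitz_sqr_le.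
rewrite RintegralD//; [|exact: icst|exact: EFin_integrableZl].
rewrite Rintegral_probability_cst RintegralZl// lerD2l.
by rewrite (teval_second_moment intX mean0 var_s2).
Qed.

(** Smoothing costs 10 C e on each of the two spaces, and the Lindeberg factor 8 M with M = 4 C/e^2
    gives 32 C/e^2. *)
Lemma cube_vs_gauss c (e l : R) : 0 < e -> 0 < l ->
  `|cube_expect p (psi \o ceval p c) - \int[gauss p n]_t psi (teval p c t)| <=
  20 * C * e + 32 * C / e ^+ 2 *
    \sum_(i < n) (l * wnorm 4 (cderiv i c) + wnorm 4 (cderiv i c) ^+ 2 / l).
Proof.
move=> e0 l0; have C0 := lipschitz_cst_ge0 psi_lip.
have [phi [phi1 [phi2 [cphi phipsi phiT]]]] := smooth_approximation psi_lip e0.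
have mphi : measurable_fun setT phi by exact: continuous_measurable_fun.
pose K := `|psi 0| + C + 10 * C * e.
have gphi y : `|phi y| <= K * (1 + y ^+ 4).
  have -> : phi y = psi y + (phi y - psi y) by rewrite addrC subrK.
  rewrite (le_trans (ler_normD _ _))// mulrDl lerD ?lipschitz_growth//.
  have y4 : 0 <= y ^+ 4 by rewrite exprn_even_ge0.
  rewrite (le_trans (phipsi y))// ler_peMr ?mulr_ge0 ?(ltW e0)//; first by lra.
have lin := lindeberg intX mean0 var_s2 moment4 _ _ p01 _ mphi gphi phiT c l0.
have := lin _ _ erefl; have s21 : s2 <= 1 by have := s2_le; lra.
move/(_ s21 (lexx _)) => {}lin.
have iphi := gauss_integrable c mphi gphi; have ipsi := gauss_integrable_lipschitz c.
have h1 : `|cube_expect p (psi \o ceval p c) - cube_expect p (phi \o ceval p c)| <= 10 * C * e.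
  rewrite -cube_expectB; apply: (le_trans (normr_cube_expect p01 _)).
  rewrite -(cube_expect_cst p n (10 * C * e)); apply: le_cube_expect => // x /=.
  by rewrite distrC.
have h2 : `|\int[gauss p n]_t phi (teval p c t) - \int[gauss p n]_t psi (teval p c t)| <= 10 * C * e.
  rewrite -RintegralB//; apply: (le_trans (le_normr_Rintegral _ (EFin_integrableB iphi ipsi))) => //.
  rewrite -[leRHS](Rintegral_probability_cst (gauss p n)); apply: le_Rintegral => //.
  - exact/integrable_norm/EFin_integrableB.
  - exact: finite_measure_integrable_cst.
  - by move=> t _ /=.
apply: (le_trans (ler_distD (cube_expect p (phi \o ceval p c)) _ _)).
apply: (le_trans (lerD h1 (ler_distD (\int[gauss p n]_t phi (teval p c t)) _ _))).
apply: (le_trans (lerD (lexx _) (lerD lin h2))).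
by rewrite le_eqVlt; apply/predU1P; left; ring.
Qed.

End Lipschitz.

Lemma gauss_expectation (psi : R -> R) (C : R) (f : mpoly n R) :
  (forall x y, `|psi x - psi y| <= C * `|x - y|) ->
  mpoly_multilinear f -> mpoly_harmonic f ->
  'E_(gauss p n)[fun t => psi (tuple_eval f t)]%E =
  (\int[gauss p n]_t psi (teval p (mcoef f) t))%:E.
Proof.
move=> lip mf hf; rewrite -EFin_Rintegral; last exact: gauss_integrable_lipschitz lip _.
by rewrite unlock; apply: eq_integral => t _; rewrite (tuple_evalE p).
Qed.

End Gaussian.

(* [G] and [x] stand for [(8 / p) ^+ d] and [2 ^+ d]; [l] balances the two terms of the sum in [lindeberg]. *)
Lemma influence_arith {R : realFieldType} (b C delta tau D x G : R) (l := delta ^+ 3 / (x * G)) :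
  0 < b -> 0 < G -> 0 < x -> 0 < delta -> 0 <= C -> 0 <= D -> D <= x ->
  tau <= (x ^+ 2 * G ^+ 3)^-1 * delta ^+ 6 ->
  32 * C / delta ^+ 2 * ((l + G * (2 * b * tau) / l) * (G * (D * b))) <=
  32 * (b + 2 * b ^+ 2) * (C * delta).
Proof.
move=> b0 G0 x0 d0 C0 D0 Dx tauP.
have td : x ^+ 2 * G ^+ 3 * tau / delta ^+ 5 <= delta.
  rewrite ler_pdivrMr ?exprn_gt0// -exprS; move: tauP.
  by rewrite mulrC ler_pdivlMr ?mulr_gt0 ?exprn_gt0// mulrC.
rewrite [leLHS](_ : _ = 32 * C * (delta * b * (D / x) +
    2 * b ^+ 2 * (D / x) * (x ^+ 2 * G ^+ 3 * tau / delta ^+ 5))); last first.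
  by rewrite /l; field; rewrite !gt_eqF.
rewrite [leRHS](_ : _ = 32 * C * (delta * b + 2 * b ^+ 2 * delta)); last by ring.
have dx0 : 0 <= D / x by rewrite divr_ge0// ltW.
have dx1 : D / x <= 1 by rewrite ler_pdivrMr// mul1r.
rewrite ler_wpM2l ?mulr_ge0// lerD//.
  by rewrite ler_piMr// mulr_ge0 ?ltW.
have bb : 0 <= 2 * b ^+ 2 by rewrite mulr_ge0// sqr_ge0.
apply: (@le_trans _ _ (2 * b ^+ 2 * (D / x) * delta)).
  by rewrite ler_wpM2l// mulr_ge0.
by rewrite ler_wpM2r ?(ltW d0)// ler_piMr.
Qed.

(** * Choice of parameters and final estimates *)

Section Assembly.
Context {R : realType}.
Variables (p : R) (n k d : nat) (c : {set 'I_n} -> R).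
Hypothesis p01 : 0 < p <= 1 / 2.
Hypothesis pn : p * n%:R = k%:R.
Hypothesis k_gt0 : (0 < k)%N.
Hypothesis hc : harmonic c.
Hypothesis dc : degree_le d c.
Hypothesis var1 : order_avg (fun x => feval (nonconstant c) x ^+ 2) k <= 1.
Local Notation s2 := (p * (1 - p)).

Let p_gt0 : 0 < p. Proof. by case/andP: p01. Qed.
Let p_le : p <= 1 / 2. Proof. by case/andP: p01. Qed.
Let k_le : (k <= n - k)%N := k_le_n p01 pn.
Let k_lt : (k < n)%N. Proof. have := k_le; have := k_gt0; lia. Qed.
Let n_gt0 : 0 < n%:R :> R. Proof. by rewrite ltr0n; have := k_lt; lia. Qed.

Lemma wnorm_nonconstant_le (rho : R) : (d <= k)%N ->
  (forall e, (e <= d)%N -> k%:R ^+ e * (n - k)%:R ^+ e <= rho * (k ^_ e * (n - k) ^_ e)%:R) ->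
  0 <= rho -> wnorm s2 (nonconstant c) <= rho.
Proof.
move=> dk rhoP rho0; rewrite -[leRHS]mulr1.
apply: le_trans (norm_comparison p01 pn (harmonic_nonconstant hc) (degree_le_nonconstant dc) dk k_lt rhoP) _.
by rewrite ler_wpM2l.
Qed.

(** With t = e^2/k <= 1/2, the factor 1 + 6t is at most 4. *)
Lemma ratio_4 e : (2 * d ^ 2 <= k)%N -> (e <= d)%N ->
  k%:R ^+ e * (n - k)%:R ^+ e <= 4 * (k ^_ e * (n - k) ^_ e)%:R :> R.
Proof.
move=> dk ed; have ek : (2 * e ^ 2 <= k)%N by apply: leq_trans dk; rewrite leq_mul2l leq_sqr.
apply: (le_trans (ratio_sqr p01 pn k_gt0 ek)); rewrite ler_wpM2r//.
have : 2 * e%:R ^+ 2 <= k%:R :> R by rewrite -natrX -natrM ler_nat.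
have K0 : 0 < k%:R :> R by rewrite ltr0n.
rewrite -lerBrDl ler_pdivrMr//; lra.
Qed.

Lemma wnorm_nonconstant_le4 : (2 * d ^ 2 <= k)%N -> wnorm s2 (nonconstant c) <= 4.
Proof.
move=> dk; apply: wnorm_nonconstant_le => // [|e ed]; last exact: ratio_4.
exact: leq_trans (leq_double_sqr d) dk.
Qed.

(** If k < 2d^2, only the bound 256^d is at hand, but then n is small as well: p I^d <= k delta^6 <=
    2 4^d delta^6. As 4 * 256^3 = 2^26, the hypothesis p I >= 2^27 yields 256^(3d) <= delta^6. This
    is where the power of 2 in I_p comes from. *)
Lemma wnorm_nonconstant_le_delta (I delta : R) : 1 < delta -> (d <= k)%N -> 2 ^+ 27 / p <= I ->
  I ^+ d / delta ^+ 6 <= n%:R -> wnorm s2 (nonconstant c) <= 4 * delta ^+ 2.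
Proof.
move=> d1 dk Ip nd; have d0 : 0 < delta by exact: lt_trans d1.
have dd1 : 1 <= delta ^+ 2 by rewrite exprn_ege1// ltW.
have [small|large] := leqP (2 * d ^ 2) k; first by have := wnorm_nonconstant_le4 small; lra.
have : wnorm s2 (nonconstant c) <= 256 ^+ d.
  apply: (wnorm_nonconstant_le dk) (exprn_ge0 d (ler0n R 256)) => e ed.
  apply: (le_trans (ratio_256 p01 pn (leq_trans ed dk))); rewrite ler_wpM2r//.
  by rewrite ler_weXn2l// ler1n.
move/le_trans; apply; apply: (@le_trans _ _ (delta ^+ 2)); last by rewrite ler_peMl// ?(le_trans ler01)// ler1n.
have B0 : 0 <= 256 ^+ d :> R by exact: exprn_ge0 (ler0n R 256).
(* Both sides are cubed, so that delta^2 meets the delta^6 of the hypothesis on n. *)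
rewrite -(@ler_pXn2r _ 3) ?nnegrE ?B0 ?sqr_ge0//.
have D1 : (0 < d)%N by move: large; case: (d) => //; rewrite muln0.
have kd : k%:R <= 2 * d%:R ^+ 2 :> R by rewrite -natrX -natrM ler_nat ltnW.
have dd : d%:R ^+ 2 <= 4 ^+ d :> R.
  rewrite -!natrX ler_nat (_ : 4 = 2 ^ 2)%N// -expnM mulnC expnM leq_sqr ltnW//; exact: ltn_expl.
rewrite -[leRHS]exprM (_ : (2 * 3 = 6)%N)//.
have : p * I ^+ d <= 2 * 4 ^+ d * delta ^+ 6.
  apply: (@le_trans _ _ (k%:R * delta ^+ 6)).
    by rewrite -pn -mulrA ler_wpM2l ?(ltW p_gt0)// -ler_pdivrMr// exprn_gt0.
  by rewrite ler_wpM2r ?exprn_ge0 ?(ltW d0)// (le_trans kd)// ler_wpM2l.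
have I0 : 2 ^+ 26 <= I.
  apply: le_trans Ip; rewrite ler_pdivlMr//; apply: (@le_trans _ _ (2 ^+ 26 * (1 / 2))).
    by rewrite ler_wpM2l ?exprn_ge0.
  by rewrite exprS; have : 0 <= 2 ^+ 26 :> R by []; lra.
have : 2 * 4 ^+ d * 256 ^+ d ^+ 3 <= p * I ^+ d.
  have -> : 2 * 4 ^+ d * 256 ^+ d ^+ 3 = 2 * (2 ^+ 26) ^+ d :> R.
    rewrite -mulrA; congr (_ * _); rewrite -exprM mulnC exprM -exprMn; congr (_ ^+ d).
    by ring.
  have BI : 2 * 2 ^+ 26 <= p * I by rewrite -exprS mulrC -ler_pdivrMr.
  have B1 : 0 <= 2 ^+ 26 :> R by rewrite exprn_ge0.
  move: (2 ^+ 26) B1 BI I0 => B B1 BI I0.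
  case: (d) D1 => // m _; rewrite [B ^+ _]exprS [I ^+ _]exprS !mulrA ler_pM ?exprn_ge0 ?mulr_ge0//.
  by rewrite lerXn2r// nnegrE (le_trans B1).
move=> h1 h2; have := le_trans h1 h2; rewrite ler_pM2l// mulr_gt0// exprn_gt0//.
Qed.

Variables (psi : R -> R) (C : R).
Hypothesis psi_lip : forall x y, `|psi x - psi y| <= C * `|x - y|.

Let C_ge0 : 0 <= C := lipschitz_cst_ge0 psi_lip.

Lemma slice_vs_cube (delta : R) : 0 < delta <= 1 -> (2 * d ^ 2 <= k)%N ->
  64 ^+ d / delta ^+ 6 <= n%:R ->
  `|order_avg (psi \o feval c) k - cube_expect p (psi \o feval c)| <= (1 + 10 / p) * (C * delta).
Proof.
move=> /andP[d0 d1] dk nd.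
(* The mean is moved into the functional, since the variance controls only the nonconstant part.
   Then theta = delta/(d+1) makes the first error term exactly C delta. *)
pose psi0 y := psi (c finset.set0 + y).
have lip0 x y : `|psi0 x - psi0 y| <= C * `|x - y|.
  by apply: (le_trans (psi_lip _ _)); rewrite opprD addrACA subrr add0r.
have D0 : 0 < d.+1%:R :> R by rewrite ltr0n.
have := slice_vs_cube_mean0 p01 pn k_gt0 (harmonic_nonconstant hc) (degree_le_nonconstant dc)
  dk var1 (divr_gt0 d0 D0) C_ge0 lip0.
have -> : order_avg (psi0 \o feval (nonconstant c)) k = order_avg (psi \o feval c) k.
  by congr (_ / _); apply: eq_bigr => s _; rewrite /= /psi0 /feval -mlin_nonconstant.
have -> : cube_expect p (psi0 \o feval (nonconstant c)) = cube_expect p (psi \o feval c).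
  by apply: eq_cube_expect => x; rewrite /= /psi0 /feval -mlin_nonconstant.
move/le_trans; apply; rewrite [leRHS]mulrCA ler_wpM2l// mulrCA divff ?gt_eqF// mulr1 [leRHS]mulrDl mul1r lerD2l.
set r := Num.sqrt n%:R; have rr : r ^+ 2 = n%:R by rewrite sqr_sqrtr// ltW.
have r0 : 0 < r by rewrite sqrtr_gt0.
have r1 : 1 <= r.
  by rewrite -[leLHS]sqrtr1 ler_wsqrtr// ler1n (leq_ltn_trans _ k_lt).
(* The square root of the hypothesis on n. It beats the polynomial factor d^2 (d+1) <= 8^d left by
   theta. *)
have dr : 8 ^+ d <= r * delta ^+ 3.
  rewrite -ler_pdivrMr ?exprn_gt0// -(@ler_pXn2r _ 2) ?nnegrE ?(ltW r0)//; last first.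
    by rewrite divr_ge0// exprn_ge0// ltW.
  rewrite rr expr_div_n -!exprM [(d * 2)%N]mulnC exprM (_ : 8 ^+ 2 = 64)//; ring.
have dd : d%:R ^+ 2 * d.+1%:R <= 8 ^+ d :> R.
  rewrite -!natrX -natrM ler_nat; have d2 : (d < 2 ^ d)%N by exact: ltn_expl.
  have -> : (8 ^ d = 2 ^ d * 2 ^ d * 2 ^ d)%N by rewrite -!expnMn.
  by rewrite -mulnn leq_mul// leq_mul// ltnW.
have ddd : d%:R <= d%:R ^+ 2 :> R by rewrite -natrX ler_nat; case: (d) => // m; rewrite expnS leq_pmulr.
have K0 : 0 < k%:R :> R by rewrite ltr0n.
have inner : 6 * d%:R ^+ 2 / k%:R + 4 * d%:R * r / k%:R <= 10 * d%:R ^+ 2 / (p * r).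
  rewrite -mulrDl -pn -rr -subr_ge0.
  rewrite (_ : _ - _ = (6 * d%:R ^+ 2 * (r - 1) + 4 * r * (d%:R ^+ 2 - d%:R)) / (p * r ^+ 2)); last first.
    by field; rewrite !gt_eqF.
  rewrite divr_ge0//; last by rewrite mulr_ge0 ?sqr_ge0 ?(ltW p_gt0).
  by rewrite addr_ge0// mulr_ge0 ?subr_ge0// ?mulr_ge0 ?sqr_ge0// ltW.
rewrite invf_div; apply: (@le_trans _ _ (10 * d%:R ^+ 2 / (p * r) * (d.+1%:R / delta))).
  by rewrite ler_wpM2r// divr_ge0 ?ltW.
rewrite (_ : _ * _ = 10 / p * (d%:R ^+ 2 * d.+1%:R) / (r * delta)); last first.
  by field; rewrite !gt_eqF.
have rd : 0 < r * delta by rewrite mulr_gt0.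
rewrite ler_pdivrMr// -[leRHS]mulrA ler_wpM2l ?divr_ge0 ?(ltW p_gt0)//.
apply: (le_trans dd); apply: (le_trans dr).
rewrite [leRHS]mulrCA ler_wpM2l ?(ltW r0)// [leLHS]exprSr [leLHS]mulrC -expr2.
by rewrite ler_piMl// exprn_ge0// ltW.
Qed.

(** The sum of v_i^2 is bounded by the maximum of v_i times their sum: the maximum is governed by
    tau, the sum by the variance. With b = 8/p one has 4/(p(1-p)) <= b, so passing from weight 4 to
    the true variance costs b^d. *)
Lemma cube_vs_gauss_influence (delta tau : R) : 0 < delta -> (2 * d ^ 2 <= k)%N ->
  (forall i, s2 * wnorm s2 (cderiv i c) <= 8 * tau) ->
  tau <= (4 * (8 / p) ^+ 3) ^- d * delta ^+ 6 ->
  `|cube_expect p (psi \o feval c) - \int[gauss p n]_t psi (teval p c t)| <=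
  (20 + 32 * (8 / p + 2 * (8 / p) ^+ 2)) * (C * delta).
Proof.
move=> d0 dk inf tauP; set b := 8 / p; have b0 : 0 < b by rewrite divr_gt0.
have s20 := s2_gt0 p01.
have s2b : 4 <= s2 * b.
  have -> : s2 * b = 8 * (1 - p) by rewrite /b; field; rewrite gt_eqF.
  by have := p_le; lra.
set G := b ^+ d; have G0 : 0 < G by rewrite exprn_gt0.
set x : R := 2 ^+ d; have x0 : 0 < x by rewrite exprn_gt0.
have dx : d%:R <= x by rewrite /x -natrX ler_nat ltnW//; exact: ltn_expl.
have bE : (4 * b ^+ 3) ^+ d = x ^+ 2 * G ^+ 3.
  by rewrite exprMn /x /G -!exprM [(d * 2)%N]mulnC [(d * 3)%N]mulnC !exprM; congr (_ ^+ _ * _); ring.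
rewrite -/b bE in tauP.
(* Chosen so that l G d, divided by delta^2, is at most delta; the remaining term then requires tau
   <= delta^6/(x^2 G^3), which is the base 4 (8/p)^3. *)
pose l := delta ^+ 3 / (x * G); have l0 : 0 < l by rewrite divr_gt0 ?exprn_gt0 ?mulr_gt0.
have := @cube_vs_gauss _ _ p01 _ _ _ psi_lip c _ _ d0 l0.
have -> : cube_expect p (psi \o ceval p c) = cube_expect p (psi \o feval c).
  by apply: eq_cube_expect => y; rewrite /= (harmonic_ceval p).
move/le_trans; apply; rewrite [leRHS]mulrDl (_ : 20 * C * delta = 20 * (C * delta)) ?lerD2l; last by ring.
pose v i := wnorm 4 (cderiv i c); pose w i := wnorm s2 (cderiv i c).
have w0 i : 0 <= w i by rewrite wnorm_ge0// ltW.
have v0 i : 0 <= v i by rewrite wnorm_ge0.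
have vw i : v i <= G * w i.
  apply: (@le_trans _ _ ((4 / s2) ^+ d * w i)).
    apply: wnorm_degree_le => //; first by have := sqr_ge0 (p - 1 / 2); lra.
    move=> S dS; rewrite /cderiv; case: ifP => // _; apply: dc; apply: leq_trans dS _.
    by apply: subset_leq_card; exact: finset.subsetUr.
  rewrite ler_wpM2r// lerXn2r ?nnegrE ?(ltW b0)//; first by rewrite divr_ge0// ltW.
  by rewrite ler_pdivrMr// mulrC.
have wtau i : w i <= 2 * b * tau.
  rewrite -(ler_pM2l s20); apply: (le_trans (inf i)).
  have t0 : 0 <= tau by have := le_trans (mulr_ge0 (ltW s20) (w0 i)) (inf i); lra.
  rewrite (_ : s2 * (2 * b * tau) = 2 * (s2 * b) * tau); last by ring.
  by rewrite ler_wpM2r//; lra.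
have sw : \sum_i w i <= d%:R * b.
  rewrite -(ler_pM2l s20); apply: (le_trans (sum_wnorm_cderiv (ltW s20) dc)).
  apply: (@le_trans _ _ (d%:R * 4)); first by rewrite ler_wpM2l// wnorm_nonconstant_le4.
  by rewrite (_ : s2 * (d%:R * b) = d%:R * (s2 * b)) ?ler_wpM2l//; ring.
have sumv : \sum_i (l * v i + v i ^+ 2 / l) <= (l + G * (2 * b * tau) / l) * (G * (d%:R * b)).
  have vb i : v i <= G * (2 * b * tau) by apply: (le_trans (vw i)); rewrite ler_wpM2l// ltW.
  have n0 : (0 < n)%N by exact: leq_ltn_trans k_lt.
  have V0 : 0 <= l + G * (2 * b * tau) / l.
    by rewrite addr_ge0 ?(ltW l0)// divr_ge0 ?(ltW l0)// (le_trans (v0 (Ordinal n0))).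
  apply: (@le_trans _ _ (\sum_i (l + G * (2 * b * tau) / l) * v i)).
    apply: ler_sum => i _; rewrite mulrDl lerD2l [leRHS]mulrAC ler_wpM2r ?invr_ge0 ?(ltW l0)//.
    by rewrite expr2 ler_wpM2r.
  rewrite -big_distrr ler_wpM2l//= (le_trans (ler_sum _ (fun i _ => vw i)))//.
  by rewrite -big_distrr ler_wpM2l// ltW.
have cd0 : 0 <= 32 * C / delta ^+ 2 by rewrite divr_ge0 ?mulr_ge0 ?exprn_ge0 ?(ltW d0).
apply: (le_trans (ler_wpM2l cd0 sumv)).
exact: influence_arith.
Qed.

End Assembly.

(* Without [delta <= 1 \/ d <= k] the claim is false: for p < 1/2 and k < d <= n/2,
   a large multiple of \prod_(i < d) (x_(2i) - x_(2i+1)) vanishes identically on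
   the slice, while [delta] need only be at least (I p ^+ d / n) `^ K^-1. *)
Lemma k_lt_n {R : realType} {n : nat} (p : R) (k : nat) :
  0 < p <= 1 / 2 -> p * n%:R = k%:R -> (0 < k)%N -> (k < n)%N.
Proof. by move=> p01 pn k0; have := k_le_n p01 pn; lia. Qed.

(** The three demands on I_p when delta <= 1: 8/p forces 2d^2 <= k, 64 serves the comparison of
    slice and cube, and 4 (8/p)^3 the replacement argument, whence p^3 in the denominator. *)
Lemma base_bounds {R : realFieldType} (p : R) (I := 2 ^+ 27 / p ^+ 3) : 0 < p <= 1 / 2 ->
  [/\ 8 / p <= I, 64 <= I & 4 * (8 / p) ^+ 3 <= I].
Proof.
move=> /andP[p0 p1].
have u2 : 2 <= p^-1 by rewrite -[leLHS]invrK lef_pV2 ?posrE// -[leRHS]mul1r.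
have : 2048 <= 2 ^+ 27 :> R by rewrite (_ : 2048 = 2 ^+ 11); [rewrite ler_weXn2l ?ler1n|ring].
rewrite /I -[(p ^+ 3)^-1]exprVn; move: (2 ^+ 27) (p^-1) u2 => B u u2 B2.
have uu : 4 <= u ^+ 2 by nra.
have u3 : 4 * u <= u ^+ 3 by rewrite exprSr ler_wpM2r//; lra.
have B3 : 2048 * u ^+ 3 <= B * u ^+ 3 by rewrite ler_wpM2r//; lra.
by split; rewrite ?exprMn; lra.
Qed.

Theorem theorem5p8 (R : realType) :
  exists K : R, 0 < K /\
  exists I N c : R -> R,
    {in `]0, 2^-1], forall p, 0 < I p} /\
    {within [set` `]0, 2^-1]], continuous I} /\
    {within [set` `]0, 2^-1]], continuous N} /\
    {within [set` `]0, 2^-1]], continuous c} /\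
    forall (p : R) (n k d : nat) (f : mpoly n R) (tau delta : R),
      p \in `]0, 2^-1] ->
      p * n%:R = k%:R ->
      N p <= n%:R ->
      mpoly_multilinear f -> mpoly_harmonic f -> mdegree f = d ->
      slice_var k (cube_eval f) <= 1 ->
      (forall i, slice_inf k f i <= tau) \/ (forall i, cube_inf p f i <= tau) ->
      0 < delta ->
      (delta <= 1 \/ (d <= k)%N) ->
      tau <= I p ^- d * delta `^ K ->
      I p ^+ d / delta `^ K <= n%:R ->
      forall (C : R) (psi : R -> R),
        (forall x y, `|psi x - psi y| <= C * `|x - y|) ->
        `|slice_expect k (fun x => psi (cube_eval f x))
          - cube_expect p (fun x => psi (cube_eval f x))| <= c p * (C * delta) /\
        (`|(slice_expect k (fun x => psi (cube_eval f x)))%:E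
          - 'E_(gauss p n)[fun x => psi (tuple_eval f x)]|
          <= (c p * (C * delta))%:E)%E.
Proof.
(* N = 1 excludes n = 0, so that k = pn is positive. The denominator p^2 in the last witness matches
   the term 2 (8/p)^2 of the replacement error. *)
exists 6; split => //; exists (fun p => 2 ^+ 27 / p ^+ 3), (fun=> 1), (fun p => 2 ^+ 13 / p ^+ 2).
have itv_gt0 (p : R) : p \in `]0, 2^-1] -> 0 < p by rewrite in_itv /= => /andP[].
have cont (a : R) m : {within [set` `]0, 2^-1]], continuous (fun p : R => a / p ^+ m)}.
  apply: continuous_in_subspaceT => p; rewrite inE /= => /itv_gt0 p0.
  apply: cvgM; first exact: cvg_cst.
  by apply: cvgV; [rewrite gt_eqF// exprn_gt0|exact: exprn_continuous].
split; first by move=> p /itv_gt0 p0; rewrite divr_gt0 ?exprn_gt0.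
split; first exact: cont.
split; first by apply: continuous_subspaceT => ?; exact: cvg_cst.
split; first exact: cont.
move=> p n k d f tau delta p_itv pn n1 mf hf fd var1 inf d0 dk tauP nd C psi lip.
have p01 : 0 < p <= 1 / 2 by move: p_itv; rewrite in_itv /= mul1r.
have [p0 p1] := andP p01.
have k_gt0 : (0 < k)%N by rewrite -(ltr0n R) -pn mulr_gt0// (lt_le_trans ltr01).
have p6 : delta `^ 6 = delta ^+ 6 by rewrite powR_mulrn// ltW.
rewrite !p6 in tauP nd.
set c := mcoef f; set I := 2 ^+ 27 / p ^+ 3 in tauP nd *.
have hc : harmonic c by exact: harmonic_mcoef.
have dc : degree_le d c by rewrite -fd; exact: degree_le_mcoef.
have kn : (k < n)%N by exact: k_lt_n p01 pn k_gt0.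
have fE : cube_eval f = feval c by apply/funext => x; exact: cube_evalE.
have C0 := lipschitz_cst_ge0 lip; have Q0 : 0 <= C * delta by rewrite mulr_ge0// ltW.
rewrite (gauss_expectation p01 lip mf hf) -/c.
have -> : (fun x => psi (cube_eval f x)) = psi \o feval c by rewrite fE.
rewrite slice_expectE; last exact: ltnW.
set s := order_avg _ k; set q := cube_expect _ _; set g := Rintegral _ _ _.
suff [sq_le sg_le] : `|s - q| <= 2 ^+ 13 / p ^+ 2 * (C * delta) /\
    `|s - g| <= 2 ^+ 13 / p ^+ 2 * (C * delta).
  by split=> //; rewrite -lee_fin in sg_le.
have pp : 0 < p ^+ 2 by rewrite exprn_gt0.
have split_error a : a <= 2 ^+ 13 / p ^+ 2 -> forall r, r <= a * (C * delta) ->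
    r <= 2 ^+ 13 / p ^+ 2 * (C * delta).
  by move=> ha r /le_trans; apply; rewrite ler_wpM2r.
have var1' : (d <= k)%N -> order_avg (fun x => feval (nonconstant c) x ^+ 2) k <= 1.
  by move=> dk'; rewrite -(slice_var_nonconstant hc dc (leq_trans dk' (ltnW kn)) kn) -fE.
(* For delta > 1 the three expectations are each within 5 C delta of psi at the mean, because all
   three variances are at most 4 delta^2. Here d <= k comes from the hypothesis. *)
have [d1|d1] := leP delta 1; last first.
  have {}dk : (d <= k)%N by case: dk => // /(lt_le_trans d1); rewrite ltxx.
  have {var1'}var1 := var1' dk.
  have W4 : wnorm (p * (1 - p)) (nonconstant c) <= 4 * delta ^+ 2.
    apply: (wnorm_nonconstant_le_delta p01 pn k_gt0 hc dc var1 d1 dk _ nd).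
    by rewrite /I ler_wpM2l ?exprn_ge0// lef_pV2 ?posrE ?exprn_gt0// exprS ler_piMr ?ltW//; nra.
  have near_mean r W : `|r - psi (c finset.set0)| <= C * delta + C / delta * W ->
      W <= 4 * delta ^+ 2 -> `|r - psi (c finset.set0)| <= 5 * (C * delta).
    move=> h WW; apply: (le_trans h); rewrite (_ : 5 * _ = C * delta + C / delta * (4 * delta ^+ 2)).
      by rewrite lerD2l ler_wpM2l// divr_ge0// ltW.
    by field; rewrite gt_eqF.
  have one_le : 1 <= 4 * delta ^+ 2 by have := exprn_ege1 2 (ltW d1); lra.
  have hs := near_mean _ _ (slice_lipschitz lip c k d0) (le_trans var1 one_le).
  have hq := near_mean _ _ (cube_lipschitz lip p01 hc d0) W4.
  have hg := near_mean _ _ (gauss_lipschitz p01 lip c d0) W4.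
  have ten : 10 <= 2 ^+ 13 / p ^+ 2 :> R by rewrite ler_pdivlMr//; nra.
  split; apply: (split_error _ ten).
    apply: (le_trans (ler_distD (psi (c finset.set0)) _ _)).
    by rewrite [X in _ + X]distrC (le_trans (lerD hs hq))//; lra.
  apply: (le_trans (ler_distD (psi (c finset.set0)) _ _)).
  by rewrite [X in _ + X]distrC (le_trans (lerD hs hg))//; lra.
have [Ip1 Ip2 Ip3] := base_bounds p01.
have nI : I ^+ d <= n%:R.
  apply: le_trans nd; rewrite ler_pdivlMr ?exprn_gt0// ler_piMr ?exprn_ile1 ?(ltW d0)//.
  by rewrite exprn_ge0// (le_trans _ Ip2).
(* For positive d, 2 d^2 <= 8^d <= p I^d <= pn = k, using p I >= 8. *)
have dk2 : (2 * d ^ 2 <= k)%N.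
  case: (d) nI => [//|m] nI; apply: (@leq_trans (8 ^ m.+1)).
    have -> : (8 ^ m.+1 = 2 ^ m.+1 * (2 ^ m.+1 * 2 ^ m.+1))%N by rewrite -!expnMn.
    have m2 : (m < 2 ^ m.+1)%N by rewrite ltnW//; exact: ltn_expl.
    by rewrite -mulnn !leq_mul// expnS -{1}[2%N]muln1 leq_mul// expn_gt0.
  rewrite -(ler_nat R) -pn natrX; apply: (@le_trans _ _ (p * I ^+ m.+1)); last by rewrite ler_wpM2l ?(ltW p0).
  rewrite exprS [I ^+ _]exprS mulrA ler_pM ?exprn_ge0//; first by rewrite mulrC -ler_pdivrMr.
  by rewrite lerXn2r ?nnegrE// (le_trans _ Ip2)// ler_nat.
have {}dk : (d <= k)%N by exact: leq_trans (leq_double_sqr d) dk2.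
have {var1'}var1 := var1' dk.
have sq : `|s - q| <= (1 + 10 / p) * (C * delta).
  apply: (slice_vs_cube p01 pn k_gt0 hc dc var1 lip _ dk2); first by rewrite d0.
  by apply: le_trans nd; rewrite ler_wpM2r ?invr_ge0 ?exprn_ge0 ?(ltW d0)// lerXn2r ?nnegrE// (le_trans _ Ip2).
(* Both kinds of influence yield the same bound. The slice version loses 2 * 4 from harmonicity and
   norm comparison; the cube version holds because p(1-p) <= 1/4. *)
have infl i : p * (1 - p) * wnorm (p * (1 - p)) (cderiv i c) <= 8 * tau.
  have s20 := s2_gt0 p01.
  case: inf => [/(_ i)|/(_ i)] h; last first.
    rewrite (cube_infE i p mf hf) -/c in h.
    have w0 := wnorm_ge0 (cderiv i c) (ltW s20).
    by have := sqr_ge0 (p - 1 / 2); nra.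
  apply: (le_trans (@wnorm_cderiv_slice _ _ p k d i c 4 p01 pn hc dc dk k_gt0 _)).
    by move=> e ed; exact: (ratio_4 p01 pn k_gt0 dk2 ed).
  rewrite (_ : 2 * 4 = 8) ?ler_wpM2l//; last by ring.
  by apply: le_trans h; rewrite /slice_inf /slice_inf2 fE.
have qg : `|q - g| <= (20 + 32 * (8 / p + 2 * (8 / p) ^+ 2)) * (C * delta).
  apply: (cube_vs_gauss_influence p01 pn k_gt0 hc dc var1 lip d0 dk2 infl).
  have b_gt0 : 0 < 4 * (8 / p) ^+ 3 by rewrite mulr_gt0// exprn_gt0// divr_gt0.
  have I_gt0 : 0 < I := lt_le_trans b_gt0 Ip3.
  apply: (le_trans tauP); rewrite ler_wpM2r ?exprn_ge0 ?(ltW d0)// lef_pV2 ?posrE ?exprn_gt0//.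
  by rewrite lerXn2r ?nnegrE// ltW.
(* After multiplication by p^2 the left side is below 4096 + 266/2 + 21/4, while the right side is
   8192. *)
have total : 1 + 10 / p + (20 + 32 * (8 / p + 2 * (8 / p) ^+ 2)) <= 2 ^+ 13 / p ^+ 2.
  rewrite ler_pdivlMr// [leLHS](_ : _ = 21 * p ^+ 2 + 266 * p + 4096); last by field; rewrite gt_eqF.
  nra.
have b0 : 0 <= 20 + 32 * (8 / p + 2 * (8 / p) ^+ 2) by have := divr_ge0 (ler0n R 8) (ltW p0); nra.
split; apply: (split_error _ total); rewrite mulrDl.
  by apply: (le_trans sq); rewrite lerDl mulr_ge0.
exact: le_trans (ler_distD q _ _) (lerD sq qg).
Qed.
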